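(* There exist a sequence $\{F_n\}_{n\ge0}$ of holomorphic automorphisms of $\mathbb{C}^2$, each having an attracting fixed point at the origin, such that the non-autonomous basin of attraction \[ \Omega_{\{F_n\}}=\{z\in\mathbb{C}^2 : F_n\circ\cdots\circ F_0(z)\to0 \text{ as } n\to\infty\} \] is a Short $\mathbb{C}^2$ whose boundary is $C^\infty$-smooth.
   Context: A Short $\mathbb{C}^2$ is a domain $\Omega\subset\mathbb{C}^2$ such that: (1) $\Omega=\bigcup_{j\ge1}\Omega_j$ with $\Omega_j\subset\Omega_{j+1}$ and each $\Omega_j$ biholomorphic to the unit ball of $\mathbb{C}^2$; (2) the infinitesimal Kobayashi pseudometric of $\Omega$ vanishes identically; (3) $\Omega$ carries a non-constant plurisubharmonic function that is bounded above. *)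

(* Defs.v *)
From mathcomp Require Import all_boot all_algebra.
From mathcomp Require Import all_classical all_reals all_analysis.
From mathcomp Require Import Rstruct Rstruct_topology.
From Stdlib Require Import Reals.
From Coquelicot Require Import Coquelicot.

Set Implicit Arguments.
Unset Strict Implicit.
Unset Printing Implicit Defensive.

Definition C2 : Type := (C * C)%type.
Definition C2h : NormedModule C_AbsRing :=
  prod_NormedModule C_AbsRing C_NormedModule C_NormedModule.
Definition C2r : NormedModule R_AbsRing :=
  prod_NormedModule R_AbsRing C_R_NormedModule C_R_NormedModule.

Definition zero2 : C2 := (RtoC 0%R, RtoC 0%R).

Definition cline (a b : C2) (zeta : C) : C2 :=
  (Cplus (fst a) (Cmult zeta (fst b)), Cplus (snd a) (Cmult zeta (snd b))).

Definition openC2 (U : C2 -> Prop) : Prop := @Coquelicot.Hierarchy.open C2h U.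

(* f is holomorphic on U: complex (Frechet) differentiable at each point of U,
   i.e. differentiable with a C-linear differential *)
Definition holo_on (U : C2 -> Prop) (f : C2 -> C2) : Prop :=
  forall z : C2, U z -> @ex_filterdiff C_AbsRing C2h C2h f (Hierarchy.locally (z : C2h)).

Definition holo_automorphism (F : C2 -> C2) : Prop :=
  exists G : C2 -> C2,
    holo_on (fun _ => True) F /\ holo_on (fun _ => True) G /\
    (forall z, G (F z) = z) /\ (forall z, F (G z) = z).

Definition attracting_fixed_origin (F : C2 -> C2) : Prop :=
  F zero2 = zero2 /\
  exists L : C2 -> C2,
    @filterdiff C_AbsRing C2h C2h F (Hierarchy.locally (zero2 : C2h)) L /\
    forall (lam : C) (v : C2), v <> zero2 ->
      L v = @scal C_AbsRing C2h lam v -> (Cmod lam < 1)%R.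

Fixpoint ncomp (F : nat -> C2 -> C2) (n : nat) (z : C2) : C2 :=
  match n with
  | O => F O z
  | S m => F (S m) (ncomp F m z)
  end.

Definition basin (F : nat -> C2 -> C2) (z : C2) : Prop :=
  filterlim (fun n => ncomp F n z) eventually (Hierarchy.locally (zero2 : C2h)).

Definition ball2 (z : C2) : Prop :=
  (Cmod (fst z) ^ 2 + Cmod (snd z) ^ 2 < 1)%R.

Definition biholo_to_ball (U : C2 -> Prop) : Prop :=
  openC2 U /\
  exists phi psi : C2 -> C2,
    holo_on U phi /\ holo_on ball2 psi /\
    (forall z, U z -> ball2 (phi z) /\ psi (phi z) = z) /\
    (forall w, ball2 w -> U (psi w) /\ phi (psi w) = w).

Definition hderiv (f : C -> C2) (zeta : C) (w : C2) : Prop :=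
  @filterdiff C_AbsRing C_NormedModule C2h f (Hierarchy.locally zeta)
    (fun h : C => @scal C_AbsRing C2h h w).

Definition holo_disc (Om : C2 -> Prop) (f : C -> C2) : Prop :=
  forall zeta : C, (Cmod zeta < 1)%R ->
    Om (f zeta) /\ @ex_filterdiff C_AbsRing C_NormedModule C2h f (Hierarchy.locally zeta).

Definition kobayashi (Om : C2 -> Prop) (p v : C2) : Rbar :=
  Glb_Rbar (fun r : R => exists (a : C) (f : C -> C2) (w : C2),
     r = Cmod a /\ holo_disc Om f /\ f (RtoC 0%R) = p /\
     hderiv f (RtoC 0%R) w /\ @scal C_AbsRing C2h a w = v).

Definition usc_on (Om : C2 -> Prop) (u : C2 -> \bar R) : Prop :=
  forall z : C2, Om z -> forall c : R, (u z < c%:E)%E ->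
    Hierarchy.locally (z : C2h) (fun w => (u w < c%:E)%E).

Definition psh_on (Om : C2 -> Prop) (u : C2 -> \bar R) : Prop :=
  (forall z, Om z -> u z <> +oo%E) /\
  usc_on Om u /\
  forall a b : C2,
    (forall zeta : C, (Cmod zeta <= 1)%R -> Om (cline a b zeta)) ->
    (u a <= ((/ (2 * PI))%R)%:E *
       \int[@lebesgue_measure R]_(t in `[0%R, (2 * PI)%R]%classic)
          u (cline a b (cos t, sin t)))%E.

Definition short_C2 (Om : C2 -> Prop) : Prop :=
  (exists Oj : nat -> C2 -> Prop,
      (forall j z, Oj j z -> Oj (S j) z) /\
      (forall z, Om z <-> exists j, Oj j z) /\
      (forall j, biholo_to_ball (Oj j))) /\
  (forall p v : C2, Om p -> kobayashi Om p v = Finite 0%R) /\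
  (exists u : C2 -> \bar R,
      psh_on Om u /\
      (exists M : R, forall z, Om z -> (u z <= M%:E)%E) /\
      (exists z1 z2 : C2, Om z1 /\ Om z2 /\ u z1 <> u z2)).

Definition dirderiv (rho : C2 -> R) (e : C2) (z : C2) : R :=
  Derive (fun t : R => rho (@plus C2r z (@scal R_AbsRing C2r t e))) 0%R.

Fixpoint Ck (k : nat) (V : C2 -> Prop) (rho : C2 -> R) : Prop :=
  match k with
  | O => forall z, V z -> Continuity.continuous (rho : C2h -> R_UniformSpace) z
  | S k' => (forall z, V z -> Continuity.continuous (rho : C2h -> R_UniformSpace) z) /\
            forall e : C2,
              (forall z, V z ->
                 ex_derive (fun t : R => rho (@plus C2r z (@scal R_AbsRing C2r t e))) 0%R) /\
              Ck k' V (dirderiv rho e)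
  end.

Definition smooth_on (V : C2 -> Prop) (rho : C2 -> R) : Prop :=
  forall k, Ck k V rho.

Definition bdry (Om : C2 -> Prop) (p : C2) : Prop :=
  (forall P, Hierarchy.locally (p : C2h) P -> exists z, Om z /\ P z) /\
  ~ (Hierarchy.locally (p : C2h) Om).

Definition smooth_boundary (Om : C2 -> Prop) : Prop :=
  forall p, bdry Om p ->
    exists (V : C2 -> Prop) (rho : C2 -> R),
      openC2 V /\ V p /\ smooth_on V rho /\
      (exists e : C2, dirderiv rho e p <> 0%R) /\
      (forall z, V z -> (Om z <-> (rho z < 0)%R)).

(* Main.v *)
Require Import Defs.
From Stdlib Require Import Reals Lra Lia List Classical.
From Coquelicot Require Import Coquelicot.

(** Take F_n(z, w) = (z^2 + a_n w, a_n z) with a_n = 32^(-2^n), and write (z_n, w_n) for the orbit.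
    The ball of radius 1/2 is mapped into itself and attracted to 0, so the basin is the increasing
    union of its preimages. The differential of the n-th iterate tends to 0 along orbits of the
    basin, so pulling back affine discs from the n-th stage makes the Kobayashi metric vanish.
    The functions 2^-n log(2 max(|z_n|, |w_n|, a_n)) are plurisubharmonic, decreasing in n, and
    bounded below because a_n^(2^-n) is constant; their limit is <= 0 on the basin and
    takes different values at 0 and (1/4, 0).
    A point outside the basin eventually satisfies |w_n| < |z_n| and |z_n| > 3/4. Near it
    z_(k+1) = z_k^2 (1 + eps_k) with |eps_k| <= 1/4 for all k >= n, so 2^-k log|z_k| converges
    geometrically to a function that is negative exactly on the basin. This limit is
    smooth, being a uniform limit of real parts of polynomials (Cauchy estimates), and its
    differential does not vanish because eps_k is tiny on the boundary. *)

Local Open Scope R_scope.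

(** * Polynomials in one variable *)

(** The term [a_n w] makes the squaring map invertible on the plane, and its size is squeezed from
    two sides. A finite plurisubharmonic limit asks that [a_n^(2^-n)] stay away from 0. A smooth
    boundary asks that the perturbation of [z^2] be so weak that [z_n] has no zeros near the
    boundary and that the logarithmic derivative of [z_n] almost exactly doubles at each step. Both
    hold when [a_(n+1) = a_n^2] with a small start. Zeros of [z_n] stay away from the boundary
    because [w] is so strongly contracted that an orbit not tending to 0 must be dominated by [z_n]
    from some stage on. All function theory is done on polynomials: the iterates and their inverses
    are polynomial maps, and Cauchy estimates, the maximum principle and Jensen's inequality come
    from averaging over sufficiently many roots of unity. The functions that are not polynomial,
    [1 / z_k] and [log |z_k|], enter as uniform limits of polynomials or of their real parts, on a
    polydisc that does not shrink with [k]. *)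

Fixpoint peval (l : list C) (z : C) : C :=
  match l with
  | nil => RtoC 0
  | c :: l' => Cplus c (Cmult z (peval l' z))
  end.

Definition ispoly (q : C -> C) : Prop := exists l, forall z, q z = peval l z.

Lemma ispoly_ext (p q : C -> C) : (forall z, p z = q z) -> ispoly p -> ispoly q.
Proof. intros H [l Hl]. exists l. intros z. now rewrite <- H. Qed.

Lemma ispoly_const (c : C) : ispoly (fun _ => c).
Proof. exists (c :: nil). intros z. simpl. ring. Qed.

Lemma ispoly_cons (c : C) (q : C -> C) : ispoly q -> ispoly (fun z => c + z * q z)%C.
Proof. intros [l Hl]. exists (c :: l). intros z. simpl. now rewrite Hl. Qed.

Lemma ispoly_plus (p q : C -> C) : ispoly p -> ispoly q -> ispoly (fun z => p z + q z)%C.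
Proof.
  intros [l Hl] [l' Hl'].
  apply (ispoly_ext (fun z => peval l z + peval l' z)%C).
  { intros z. now rewrite Hl, Hl'. }
  clear p q Hl Hl'. revert l'. induction l as [|c l IH]; intros l'.
  - exists l'. intros z. simpl. ring.
  - destruct l' as [|c' l'].
    + exists (c :: l). intros z. simpl. ring.
    + destruct (IH l') as [m Hm]. exists (Cplus c c' :: m).
      intros z. simpl. rewrite <- Hm. ring.
Qed.

Lemma ispoly_scal (c : C) (q : C -> C) : ispoly q -> ispoly (fun z => c * q z)%C.
Proof.
  intros [l Hl]. exists (map (Cmult c) l). intros z. rewrite Hl. clear Hl.
  induction l as [|a l IH]; simpl; [ring|]. rewrite <- IH. ring.
Qed.

Lemma ispoly_mult (p q : C -> C) : ispoly p -> ispoly q -> ispoly (fun z => p z * q z)%C.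
Proof.
  intros [l Hl] Hq.
  apply (ispoly_ext (fun z => peval l z * q z)%C).
  { intros z. now rewrite Hl. }
  clear p Hl. induction l as [|c l IH].
  - apply (ispoly_ext (fun _ => RtoC 0)); [intros; simpl; ring | apply ispoly_const].
  - apply (ispoly_ext (fun z => c * q z + (RtoC 0 + z * (peval l z * q z)))%C).
    + intros z. simpl. ring.
    + apply ispoly_plus; [now apply ispoly_scal | now apply ispoly_cons].
Qed.

(** * Averages over roots of unity and coefficient estimates *)

Definition cis (x : R) : C := (cos x, sin x).

Lemma cis_plus (x y : R) : cis (x + y) = (cis x * cis y)%C.
Proof. unfold cis, Cmult; simpl. rewrite cos_plus, sin_plus. f_equal; ring. Qed.

Lemma cis_0 : cis 0 = RtoC 1.
Proof. unfold cis. now rewrite cos_0, sin_0. Qed.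

Lemma cis_opp (x : R) : cis (- x) = Cconj (cis x).
Proof. unfold cis, Cconj; simpl. now rewrite cos_neg, sin_antisym. Qed.

Lemma Cmod_cis (x : R) : Cmod (cis x) = 1.
Proof.
  unfold Cmod, cis; simpl. rewrite !Rmult_1_r.
  replace (cos x * cos x + sin x * sin x) with 1; [apply sqrt_1|].
  generalize (sin2_cos2 x). unfold Rsqr. lra.
Qed.

Lemma cis_2PI (k : nat) : cis (2 * PI * INR k) = RtoC 1.
Proof.
  unfold cis. replace (2 * PI * INR k) with (0 + 2 * INR k * PI) by ring.
  now rewrite cos_period, sin_period, cos_0, sin_0.
Qed.

Lemma cis_neq_1 (x : R) : 0 < x < 2 * PI -> cis x <> RtoC 1.
Proof.
  intros Hx H. apply (f_equal fst) in H. simpl in H.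
  assert (Hs : 0 < sin (x / 2)) by (apply sin_gt_0; lra).
  replace x with (2 * (x / 2)) in H by field.
  rewrite cos_2a_sin in H. nra.
Qed.

Fixpoint Csum (h : nat -> C) (n : nat) : C :=
  match n with
  | O => RtoC 0
  | S m => Cplus (Csum h m) (h m)
  end.

Lemma Csum_ext (h g : nat -> C) (n : nat) :
  (forall j, (j < n)%nat -> h j = g j) -> Csum h n = Csum g n.
Proof.
  induction n as [|n IH]; intros H; simpl; [easy|].
  rewrite IH, H; auto.
Qed.

Lemma Csum_plus (h g : nat -> C) (n : nat) :
  Csum (fun j => h j + g j)%C n = (Csum h n + Csum g n)%C.
Proof. induction n as [|n IH]; simpl; [ring|]. rewrite IH. ring. Qed.

Lemma Csum_scal (c : C) (h : nat -> C) (n : nat) :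
  Csum (fun j => c * h j)%C n = (c * Csum h n)%C.
Proof. induction n as [|n IH]; simpl; [ring|]. rewrite IH. ring. Qed.

Lemma Csum_conj (h : nat -> C) (n : nat) :
  Csum (fun j => Cconj (h j)) n = Cconj (Csum h n).
Proof.
  induction n as [|n IH]; simpl.
  - unfold Cconj, RtoC; simpl. f_equal; ring.
  - rewrite IH. unfold Cconj, Cplus; simpl. f_equal; ring.
Qed.

Lemma Csum_const (c : C) (n : nat) : Csum (fun _ => c) n = (RtoC (INR n) * c)%C.
Proof.
  induction n as [|n IH]; [simpl; ring|].
  rewrite S_INR, RtoC_plus. simpl Csum. rewrite IH. ring.
Qed.

Lemma Cmod_Csum (h : nat -> C) (B : R) (n : nat) :
  (forall j, (j < n)%nat -> Cmod (h j) <= B) -> Cmod (Csum h n) <= INR n * B.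
Proof.
  induction n as [|n IH]; intros H.
  - simpl. rewrite Cmod_0. lra.
  - rewrite S_INR. simpl Csum.
    eapply Rle_trans; [apply Cmod_triangle|].
    assert (Cmod (Csum h n) <= INR n * B) by auto.
    assert (Cmod (h n) <= B) by auto. lra.
Qed.

Lemma Csum_cis_geom (x : R) (n : nat) :
  ((cis x - RtoC 1) * Csum (fun j => cis (INR j * x)) n = cis (INR n * x) - RtoC 1)%C.
Proof.
  induction n as [|n IH].
  - simpl. rewrite Rmult_0_l, cis_0. ring.
  - rewrite S_INR. simpl Csum. rewrite Rmult_plus_distr_r, Rmult_1_l, cis_plus.
    rewrite Cmult_plus_distr_l, IH. ring.
Qed.

(** Discrete stand-in for the circle integral. Against frequencies below [M] it is exact, so
    Cauchy's formulas for a polynomial of small degree hold without any limit. *)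
Definition circ_sum (M : nat) (h : R -> C) : C :=
  Csum (fun j => h (2 * PI * INR j / INR M)) M.

Lemma circ_sum_ext (M : nat) (h g : R -> C) :
  (forall t, h t = g t) -> circ_sum M h = circ_sum M g.
Proof. intros H. apply Csum_ext. auto. Qed.

Lemma circ_sum_cis (M m : nat) :
  (0 < m < M)%nat -> circ_sum M (fun t => cis (INR m * t)) = RtoC 0.
Proof.
  intros Hm. unfold circ_sum.
  assert (HM : 0 < INR M) by (apply lt_0_INR; lia).
  assert (Hm0 : 0 < INR m) by (apply lt_0_INR; lia).
  assert (HmM : INR m < INR M) by (apply lt_INR; lia).
  assert (HPI := PI_RGT_0).
  set (x := 2 * PI * INR m / INR M).
  rewrite (Csum_ext _ (fun j => cis (INR j * x))).
  2:{ intros j _. f_equal. unfold x. field. lra. }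
  assert (H := Csum_cis_geom x M).
  replace (INR M * x) with (2 * PI * INR m) in H by (unfold x; field; lra).
  rewrite cis_2PI in H.
  assert (Hx : (cis x - RtoC 1)%C <> RtoC 0).
  { intros E. apply (cis_neq_1 x).
    - unfold x. split.
      + apply Rdiv_lt_0_compat; [nra|lra].
      + apply (Rmult_lt_reg_r (INR M)); [lra|].
        unfold Rdiv. rewrite Rmult_assoc, Rinv_l by lra. nra.
    - replace (cis x) with (cis x - RtoC 1 + RtoC 1)%C by ring. rewrite E. ring. }
  replace (RtoC 1 - RtoC 1)%C with (RtoC 0) in H by ring.
  destruct (classic (Csum (fun j => cis (INR j * x)) M = RtoC 0)) as [E|E]; [easy|].
  exfalso. exact (Cmult_neq_0 _ _ Hx E H).
Qed.

(** Peeling off a coefficient moves a factor [cis t] into the frequency, so the induction must let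
    [m] vary. The bound [m + length l <= M] keeps every frequency below [M], where no aliasing
    occurs. *)
Lemma circ_sum_peval_pos (M : nat) (s : R) (l : list C) (m : nat) :
  (0 < m)%nat -> (m + length l <= M)%nat ->
  circ_sum M (fun t => cis (INR m * t) * peval l (RtoC s * cis t))%C = RtoC 0.
Proof.
  revert m. induction l as [|c l IH]; intros m Hm Hl.
  - unfold circ_sum. rewrite (Csum_ext _ (fun _ => RtoC 0)).
    + rewrite Csum_const. ring.
    + intros j _. simpl. ring.
  - simpl in Hl.
    rewrite (circ_sum_ext _ _ (fun t => c * cis (INR m * t) +
       RtoC s * (cis (INR (S m) * t) * peval l (RtoC s * cis t)))%C).
    2:{ intros t. rewrite S_INR, Rmult_plus_distr_r, Rmult_1_l, cis_plus. simpl. ring. }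
    unfold circ_sum. rewrite Csum_plus, !Csum_scal.
    fold (circ_sum M (fun t => cis (INR m * t))).
    fold (circ_sum M (fun t => cis (INR (S m) * t) * peval l (RtoC s * cis t))%C).
    rewrite circ_sum_cis by lia. rewrite IH by lia. ring.
Qed.

(** Orthogonality of characters: the term of order [i] is the one of frequency 0. Lower orders have
    negative frequency and vanish by conjugating [circ_sum_cis]; higher ones vanish by
    [circ_sum_peval_pos]. *)
Lemma circ_sum_peval_coef (M : nat) (s : R) (i : nat) (l : list C) :
  (i < M)%nat -> (length l <= M)%nat ->
  circ_sum M (fun t => cis (- (INR i * t)) * peval l (RtoC s * cis t))%C
  = (RtoC (INR M) * RtoC s ^ i * nth i l (RtoC 0))%C.
Proof.
  revert l. induction i as [|i IH]; intros l Hi Hl.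
  - destruct l as [|c l].
    + unfold circ_sum. rewrite (Csum_ext _ (fun _ => RtoC 0)).
      * rewrite Csum_const. simpl. ring.
      * intros j _. simpl. ring.
    + simpl in Hl.
      rewrite (circ_sum_ext _ _ (fun t => c +
         RtoC s * (cis (INR 1 * t) * peval l (RtoC s * cis t)))%C).
      2:{ intros t. simpl. rewrite Rmult_0_l, Ropp_0, cis_0, Rmult_1_l. ring. }
      unfold circ_sum. rewrite Csum_plus, Csum_const, Csum_scal.
      fold (circ_sum M (fun t => cis (INR 1 * t) * peval l (RtoC s * cis t))%C).
      rewrite circ_sum_peval_pos by lia. simpl. ring.
  - destruct l as [|c l].
    + unfold circ_sum. rewrite (Csum_ext _ (fun _ => RtoC 0)).
      * rewrite Csum_const. simpl. ring.
      * intros j _. simpl. ring.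
    + simpl in Hl.
      rewrite (circ_sum_ext _ _ (fun t => c * Cconj (cis (INR (S i) * t)) +
         RtoC s * (cis (- (INR i * t)) * peval l (RtoC s * cis t)))%C).
      2:{ intros t. rewrite <- cis_opp.
          replace (- (INR i * t)) with (- (INR (S i) * t) + t) by (rewrite S_INR; ring).
          rewrite cis_plus. simpl peval. ring. }
      unfold circ_sum. rewrite Csum_plus, !Csum_scal, Csum_conj.
      fold (circ_sum M (fun t => cis (INR (S i) * t))).
      fold (circ_sum M (fun t => cis (- (INR i * t)) * peval l (RtoC s * cis t))%C).
      rewrite circ_sum_cis by lia. rewrite IH by lia. simpl nth. rewrite Cpow_S.
      replace (Cconj (RtoC 0)) with (RtoC 0)
        by (unfold Cconj, RtoC; simpl; f_equal; ring).
      ring.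
Qed.

Lemma Cpow_RtoC (s : R) (i : nat) : (RtoC s ^ i)%C = RtoC (s ^ i).
Proof. induction i as [|i IH]; simpl; [easy|]. now rewrite IH, RtoC_mult. Qed.

(** The constant coefficient is the mean of the values at [S (length l)] equally spaced points of
    the circle. *)
Lemma peval_max_principle (l : list C) (B : R) :
  (forall t, Cmod (peval l (cis t)) <= B) -> Cmod (peval l (RtoC 0)) <= B.
Proof.
  intros H. set (M := S (length l)).
  assert (HM : 0 < INR M) by (apply lt_0_INR; unfold M; lia).
  assert (E := circ_sum_peval_coef M 1 0 l ltac:(unfold M; lia) ltac:(unfold M; lia)).
  assert (E0 : peval l (RtoC 0) = nth 0 l (RtoC 0)) by (destruct l; simpl; ring).
  rewrite E0. apply (Rmult_le_reg_l (INR M)); [easy|].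
  replace (INR M * Cmod (nth 0 l (RtoC 0)))
    with (Cmod (RtoC (INR M) * RtoC 1 ^ 0 * nth 0 l (RtoC 0))%C).
  - rewrite <- E. apply Cmod_Csum. intros j _.
    rewrite Cmod_mult, Cmod_cis, Cmult_1_l, Rmult_1_l. apply H.
  - rewrite !Cmod_mult. change (RtoC 1 ^ 0)%C with (RtoC 1). rewrite Cmod_1, Cmod_R, Rabs_pos_eq; [ring|apply Rlt_le; exact HM].
Qed.

(* Averaging [cis (- i t) * Re q] isolates half the coefficient because the
   conjugate polynomial only has nonpositive frequencies. *)
Lemma peval_coef_bound (l : list C) (s B : R) (i : nat) :
  0 <= s -> (0 < i)%nat ->
  (forall t, Rabs (Re (peval l (RtoC s * cis t)%C)) <= B) ->
  Cmod (nth i l (RtoC 0)) * s ^ i <= 2 * B.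
Proof.
  intros Hs Hi H. set (M := (i + S (length l))%nat).
  assert (HM : 0 < INR M) by (apply lt_0_INR; unfold M; lia).
  assert (E := circ_sum_peval_coef M s i l ltac:(unfold M; lia) ltac:(unfold M; lia)).
  assert (E' := circ_sum_peval_pos M s l i Hi ltac:(unfold M; lia)).
  assert (E2 : circ_sum M (fun t => cis (- (INR i * t)) *
                 RtoC (2 * Re (peval l (RtoC s * cis t)%C)))%C
               = (RtoC (INR M) * RtoC s ^ i * nth i l (RtoC 0))%C).
  { rewrite (circ_sum_ext _ _ (fun t =>
      cis (- (INR i * t)) * peval l (RtoC s * cis t) +
      Cconj (cis (INR i * t) * peval l (RtoC s * cis t)))%C).
    - unfold circ_sum. rewrite Csum_plus, Csum_conj.
      fold (circ_sum M (fun t => cis (- (INR i * t)) * peval l (RtoC s * cis t))%C).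
      fold (circ_sum M (fun t => cis (INR i * t) * peval l (RtoC s * cis t))%C).
      rewrite E, E'.
      replace (Cconj (RtoC 0)) with (RtoC 0)
        by (unfold Cconj, RtoC; simpl; f_equal; ring).
      ring.
    - intros t. rewrite Cmult_conj, <- cis_opp, <- Cmult_plus_distr_l. f_equal.
      destruct (peval l (RtoC s * cis t)%C) as [u v].
      unfold Cconj, Cplus, RtoC, Re; simpl. f_equal; ring. }
  apply (Rmult_le_reg_l (INR M)); [easy|].
  replace (INR M * (Cmod (nth i l (RtoC 0)) * s ^ i))
    with (Cmod (RtoC (INR M) * RtoC s ^ i * nth i l (RtoC 0))%C).
  - rewrite <- E2. apply Cmod_Csum. intros j _.
    rewrite Cmod_mult, Cmod_cis, Rmult_1_l, Cmod_R, Rabs_mult, (Rabs_pos_eq 2) by lra.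
    apply Rmult_le_compat_l; [lra|]. apply H.
  - rewrite Cpow_RtoC, !Cmod_mult, !Cmod_R, !Rabs_pos_eq; [ring | now apply pow_le | lra].
Qed.

(** * Uniform limits of real parts of polynomials *)

(** The constructor [polyfun_ext] closes the class under pointwise equality, so that compositions
    and iterates belong to it without being written literally as sums and products. *)
Inductive polyfun : (C2 -> C) -> Prop :=
| polyfun_const (c : C) : polyfun (fun _ => c)
| polyfun_fst : polyfun fst
| polyfun_snd : polyfun snd
| polyfun_plus f g : polyfun f -> polyfun g -> polyfun (fun z => f z + g z)%C
| polyfun_mult f g : polyfun f -> polyfun g -> polyfun (fun z => f z * g z)%C
| polyfun_ext f g : (forall z, f z = g z) -> polyfun f -> polyfun g.

Definition polydisc (p : C2) (r : R) (z : C2) : Prop :=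
  Cmod (fst z - fst p)%C < r /\ Cmod (snd z - snd p)%C < r.

(** [D] is the complex derivative of [P] along [e]. The second-order quotient [A] is asked to be
    polynomial in [zeta], so that [peval_coef_bound] applies to the restriction of [P] to a complex
    line. *)
Definition is_dirD (P : C2 -> C) (e : C2) (D : C2 -> C) : Prop :=
  polyfun D /\
  forall z, exists A, ispoly A /\
    forall zeta, P (cline z e zeta) = (P z + zeta * (D z + zeta * A zeta))%C.

Lemma polyfun_dirD (P : C2 -> C) (e : C2) : polyfun P -> exists D, is_dirD P e D.
Proof.
  induction 1 as [c| | |f g _ [D [HD H]] _ [E [HE H']]|f g Hf [D [HD H]] Hg [E [HE H']]
                 |f g Hfg _ [D [HD H]]].
  - exists (fun _ => RtoC 0). split; [constructor|]. intros z.
    exists (fun _ => RtoC 0). split; [apply ispoly_const|]. intros zeta. ring.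
  - exists (fun _ => fst e). split; [constructor|]. intros z.
    exists (fun _ => RtoC 0). split; [apply ispoly_const|].
    intros zeta. unfold cline; simpl. ring.
  - exists (fun _ => snd e). split; [constructor|]. intros z.
    exists (fun _ => RtoC 0). split; [apply ispoly_const|].
    intros zeta. unfold cline; simpl. ring.
  - exists (fun z => D z + E z)%C. split; [now constructor|]. intros z.
    destruct (H z) as [A [HA EA]], (H' z) as [B [HB EB]].
    exists (fun t => A t + B t)%C. split; [now apply ispoly_plus|].
    intros zeta. rewrite EA, EB. ring.
  - exists (fun z => f z * E z + D z * g z)%C.
    split; [repeat constructor; assumption|]. intros z.
    destruct (H z) as [A [HA EA]], (H' z) as [B [HB EB]].
    exists (fun t => ((f z * B t + g z * A t) + D z * E z) +
       (RtoC 0 + t * ((D z * B t + E z * A t) + (RtoC 0 + t * (A t * B t)))))%C.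
    split.
    + apply ispoly_plus; [apply ispoly_plus|].
      * apply ispoly_plus; now apply ispoly_scal.
      * apply ispoly_const.
      * apply ispoly_cons. apply ispoly_plus.
        -- apply ispoly_plus; now apply ispoly_scal.
        -- apply ispoly_cons. now apply ispoly_mult.
    + intros zeta. rewrite EA, EB. ring.
  - exists D. split; [easy|]. intros z. destruct (H z) as [A [HA EA]].
    exists A. split; [easy|]. intros zeta. now rewrite <- !Hfg.
Qed.

Lemma polyfun_bound (P : C2 -> C) (p : C2) (r : R) :
  polyfun P -> exists M, 0 <= M /\ forall z, polydisc p r z -> Cmod (P z) <= M.
Proof.
  assert (HC : forall x y : C, Cmod (x - y)%C < r -> Cmod x <= Cmod y + Rabs r).
  { intros x y H. replace x with (y + (x - y))%C by ring.
    eapply Rle_trans; [apply Cmod_triangle|]. assert (Hr := Rle_abs r). lra. }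
  induction 1 as [c| | |f g _ [M [HM H]] _ [M' [HM' H']]|f g _ [M [HM H]] _ [M' [HM' H']]
                 |f g Hfg _ [M [HM H]]].
  - exists (Cmod c). split; [apply Cmod_ge_0|]. intros; lra.
  - exists (Cmod (fst p) + Rabs r). split.
    + assert (H1 := Cmod_ge_0 (fst p)). assert (H2 := Rabs_pos r). lra.
    + intros z [Hz _]. auto.
  - exists (Cmod (snd p) + Rabs r). split.
    + assert (H1 := Cmod_ge_0 (snd p)). assert (H2 := Rabs_pos r). lra.
    + intros z [_ Hz]. auto.
  - exists (M + M'). split; [lra|]. intros z Hz.
    eapply Rle_trans; [apply Cmod_triangle|]. apply Rplus_le_compat; auto.
  - exists (M * M'). split; [nra|]. intros z Hz. rewrite Cmod_mult.
    apply Rmult_le_compat; auto using Cmod_ge_0.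
  - exists M. split; [easy|]. intros z Hz. rewrite <- Hfg. auto.
Qed.

Definition cplus2 (p v : C2) : C2 := (fst p + fst v, snd p + snd v)%C.

Definition cmod2 (v : C2) : R := Cmod (fst v) + Cmod (snd v).

Lemma cmod2_ge_0 (v : C2) : 0 <= cmod2 v.
Proof. unfold cmod2. assert (H := Cmod_ge_0 (fst v)). assert (H' := Cmod_ge_0 (snd v)). lra. Qed.

(** Structural induction on [P]. Restricting to [cmod2 v <= 1] lets the terms of order three and
    four in a product be absorbed into the quadratic bound. *)
Lemma polyfun_expand (P : C2 -> C) (p : C2) :
  polyfun P -> exists (A B : C) (K : R), 0 <= K /\
    forall v, cmod2 v <= 1 ->
      Cmod (P (cplus2 p v) - P p - (A * fst v + B * snd v))%C <= K * cmod2 v ^ 2.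
Proof.
  induction 1 as [c| | |f g _ [A [B [K [HK H]]]] _ [A' [B' [K' [HK' H']]]]
                 |f g _ [A [B [K [HK H]]]] _ [A' [B' [K' [HK' H']]]]
                 |f g Hfg _ [A [B [K [HK H]]]]].
  - exists (RtoC 0), (RtoC 0), 0. split; [lra|]. intros v _.
    replace (c - c - (RtoC 0 * fst v + RtoC 0 * snd v))%C with (RtoC 0) by ring.
    rewrite Cmod_0. lra.
  - exists (RtoC 1), (RtoC 0), 0. split; [lra|]. intros v _. simpl fst.
    replace (fst p + fst v - fst p - (RtoC 1 * fst v + RtoC 0 * snd v))%C
      with (RtoC 0) by ring.
    rewrite Cmod_0. lra.
  - exists (RtoC 0), (RtoC 1), 0. split; [lra|]. intros v _. simpl snd.
    replace (snd p + snd v - snd p - (RtoC 0 * fst v + RtoC 1 * snd v))%C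
      with (RtoC 0) by ring.
    rewrite Cmod_0. lra.
  - exists (A + A')%C, (B + B')%C, (K + K'). split; [lra|]. intros v Hv.
    replace (f (cplus2 p v) + g (cplus2 p v) - (f p + g p)
             - ((A + A') * fst v + (B + B') * snd v))%C
      with ((f (cplus2 p v) - f p - (A * fst v + B * snd v))
            + (g (cplus2 p v) - g p - (A' * fst v + B' * snd v)))%C by ring.
    eapply Rle_trans; [apply Cmod_triangle|].
    specialize (H v Hv). specialize (H' v Hv). lra.
  - set (c := Cmod A + Cmod B). set (c' := Cmod A' + Cmod B').
    exists (f p * A' + g p * A)%C, (f p * B' + g p * B)%C,
      (c * c' + Cmod (f p) * K' + Cmod (g p) * K + c * K' + K * c' + K * K').
    assert (Hlin : forall a b v, Cmod (a * fst v + b * snd v)%C <= (Cmod a + Cmod b) * cmod2 v).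
    { intros a b v. eapply Rle_trans; [apply Cmod_triangle|]. rewrite !Cmod_mult.
      unfold cmod2. assert (H1 := Cmod_ge_0 a). assert (H2 := Cmod_ge_0 b).
      assert (H3 := Cmod_ge_0 (fst v)). assert (H4 := Cmod_ge_0 (snd v)). nra. }
    assert (Hc : 0 <= c) by (unfold c; assert (H1 := Cmod_ge_0 A); assert (H2 := Cmod_ge_0 B); lra).
    assert (Hc' : 0 <= c') by (unfold c'; assert (H1 := Cmod_ge_0 A'); assert (H2 := Cmod_ge_0 B'); lra).
    assert (Hf := Cmod_ge_0 (f p)). assert (Hg := Cmod_ge_0 (g p)).
    split.
    + repeat apply Rplus_le_le_0_compat; apply Rmult_le_pos; assumption.
    + intros v Hv. specialize (H v Hv). specialize (H' v Hv).
      assert (L := Hlin A B v). assert (L' := Hlin A' B' v). fold c in L. fold c' in L'.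
      set (X := (A * fst v + B * snd v)%C) in *. set (X' := (A' * fst v + B' * snd v)%C) in *.
      set (r := (f (cplus2 p v) - f p - X)%C) in *. set (r' := (g (cplus2 p v) - g p - X')%C) in *.
      replace (f (cplus2 p v) * g (cplus2 p v) - f p * g p
         - ((f p * A' + g p * A) * fst v + (f p * B' + g p * B) * snd v))%C
        with (X * X' + f p * r' + g p * r + X * r' + r * X' + r * r')%C
        by (unfold r, r', X, X'; ring).
      assert (HN := cmod2_ge_0 v). set (N := cmod2 v) in *.
      assert (HX := Cmod_ge_0 X). assert (HX' := Cmod_ge_0 X').
      assert (Hr := Cmod_ge_0 r). assert (Hr' := Cmod_ge_0 r').
      assert (HN2 : N ^ 2 <= N) by (simpl; nra).
      assert (HN0 : 0 <= N ^ 2) by (simpl; nra).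
      assert (K * N ^ 2 <= K * N) by (apply Rmult_le_compat_l; lra).
      assert (K' * N ^ 2 <= K' * N) by (apply Rmult_le_compat_l; lra).
      assert (HKN : 0 <= K * N) by (apply Rmult_le_pos; lra).
      assert (T1 : Cmod X * Cmod X' <= (c * N) * (c' * N)) by (apply Rmult_le_compat; lra).
      assert (T2 : Cmod (f p) * Cmod r' <= Cmod (f p) * (K' * N ^ 2))
        by (apply Rmult_le_compat_l; lra).
      assert (T3 : Cmod (g p) * Cmod r <= Cmod (g p) * (K * N ^ 2))
        by (apply Rmult_le_compat_l; lra).
      assert (T4 : Cmod X * Cmod r' <= (c * N) * (K' * N)) by (apply Rmult_le_compat; lra).
      assert (T5 : Cmod r * Cmod X' <= (K * N) * (c' * N)) by (apply Rmult_le_compat; lra).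
      assert (T6 : Cmod r * Cmod r' <= (K * N) * (K' * N)) by (apply Rmult_le_compat; lra).
      rewrite <- !Cmod_mult in T1, T2, T3, T4, T5, T6.
      assert (U1 := Cmod_triangle (X * X' + f p * r' + g p * r + X * r' + r * X')%C (r * r')%C).
      assert (U2 := Cmod_triangle (X * X' + f p * r' + g p * r + X * r')%C (r * X')%C).
      assert (U3 := Cmod_triangle (X * X' + f p * r' + g p * r)%C (X * r')%C).
      assert (U4 := Cmod_triangle (X * X' + f p * r')%C (g p * r)%C).
      assert (U5 := Cmod_triangle (X * X')%C (f p * r')%C).
      replace ((c * c' + Cmod (f p) * K' + Cmod (g p) * K + c * K' + K * c' + K * K') * N ^ 2)
        with ((c * N) * (c' * N) + Cmod (f p) * (K' * N ^ 2) + Cmod (g p) * (K * N ^ 2)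
              + (c * N) * (K' * N) + (K * N) * (c' * N) + (K * N) * (K' * N)) by ring.
      lra.
  - exists A, B, K. split; [easy|]. intros v Hv. rewrite <- !Hfg. auto.
Qed.

Lemma polyfun_lipschitz (P : C2 -> C) (p : C2) :
  polyfun P -> exists K, 0 <= K /\
    forall v, cmod2 v <= 1 -> Cmod (P (cplus2 p v) - P p)%C <= K * cmod2 v.
Proof.
  intros HP. destruct (polyfun_expand P p HP) as [A [B [K [HK H]]]].
  assert (HA := Cmod_ge_0 A). assert (HB := Cmod_ge_0 B).
  exists (Cmod A + Cmod B + K). split; [lra|].
  intros v Hv. specialize (H v Hv).
  replace (P (cplus2 p v) - P p)%C with
    ((P (cplus2 p v) - P p - (A * fst v + B * snd v)) + (A * fst v + B * snd v))%C by ring.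
  eapply Rle_trans; [apply Cmod_triangle|].
  assert (L := Cmod_triangle (A * fst v) (B * snd v)). rewrite !Cmod_mult in L.
  assert (H3 := Cmod_ge_0 (fst v)). assert (H4 := Cmod_ge_0 (snd v)).
  assert (HN : 0 <= cmod2 v) by apply cmod2_ge_0.
  assert (cmod2 v ^ 2 <= cmod2 v) by (simpl; nra).
  assert (K * cmod2 v ^ 2 <= K * cmod2 v) by (apply Rmult_le_compat_l; lra).
  unfold cmod2 in *. nra.
Qed.

(** On a polydisc such functions are pluriharmonic. The class is closed under differentiation at the
    price of a smaller polydisc, and this is what yields smoothness of every order. *)
Definition re_approx (V : C2 -> Prop) (rho : C2 -> R) : Prop :=
  forall eps, 0 < eps -> exists P, polyfun P /\
    forall z, V z -> Rabs (rho z - Re (P z)) <= eps.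

Definition approx (V : C2 -> Prop) (f : C2 -> C) : Prop :=
  forall eps, 0 < eps -> exists P, polyfun P /\
    forall z, V z -> Cmod (f z - P z)%C <= eps.

(** A geometric series of ratio 1/2. Passing to the tail of the list multiplies the coefficient
    bound by [/ s], hence the generalisation over [K]. *)
Lemma peval_bound (l : list C) (K s : R) (z : C) :
  0 < s -> (forall i, Cmod (nth i l (RtoC 0)) * s ^ i <= K) ->
  Cmod z <= s / 2 -> Cmod (peval l z) <= 2 * K.
Proof.
  intros Hs. revert K. induction l as [|c l IH]; intros K H Hz.
  - simpl. rewrite Cmod_0. specialize (H O). simpl in H. rewrite Cmod_0 in H. lra.
  - simpl peval. assert (H0 := H O). simpl in H0.
    eapply Rle_trans; [apply Cmod_triangle|]. rewrite Cmod_mult.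
    assert (Hl : Cmod (peval l z) <= 2 * (K / s)).
    { apply IH; [|easy]. intros i. specialize (H (S i)). simpl in H.
      apply (Rmult_le_reg_r s); [easy|].
      replace (K / s * s) with K by (field; lra). lra. }
    assert (Cmod z * Cmod (peval l z) <= s / 2 * (2 * (K / s)))
      by (apply Rmult_le_compat; auto using Cmod_ge_0).
    replace (s / 2 * (2 * (K / s))) with K in H1 by (field; lra). lra.
Qed.

Lemma polydisc_cline (p : C2) (r R0 s : R) (z e : C2) (zeta : C) :
  polydisc p r z -> s * cmod2 e <= R0 - r -> Cmod zeta <= s ->
  polydisc p R0 (cline z e zeta).
Proof.
  intros [H1 H2] Hs Hz. unfold cmod2 in Hs.
  assert (H3 := Cmod_ge_0 (fst e)). assert (H4 := Cmod_ge_0 (snd e)).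
  assert (H5 := Cmod_ge_0 zeta).
  split; unfold cline; simpl.
  - replace (fst z + zeta * fst e - fst p)%C with ((fst z - fst p) + zeta * fst e)%C by ring.
    eapply Rle_lt_trans; [apply Cmod_triangle|]. rewrite Cmod_mult.
    assert (Cmod zeta * Cmod (fst e) <= s * Cmod (fst e)) by (apply Rmult_le_compat_r; lra).
    nra.
  - replace (snd z + zeta * snd e - snd p)%C with ((snd z - snd p) + zeta * snd e)%C by ring.
    eapply Rle_lt_trans; [apply Cmod_triangle|]. rewrite Cmod_mult.
    assert (Cmod zeta * Cmod (snd e) <= s * Cmod (snd e)) by (apply Rmult_le_compat_r; lra).
    nra.
Qed.

(** Cauchy estimate for the linear coefficient of [P - Q] on a complex line. Only the real parts are
    compared because only these are controlled for a real function such as [rho]. *)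
Lemma polyfun_diff_coef (P Q D E : C2 -> C) (e z : C2) (s B : R) :
  0 < s -> is_dirD P e D -> is_dirD Q e E ->
  (forall zeta, Cmod zeta = s ->
     Rabs (Re (P (cline z e zeta)) - Re (Q (cline z e zeta))) <= B) ->
  Rabs (Re (D z) - Re (E z)) <= 2 * B / s.
Proof.
  intros Hs [_ HD] [_ HE] H.
  destruct (HD z) as [A [HA EA]], (HE z) as [A' [HA' EA']].
  destruct (ispoly_plus A (fun t => (- RtoC 1) * A' t)%C HA (ispoly_scal _ _ HA')) as [l Hl].
  assert (Hc := peval_coef_bound ((P z - Q z) :: (D z - E z) :: l)%C s B 1).
  simpl nth in Hc. rewrite pow_1 in Hc.
  assert (Hd : Cmod (D z - E z)%C * s <= 2 * B).
  { apply Hc; [lra|lia|]. intros t.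
    replace (peval ((P z - Q z) :: (D z - E z) :: l)%C (RtoC s * cis t)%C)
      with (P (cline z e (RtoC s * cis t)) - Q (cline z e (RtoC s * cis t)))%C.
    - unfold Re. simpl. apply H. rewrite Cmod_mult, Cmod_cis, Cmod_R, Rabs_pos_eq; lra.
    - rewrite EA, EA'. simpl peval. rewrite <- Hl. ring. }
  assert (Hre := re_le_Cmod (D z - E z)%C).
  replace (Re (D z - E z)%C) with (Re (D z) - Re (E z)) in Hre by reflexivity.
  apply (Rmult_le_reg_r s); [easy|].
  replace (2 * B / s * s) with (2 * B) by (field; lra).
  nra.
Qed.

(** The coefficients of order at least two obey the Cauchy estimate at radius [s]; staying within
    [s / 2] makes their sum a convergent geometric series, uniformly in the degree. *)
Lemma polyfun_remainder (P D : C2 -> C) (e z : C2) (s B t : R) :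
  0 < s -> is_dirD P e D ->
  (forall zeta, Cmod zeta = s -> Rabs (Re (P (cline z e zeta))) <= B) ->
  Rabs t <= s / 2 ->
  Rabs (Re (P (cline z e (RtoC t))) - Re (P z) - t * Re (D z)) <= 4 * B * (t ^ 2 / s ^ 2).
Proof.
  intros Hs [_ HD] H Ht.
  destruct (HD z) as [A [[l Hl] EA]].
  assert (Hb : Cmod (peval l (RtoC t)) <= 2 * (2 * B / s ^ 2)).
  { apply peval_bound with (s := s); [easy| |now rewrite Cmod_R].
    intros i.
    assert (Hc := peval_coef_bound (P z :: D z :: l) s B (S (S i))).
    simpl nth in Hc. apply (Rmult_le_reg_r (s ^ 2)); [apply pow_lt; lra|].
    replace (2 * B / s ^ 2 * s ^ 2) with (2 * B) by (field; lra).
    rewrite Rmult_assoc, <- pow_add. replace (i + 2)%nat with (S (S i)) by lia.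
    apply Hc; [lra|lia|]. intros u.
    replace (peval (P z :: D z :: l) (RtoC s * cis u)%C)
      with (P (cline z e (RtoC s * cis u)%C)).
    - apply H. rewrite Cmod_mult, Cmod_cis, Cmod_R, Rabs_pos_eq; lra.
    - rewrite EA. simpl peval. now rewrite Hl. }
  replace (Re (P (cline z e (RtoC t))) - Re (P z) - t * Re (D z))
    with (Re (RtoC (t ^ 2) * peval l (RtoC t))%C).
  - eapply Rle_trans; [apply re_le_Cmod|]. rewrite Cmod_mult, Cmod_R.
    rewrite Rabs_pos_eq by (simpl; nra).
    replace (4 * B * (t ^ 2 / s ^ 2)) with (t ^ 2 * (2 * (2 * B / s ^ 2))) by (field; lra).
    apply Rmult_le_compat_l; [simpl; nra | easy].
  - rewrite EA, Hl. destruct (peval l (RtoC t)) as [u v], (D z) as [u' v'], (P z) as [u'' v''].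
    unfold Re, RtoC, Cmult, Cplus; simpl. ring.
Qed.

Lemma re_approx_expand (p : C2) (r R0 s M : R) (rho : C2 -> R) (z e : C2) :
  0 < s -> s * cmod2 e <= R0 - r -> polydisc p r z ->
  re_approx (polydisc p R0) rho ->
  (forall y, polydisc p R0 y -> Rabs (rho y) <= M) ->
  exists d,
    (forall eps P D, is_dirD P e D ->
       (forall y, polydisc p R0 y -> Rabs (rho y - Re (P y)) <= eps) ->
       Rabs (d - Re (D z)) <= 2 * eps / s) /\
    (forall t, Rabs t <= s / 2 ->
       Rabs (rho (cline z e (RtoC t)) - rho z - t * d) <= 4 * M * (t ^ 2 / s ^ 2)).
Proof.
  intros Hs He Hz Hap HM.
  assert (Hzeta : forall zeta, Cmod zeta <= s -> polydisc p R0 (cline z e zeta)).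
  { intros zeta H. now apply polydisc_cline with r s. }
  assert (Hz0 : polydisc p R0 z).
  { replace z with (cline z e (RtoC 0)).
    - apply Hzeta. rewrite Cmod_0. lra.
    - unfold cline. destruct z; simpl. f_equal; ring. }
  (* The derivative [d] is obtained without choosing a sequence of approximants. Each approximant of
     precision [eps] confines it to an interval of radius [2 * eps / s] about [Re (D z)]; these
     intervals meet pairwise, so the supremum of their lower ends lies in all of them. *)
  pose (X := fun x => exists eps P D, is_dirD P e D /\
     (forall y, polydisc p R0 y -> Rabs (rho y - Re (P y)) <= eps) /\ x = Re (D z) - 2 * eps / s).
  assert (Hub : forall eps P D, is_dirD P e D ->
     (forall y, polydisc p R0 y -> Rabs (rho y - Re (P y)) <= eps) ->
     is_upper_bound X (Re (D z) + 2 * eps / s)).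
  { intros eps P D HD HP x [eps' [Q [E [HE [HQ ->]]]]].
    assert (Hd := polyfun_diff_coef Q P E D e z s (eps + eps') Hs HE HD).
    assert (H0 : Rabs (Re (E z) - Re (D z)) <= 2 * (eps + eps') / s).
    { apply Hd. intros zeta Hzt.
      assert (H1 := HP _ (Hzeta zeta ltac:(lra))). assert (H2 := HQ _ (Hzeta zeta ltac:(lra))).
      apply Rabs_le_between in H1. apply Rabs_le_between in H2.
      apply Rabs_le. lra. }
    apply Rabs_le_between in H0.
    replace (2 * (eps + eps') / s) with (2 * eps / s + 2 * eps' / s) in H0 by (field; lra).
    lra. }
  destruct (Hap 1 ltac:(lra)) as [P0 [HP0 HP0']].
  destruct (polyfun_dirD P0 e HP0) as [D0 HD0].
  destruct (completeness X) as [d [Hd1 Hd2]].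
  { eexists. eapply Hub; eauto. }
  { eexists. exists 1, P0, D0. split; [easy|]. split; [easy|]. reflexivity. }
  assert (Hd : forall eps P D, is_dirD P e D ->
       (forall y, polydisc p R0 y -> Rabs (rho y - Re (P y)) <= eps) ->
       Rabs (d - Re (D z)) <= 2 * eps / s).
  { intros eps P D HD HP.
    assert (H1 := Hd2 _ (Hub eps P D HD HP)).
    assert (H2 : Re (D z) - 2 * eps / s <= d).
    { apply Hd1. exists eps, P, D. auto. }
    apply Rabs_le. lra. }
  exists d. split; [exact Hd|].
  intros t Ht. apply le_epsilon. intros eta Heta.
  (* The loss [eta] splits into four quarters: two values of [rho], the derivative [d], and the
     enlarged bound [M + eta / 4] in the remainder, where [t ^ 2 / s ^ 2 <= 1 / 4] absorbs the
     factor 4. *)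
  destruct (Hap (eta / 4) ltac:(lra)) as [P [HP HP']].
  destruct (polyfun_dirD P e HP) as [D HD].
  assert (H1 := Hd (eta / 4) P D HD HP').
  assert (Ht1 : Cmod (RtoC t) <= s) by (rewrite Cmod_R; lra).
  assert (H2 := polyfun_remainder P D e z s (M + eta / 4) t Hs HD).
  assert (H3 : Rabs (Re (P (cline z e (RtoC t))) - Re (P z) - t * Re (D z))
               <= 4 * (M + eta / 4) * (t ^ 2 / s ^ 2)).
  { apply H2; [|easy]. intros zeta Hzt.
    assert (Ha := HP' _ (Hzeta zeta ltac:(lra))). assert (Hb := HM _ (Hzeta zeta ltac:(lra))).
    apply Rabs_le_between in Ha. apply Rabs_le_between in Hb. apply Rabs_le. lra. }
  assert (H4 := HP' _ (Hzeta _ Ht1)). assert (H5 := HP' _ Hz0).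
  assert (Hts : Rabs t / s <= 1 / 2).
  { apply (Rmult_le_reg_r s); [easy|]. replace (Rabs t / s * s) with (Rabs t) by (field; lra). lra. }
  assert (Hts0 : 0 <= Rabs t / s).
  { apply Rmult_le_pos; [apply Rabs_pos|]. left. now apply Rinv_0_lt_compat. }
  assert (Hsq : t ^ 2 / s ^ 2 <= 1 / 4).
  { replace (t ^ 2 / s ^ 2) with ((Rabs t / s) * (Rabs t / s)).
    - nra.
    - rewrite <- (pow2_abs t). field. lra. }
  assert (H6 : Rabs (t * d - t * Re (D z)) <= Rabs t / s * (2 * (eta / 4))).
  { rewrite <- Rmult_minus_distr_l, Rabs_mult.
    replace (Rabs t / s * (2 * (eta / 4))) with (Rabs t * (2 * (eta / 4) / s)) by (field; lra).
    apply Rmult_le_compat_l; [apply Rabs_pos | easy]. }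
  assert (H7 : Rabs t / s * (2 * (eta / 4)) <= eta / 4) by nra.
  apply Rabs_le_between in H3, H4, H5, H6.
  apply Rabs_le. nra.
Qed.

Lemma re_approx_bounded (p : C2) (r : R) (rho : C2 -> R) :
  re_approx (polydisc p r) rho ->
  exists M, forall y, polydisc p r y -> Rabs (rho y) <= M.
Proof.
  intros H. destruct (H 1 ltac:(lra)) as [P [HP HP']].
  destruct (polyfun_bound P p r HP) as [M [HM HM']].
  exists (M + 1). intros y Hy. specialize (HP' y Hy). specialize (HM' y Hy).
  assert (Hre := re_le_Cmod (P y)).
  apply Rabs_le_between in HP'.
  assert (Hre' : Rabs (Re (P y)) <= M) by lra. apply Rabs_le_between in Hre'.
  apply Rabs_le. lra.
Qed.

Lemma is_derive_quadratic (phi : R -> R) (d K s : R) :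
  0 < s -> (forall t, Rabs t <= s -> Rabs (phi t - phi 0 - t * d) <= K * t ^ 2) ->
  is_derive phi 0 d.
Proof.
  intros Hs H. apply is_derive_Reals. intros eps Heps.
  assert (HK : 0 < Rabs K + 1) by (assert (H0 := Rabs_pos K); lra).
  assert (Hd : 0 < Rmin s (eps / (Rabs K + 1))).
  { apply Rmin_pos; [easy|]. now apply Rdiv_lt_0_compat. }
  exists (mkposreal _ Hd). intros h Hh Hhd. simpl in Hhd.
  rewrite Rplus_0_l.
  assert (Hh1 : Rabs h < s) by (eapply Rlt_le_trans; [exact Hhd | apply Rmin_l]).
  assert (Hh2 : Rabs h < eps / (Rabs K + 1)) by (eapply Rlt_le_trans; [exact Hhd | apply Rmin_r]).
  replace ((phi h - phi 0) / h - d) with ((phi h - phi 0 - h * d) / h) by (field; easy).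
  assert (Hpos : 0 < Rabs h) by now apply Rabs_pos_lt.
  unfold Rdiv. rewrite Rabs_mult, Rabs_inv.
  apply (Rmult_lt_reg_r (Rabs h)); [easy|].
  rewrite Rmult_assoc, Rinv_l, Rmult_1_r by lra.
  eapply Rle_lt_trans; [apply H; lra|].
  rewrite <- (pow2_abs h).
  assert (Hh3 : Rabs h * (Rabs K + 1) < eps).
  { replace eps with (eps / (Rabs K + 1) * (Rabs K + 1)) by (field; lra).
    now apply Rmult_lt_compat_r. }
  assert (HK' := Rle_abs K).
  nra.
Qed.

Lemma dirderiv_arg (z e : C2) (t : R) :
  @plus C2r z (@scal R_AbsRing C2r t e) = cline z e (RtoC t).
Proof.
  destruct z as [[a b] [c d]], e as [[a' b'] [c' d']].
  unfold cline, plus, scal; simpl. unfold prod_plus, prod_scal; simpl.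
  unfold prod_plus, prod_scal, plus, scal; simpl. unfold mult; simpl.
  unfold Cplus, Cmult, RtoC; simpl.
  apply injective_projections; apply injective_projections; simpl;
    unfold plus, scal; simpl; unfold mult; simpl; ring.
Qed.

Lemma cline_0 (z e : C2) : cline z e (RtoC 0) = z.
Proof. unfold cline. destruct z; simpl. f_equal; ring. Qed.

Lemma step_size (e : C2) (a : R) : 0 < a -> exists s, 0 < s /\ s * cmod2 e <= a.
Proof.
  intros Ha. assert (He := cmod2_ge_0 e).
  exists (a / (1 + cmod2 e)). split; [apply Rdiv_lt_0_compat; lra|].
  apply (Rmult_le_reg_r (1 + cmod2 e)); [lra|].
  replace (a / (1 + cmod2 e) * cmod2 e * (1 + cmod2 e)) with (a * cmod2 e) by (field; lra).
  nra.
Qed.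

Lemma re_approx_is_derive (p : C2) (r R0 : R) (rho : C2 -> R) (e z : C2) :
  r < R0 -> re_approx (polydisc p R0) rho -> polydisc p r z ->
  is_derive (fun t : R => rho (@plus C2r z (@scal R_AbsRing C2r t e))) 0 (dirderiv rho e z).
Proof.
  intros Hr Hap Hz.
  destruct (step_size e (R0 - r) ltac:(lra)) as [s [Hs He]].
  destruct (re_approx_bounded p R0 rho Hap) as [M HM].
  destruct (re_approx_expand p r R0 s M rho z e Hs He Hz Hap HM) as [d [_ Hd]].
  assert (H : is_derive (fun t : R => rho (@plus C2r z (@scal R_AbsRing C2r t e))) 0 d).
  { apply is_derive_quadratic with (s := s / 2) (K := 4 * M / s ^ 2); [lra|].
    intros t Ht. rewrite !dirderiv_arg, cline_0.
    replace (4 * M / s ^ 2 * t ^ 2) with (4 * M * (t ^ 2 / s ^ 2)) by (field; lra).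
    now apply Hd. }
  unfold dirderiv. now rewrite (is_derive_unique _ _ _ H).
Qed.

Lemma re_approx_dirderiv_close (p : C2) (r R0 s eps : R) (rho : C2 -> R) (e z : C2)
    (P D : C2 -> C) :
  0 < s -> s * cmod2 e <= R0 - r -> r < R0 ->
  re_approx (polydisc p R0) rho -> polydisc p r z -> is_dirD P e D ->
  (forall y, polydisc p R0 y -> Rabs (rho y - Re (P y)) <= eps) ->
  Rabs (dirderiv rho e z - Re (D z)) <= 2 * eps / s.
Proof.
  intros Hs He Hr Hap Hz HD HP.
  destruct (re_approx_bounded p R0 rho Hap) as [M HM].
  destruct (re_approx_expand p r R0 s M rho z e Hs He Hz Hap HM) as [d [Hd1 Hd2]].
  assert (H : is_derive (fun t : R => rho (@plus C2r z (@scal R_AbsRing C2r t e))) 0 d).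
  { apply is_derive_quadratic with (s := s / 2) (K := 4 * M / s ^ 2); [lra|].
    intros t Ht. rewrite !dirderiv_arg, cline_0.
    replace (4 * M / s ^ 2 * t ^ 2) with (4 * M * (t ^ 2 / s ^ 2)) by (field; lra).
    now apply Hd2. }
  unfold dirderiv. rewrite (is_derive_unique _ _ _ H). now apply Hd1 with P.
Qed.

(** The Cauchy factor [2 / s] is the same at every point of the smaller polydisc, so the derivatives
    of the approximants converge uniformly there. The precision [eps * s / 2] compensates this
    factor. *)
Lemma re_approx_dirderiv (p : C2) (r R0 : R) (rho : C2 -> R) (e : C2) :
  r < R0 -> re_approx (polydisc p R0) rho -> re_approx (polydisc p r) (dirderiv rho e).
Proof.
  intros Hr Hap eps Heps.
  destruct (step_size e (R0 - r) ltac:(lra)) as [s [Hs He]].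
  destruct (Hap (eps * s / 2)) as [P [HP HP']]; [nra|].
  destruct (polyfun_dirD P e HP) as [D HD].
  exists D. split; [apply HD|]. intros z Hz.
  replace eps with (2 * (eps * s / 2) / s) by (field; lra).
  now apply (re_approx_dirderiv_close p r R0 s (eps * s / 2) rho e z P D).
Qed.

Lemma locally_polydisc (z : C2) (P : C2 -> Prop) :
  Hierarchy.locally (z : C2h) P <-> exists r, 0 < r /\ forall w, polydisc z r w -> P w.
Proof.
  split.
  - intros [eps H]. exists eps. split; [apply cond_pos|].
    intros w [H1 H2]. apply H. split.
    + apply C_NormedModule_mixin_compat1. exact H1.
    + apply C_NormedModule_mixin_compat1. exact H2.
  - intros [r [Hr H]].
    assert (Hr2 : 0 < r / 2) by lra.
    (* Balls of [C] are taken componentwise, and the modulus can exceed the radius of such a ball by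
       the factor [sqrt 2]. *)
    assert (Hsq : sqrt 2 * (r / 2) < r).
    { assert (sqrt 2 < 2); [|nra]. rewrite <- (sqrt_pow2 2) at 2 by lra.
      apply sqrt_lt_1; simpl; lra. }
    exists (mkposreal _ Hr2). intros w [H1 H2]. apply H.
    apply C_NormedModule_mixin_compat2 in H1. apply C_NormedModule_mixin_compat2 in H2.
    simpl in H1, H2.
    split; (eapply Rlt_trans; [eassumption | exact Hsq]).
Qed.

Lemma polydisc_center (p : C2) (r : R) : 0 < r -> polydisc p r p.
Proof.
  intros Hr. split; [replace (fst p - fst p)%C with (RtoC 0) by ring
                    | replace (snd p - snd p)%C with (RtoC 0) by ring]; rewrite Cmod_0; easy.
Qed.

Lemma polydisc_open (p : C2) (r : R) : openC2 (polydisc p r).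
Proof.
  change (forall z : C2, polydisc p r z -> Hierarchy.locally (z : C2h) (polydisc p r)).
  intros z [H1 H2]. apply locally_polydisc.
  set (d := Rmin (r - Cmod (fst z - fst p)%C) (r - Cmod (snd z - snd p)%C)).
  assert (Hd1 := Rmin_l (r - Cmod (fst z - fst p)%C) (r - Cmod (snd z - snd p)%C)).
  assert (Hd2 := Rmin_r (r - Cmod (fst z - fst p)%C) (r - Cmod (snd z - snd p)%C)).
  fold d in Hd1, Hd2.
  exists d. split; [apply Rmin_pos; lra|].
  intros w [H3 H4]. split.
  - replace (fst w - fst p)%C with ((fst w - fst z) + (fst z - fst p))%C by ring.
    eapply Rle_lt_trans; [apply Cmod_triangle|]. lra.
  - replace (snd w - snd p)%C with ((snd w - snd z) + (snd z - snd p))%C by ring.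
    eapply Rle_lt_trans; [apply Cmod_triangle|]. lra.
Qed.

Lemma polydisc_le (p : C2) (r r' : R) (z : C2) : r <= r' -> polydisc p r z -> polydisc p r' z.
Proof. intros H [H1 H2]. split; lra. Qed.

Lemma polyfun_continuous (P : C2 -> C) (p : C2) (eps : R) :
  polyfun P -> 0 < eps ->
  exists r, 0 < r /\ forall z, polydisc p r z -> Cmod (P z - P p)%C < eps.
Proof.
  intros HP Heps. destruct (polyfun_lipschitz P p HP) as [K [HK H]].
  assert (Hr : 0 < Rmin (1 / 2) (eps / (2 * (K + 1)))).
  { apply Rmin_pos; [lra|]. apply Rdiv_lt_0_compat; lra. }
  exists (Rmin (1 / 2) (eps / (2 * (K + 1)))). split; [exact Hr|].
  intros z [H1 H2].
  assert (Ha := Rmin_l (1 / 2) (eps / (2 * (K + 1)))).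
  assert (Hb := Rmin_r (1 / 2) (eps / (2 * (K + 1)))).
  set (v := (fst z - fst p, snd z - snd p)%C : C2).
  replace z with (cplus2 p v).
  2:{ unfold cplus2, v. destruct z; simpl. f_equal; ring. }
  assert (Hv : cmod2 v < eps / (K + 1)).
  { unfold cmod2, v; simpl. replace (eps / (K + 1)) with (eps / (2 * (K + 1)) + eps / (2 * (K + 1))) by (field; lra). lra. }
  eapply Rle_lt_trans; [apply H; unfold cmod2, v; simpl; lra|].
  assert (Hv0 := cmod2_ge_0 v).
  assert (Hv2 : cmod2 v * (K + 1) < eps).
  { replace eps with (eps / (K + 1) * (K + 1)) by (field; lra).
    apply Rmult_lt_compat_r; lra. }
  nra.
Qed.

Lemma re_approx_continuous (V : C2 -> Prop) (rho : C2 -> R) (z : C2) :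
  openC2 V -> re_approx V rho -> V z ->
  Continuity.continuous (rho : C2h -> R_UniformSpace) z.
Proof.
  intros HV Hap Hz. unfold continuous. apply filterlim_locally. intros eps.
  assert (Heps := cond_pos eps).
  destruct (Hap (eps / 4) ltac:(lra)) as [P [HP HP']].
  destruct (polyfun_continuous P z (eps / 4) HP ltac:(lra)) as [r [Hr H]].
  destruct (proj1 (locally_polydisc z V) (HV z Hz)) as [r' [Hr' H']].
  apply locally_polydisc. exists (Rmin r r'). split; [now apply Rmin_pos|].
  intros w Hw.
  assert (Hw1 : polydisc z r w) by (eapply polydisc_le; [apply Rmin_l | exact Hw]).
  assert (Hw2 : V w) by (apply H'; eapply polydisc_le; [apply Rmin_r | exact Hw]).
  specialize (H w Hw1). assert (Ha := HP' z Hz). assert (Hb := HP' w Hw2).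
  assert (Hre := re_le_Cmod (P w - P z)%C).
  replace (Re (P w - P z)%C) with (Re (P w) - Re (P z)) in Hre by reflexivity.
  assert (Hc : Rabs (Re (P w) - Re (P z)) <= eps / 4) by lra.
  apply Rabs_le_between in Ha, Hb, Hc.
  change (Rabs (rho w - rho z) < eps). apply Rabs_def1; lra.
Qed.

(** Each differentiation gives up half of the remaining gap between [r] and [R0], so the radius [r]
    survives any finite number of them. *)
Lemma re_approx_Ck (p : C2) (k : nat) : forall (r R0 : R) (rho : C2 -> R),
  r < R0 -> re_approx (polydisc p R0) rho -> Ck k (polydisc p r) rho.
Proof.
  induction k as [|k IH]; intros r R0 rho Hr Hap.
  - intros z Hz. apply (re_approx_continuous (polydisc p R0)); [apply polydisc_open | easy |].
    apply polydisc_le with r; [lra|easy].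
  - split.
    + intros z Hz. apply (re_approx_continuous (polydisc p R0)); [apply polydisc_open | easy |].
      apply polydisc_le with r; [lra|easy].
    + intros e. split.
      * intros z Hz. eexists. now apply re_approx_is_derive with p r R0.
      * apply IH with ((r + R0) / 2); [lra|].
        apply re_approx_dirderiv with R0; [lra|easy].
Qed.

(** * Uniform approximation of products, inverses and logarithms *)

Lemma approx_polyfun (V : C2 -> Prop) (f : C2 -> C) : polyfun f -> approx V f.
Proof.
  intros Hf eps Heps. exists f. split; [easy|]. intros z _.
  replace (f z - f z)%C with (RtoC 0) by ring. rewrite Cmod_0. lra.
Qed.

Lemma approx_ext (V : C2 -> Prop) (f g : C2 -> C) :
  (forall z, V z -> f z = g z) -> approx V f -> approx V g.
Proof.
  intros H Hf eps Heps. destruct (Hf eps Heps) as [P [HP HP']].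
  exists P. split; [easy|]. intros z Hz. rewrite <- H by easy. auto.
Qed.

Lemma approx_plus (V : C2 -> Prop) (f g : C2 -> C) :
  approx V f -> approx V g -> approx V (fun z => f z + g z)%C.
Proof.
  intros Hf Hg eps Heps.
  destruct (Hf (eps / 2) ltac:(lra)) as [P [HP HP']].
  destruct (Hg (eps / 2) ltac:(lra)) as [Q [HQ HQ']].
  exists (fun z => P z + Q z)%C. split; [now constructor|]. intros z Hz.
  replace (f z + g z - (P z + Q z))%C with ((f z - P z) + (g z - Q z))%C by ring.
  eapply Rle_trans; [apply Cmod_triangle|].
  specialize (HP' z Hz). specialize (HQ' z Hz). lra.
Qed.

Lemma approx_mult (V : C2 -> Prop) (f g : C2 -> C) (M M' : R) :
  (forall z, V z -> Cmod (f z) <= M) -> (forall z, V z -> Cmod (g z) <= M') ->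
  approx V f -> approx V g -> approx V (fun z => f z * g z)%C.
Proof.
  intros HM HM' Hf Hg eps Heps.
  set (B := Rabs M + Rabs M' + 1).
  assert (HB1 := Rabs_pos M). assert (HB2 := Rabs_pos M').
  assert (HBM := Rle_abs M). assert (HBM' := Rle_abs M').
  set (d := Rmin 1 (eps / (2 * B))).
  assert (HB : 0 < B) by (unfold B; lra).
  assert (Hd : 0 < d) by (apply Rmin_pos; [lra | apply Rdiv_lt_0_compat; lra]).
  assert (Hd1 : d <= 1) by apply Rmin_l.
  assert (Hd2 : d * B <= eps / 2).
  { assert (H := Rmin_r 1 (eps / (2 * B))). fold d in H.
    replace (eps / 2) with (eps / (2 * B) * B) by (field; lra).
    apply Rmult_le_compat_r; lra. }
  destruct (Hf d Hd) as [P [HP HP']]. destruct (Hg d Hd) as [Q [HQ HQ']].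
  exists (fun z => P z * Q z)%C. split; [now constructor|]. intros z Hz.
  specialize (HP' z Hz). specialize (HQ' z Hz). specialize (HM z Hz). specialize (HM' z Hz).
  set (a := (f z - P z)%C) in *. set (b := (g z - Q z)%C) in *.
  replace (f z * g z - P z * Q z)%C with (f z * b + a * g z + - (a * b))%C
    by (unfold a, b; ring).
  assert (U1 := Cmod_triangle (f z * b + a * g z)%C (- (a * b))%C).
  assert (U2 := Cmod_triangle (f z * b)%C (a * g z)%C).
  rewrite Cmod_opp, !Cmod_mult in *.
  assert (Ha := Cmod_ge_0 a). assert (Hb := Cmod_ge_0 b).
  assert (Hf0 := Cmod_ge_0 (f z)). assert (Hg0 := Cmod_ge_0 (g z)).
  assert (T1 : Cmod (f z) * Cmod b <= Rabs M * d) by (apply Rmult_le_compat; lra).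
  assert (T2 : Cmod a * Cmod (g z) <= d * Rabs M') by (apply Rmult_le_compat; lra).
  assert (T3 : Cmod a * Cmod b <= d * 1) by (apply Rmult_le_compat; lra).
  assert (T4 : d * B = Rabs M * d + d * Rabs M' + d * 1) by (unfold B; ring).
  lra.
Qed.

Lemma approx_limit (V : C2 -> Prop) (f : C2 -> C) :
  (forall eps, 0 < eps -> exists g, approx V g /\ forall z, V z -> Cmod (f z - g z)%C <= eps) ->
  approx V f.
Proof.
  intros H eps Heps. destruct (H (eps / 2) ltac:(lra)) as [g [Hg Hfg]].
  destruct (Hg (eps / 2) ltac:(lra)) as [P [HP HP']].
  exists P. split; [easy|]. intros z Hz.
  replace (f z - P z)%C with ((f z - g z) + (g z - P z))%C by ring.
  eapply Rle_trans; [apply Cmod_triangle|].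
  specialize (Hfg z Hz). specialize (HP' z Hz). lra.
Qed.

(** Horner form of the geometric sum of the powers [(- x) ^ j] with [j < n], which approximates the
    inverse of [1 + x]. *)
Fixpoint gsum (x : C) (n : nat) : C :=
  match n with
  | O => RtoC 0
  | S m => (RtoC 1 - x * gsum x m)%C
  end.

(* [lsum x n] is the Taylor polynomial of the logarithm at 1 evaluated at [1 + x]. *)
Fixpoint lsum (x : C) (n : nat) : C :=
  match n with
  | O => RtoC 0
  | S m => (lsum x m + (- x) ^ m * x * RtoC (/ INR (S m)))%C
  end.

Lemma approx_powers (V : C2 -> Prop) (f : C2 -> C) (n : nat) :
  (forall z, V z -> Cmod (f z) <= 1 / 4) -> approx V f ->
  approx V (fun z => (- f z) ^ n)%C.
Proof.
  intros HM Hf. induction n as [|n IH]; simpl.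
  - apply approx_polyfun. constructor.
  - apply approx_mult with (1 / 4) 1; [| | |exact IH].
    + intros z Hz. rewrite Cmod_opp. auto.
    + intros z Hz. rewrite Cmod_pow, Cmod_opp. rewrite <- (pow1 n).
      apply pow_incr. split; [apply Cmod_ge_0|]. specialize (HM z Hz). lra.
    + apply approx_ext with (fun z => (- RtoC 1) * f z)%C; [intros; ring|].
      apply approx_mult with 1 (1 / 4); [|exact HM| |exact Hf].
      * intros _ _. rewrite Cmod_opp, Cmod_1. lra.
      * apply approx_polyfun. constructor.
Qed.

Lemma gsum_error (x : C) (n : nat) :
  ((RtoC 1 + x) * gsum x n)%C = (RtoC 1 - (- x) ^ n)%C.
Proof.
  induction n as [|n IH]; simpl; [ring|].
  replace ((RtoC 1 + x) * (RtoC 1 - x * gsum x n))%C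
    with ((RtoC 1 + x) - x * ((RtoC 1 + x) * gsum x n))%C by ring.
  rewrite IH. ring.
Qed.

Lemma Cmod_1_plus (x : C) : Cmod x <= 1 / 4 -> 3 / 4 <= Cmod (RtoC 1 + x)%C <= 5 / 4.
Proof.
  intros H. split.
  - assert (H1 := Cmod_triangle (RtoC 1 + x)%C (- x)%C).
    replace (RtoC 1 + x + - x)%C with (RtoC 1) in H1 by ring.
    rewrite Cmod_1, Cmod_opp in H1. lra.
  - assert (H1 := Cmod_triangle (RtoC 1) x). rewrite Cmod_1 in H1. lra.
Qed.

Lemma Cmod_neq_0 (x : C) : 0 < Cmod x -> x <> RtoC 0.
Proof. intros H E. rewrite E, Cmod_0 in H. lra. Qed.

Lemma pow_quarter_small (eps : R) : 0 < eps -> exists n, (1 / 4) ^ n <= eps.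
Proof.
  intros Heps. destruct (pow_lt_1_zero (1 / 4)) with (y := eps) as [N HN]; [|easy|].
  - rewrite Rabs_pos_eq; lra.
  - exists N. specialize (HN N ltac:(lia)). apply Rabs_def2 in HN. lra.
Qed.

(** The geometric series has ratio at most 1/4 on all of [V], hence converges uniformly. The bound 2
    on its partial sums is carried along because [approx_mult] requires bounded factors. *)
Lemma approx_inv_1_plus (V : C2 -> Prop) (f : C2 -> C) :
  (forall z, V z -> Cmod (f z) <= 1 / 4) -> approx V f ->
  approx V (fun z => / (RtoC 1 + f z))%C.
Proof.
  intros HM Hf. apply approx_limit. intros eps Heps.
  destruct (pow_quarter_small (eps / 2) ltac:(lra)) as [n Hn].
  exists (fun z => gsum (f z) n). split.
  - assert (Hb : forall m, approx V (fun z => gsum (f z) m)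
       /\ forall z, V z -> Cmod (gsum (f z) m) <= 2).
    { induction m as [|m [IH1 IH2]]; simpl.
      - split; [apply approx_polyfun; constructor|]. intros. rewrite Cmod_0. lra.
      - split.
        + apply approx_ext with (fun z => RtoC 1 + ((- RtoC 1) * f z) * gsum (f z) m)%C;
            [intros; ring|].
          apply approx_plus; [apply approx_polyfun; constructor|].
          apply approx_mult with (1 / 4) 2; [|exact IH2| |exact IH1].
          * intros z Hz. rewrite Cmod_mult, Cmod_opp, Cmod_1. specialize (HM z Hz). lra.
          * apply approx_mult with 1 (1 / 4); [|exact HM| |exact Hf].
            -- intros _ _. rewrite Cmod_opp, Cmod_1. lra.
            -- apply approx_polyfun. constructor.
        + intros z Hz. unfold Cminus. eapply Rle_trans; [apply Cmod_triangle|].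
          rewrite Cmod_1, Cmod_opp, Cmod_mult.
          assert (Cmod (f z) * Cmod (gsum (f z) m) <= 1 / 4 * 2); [|lra].
          apply Rmult_le_compat; auto using Cmod_ge_0. }
    apply Hb.
  - intros z Hz. specialize (HM z Hz). assert (H1 := Cmod_1_plus _ HM).
    assert (Hn0 : (RtoC 1 + f z)%C <> RtoC 0) by (apply Cmod_neq_0; lra).
    replace (/ (RtoC 1 + f z) - gsum (f z) n)%C with (/ (RtoC 1 + f z) * (- f z) ^ n)%C.
    + rewrite Cmod_mult, Cmod_inv, Cmod_pow, Cmod_opp by easy.
      assert (Hi : / Cmod (RtoC 1 + f z)%C <= 2).
      { replace 2 with (/ (1 / 2)) by field. apply Rinv_le_contravar; lra. }
      assert (Hp : Cmod (f z) ^ n <= (1 / 4) ^ n).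
      { apply pow_incr. split; [apply Cmod_ge_0 | easy]. }
      assert (Hp0 : 0 <= Cmod (f z) ^ n) by (apply pow_le, Cmod_ge_0).
      assert (Hi0 : 0 <= / Cmod (RtoC 1 + f z)%C) by (left; apply Rinv_0_lt_compat; lra).
      nra.
    + replace ((- f z) ^ n)%C with (RtoC 1 - (RtoC 1 + f z) * gsum (f z) n)%C
        by (rewrite gsum_error; ring).
      field. easy.
Qed.

Lemma approx_lsum (V : C2 -> Prop) (f : C2 -> C) (n : nat) :
  (forall z, V z -> Cmod (f z) <= 1 / 4) -> approx V f ->
  approx V (fun z => lsum (f z) n).
Proof.
  intros HM Hf. induction n as [|n IH]; simpl.
  - apply approx_polyfun. constructor.
  - apply approx_plus; [exact IH|].
    assert (Hp : forall z, V z -> Cmod ((- f z) ^ n)%C <= 1).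
    { intros z Hz. rewrite Cmod_pow, Cmod_opp. rewrite <- (pow1 n).
      apply pow_incr. split; [apply Cmod_ge_0|]. specialize (HM z Hz). lra. }
    apply approx_mult with 1 (Cmod (RtoC (/ INR (S n)))).
    + intros z Hz. rewrite Cmod_mult. specialize (HM z Hz). specialize (Hp z Hz).
      assert (H1 := Cmod_ge_0 (f z)). assert (H2 := Cmod_ge_0 ((- f z) ^ n)%C). nra.
    + intros; apply Rle_refl.
    + apply approx_mult with 1 (1 / 4); [exact Hp|exact HM| |exact Hf].
      now apply approx_powers.
    + apply approx_polyfun. constructor.
Qed.

(** This is [log |1 + t x|], written through the squared modulus so that it is visibly
    differentiable in the real variable [t]. *)
Definition lnmod (x : C) (t : R) : R :=
  / 2 * ln ((1 + t * Re x) ^ 2 + (t * Im x) ^ 2).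

Lemma lsum_scaled_derive (x : C) (n : nat) (t : R) :
  is_derive (fun t => Re (lsum (RtoC t * x)%C n)) t (Re (x * gsum (RtoC t * x) n)%C).
Proof.
  (* [gsum] grows by Horner's rule and [lsum] by appending a last term; this identity reconciles the
     two recursions, so that the geometric sum is the derivative of the logarithmic one. *)
  assert (Hg : forall y m, gsum y (S m) = (gsum y m + (- y) ^ m)%C).
  { intros y m. induction m as [|m IH]; [simpl; ring|].
    change (gsum y (S (S m))) with (RtoC 1 - y * gsum y (S m))%C.
    change (gsum y (S m)) with (RtoC 1 - y * gsum y m)%C at 2.
    rewrite IH. simpl. ring. }
  induction n as [|n IH].
  - apply is_derive_ext with (fun _ => 0); [reflexivity|].
    replace (Re (x * gsum (RtoC t * x) 0)%C) with 0.
    + apply @is_derive_const.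
    + simpl. unfold RtoC. simpl. ring.
  - rewrite Hg.
    set (c := Re ((- x) ^ n * x)%C).
    assert (Hpow : forall s, ((- (RtoC s * x)) ^ n = RtoC (s ^ n) * (- x) ^ n)%C).
    { intros s. rewrite <- Cpow_RtoC, <- Cpow_mult_l. f_equal. ring. }
    apply is_derive_ext with (fun t => Re (lsum (RtoC t * x)%C n) + t ^ (S n) * (c / INR (S n))).
    + intros s.
      change (lsum (RtoC s * x)%C (S n)) with
        (lsum (RtoC s * x) n + (- (RtoC s * x)) ^ n * (RtoC s * x) * RtoC (/ INR (S n)))%C.
      rewrite Hpow.
      replace (RtoC (s ^ n) * (- x) ^ n * (RtoC s * x) * RtoC (/ INR (S n)))%C
        with (RtoC (s ^ S n / INR (S n)) * ((- x) ^ n * x))%C.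
      * unfold c. destruct ((- x) ^ n * x)%C as [u v].
        destruct (lsum (RtoC s * x)%C n) as [u' v'].
        unfold Re, Cplus, Cmult, RtoC. cbn [fst snd]. unfold Rdiv. match goal with |- ?a = ?b => change (@eq R a b) end. ring.
      * unfold Rdiv. rewrite RtoC_mult. simpl pow. rewrite RtoC_mult. ring.
    + replace (Re (x * (gsum (RtoC t * x) n + (- (RtoC t * x)) ^ n))%C)
        with (Re (x * gsum (RtoC t * x) n)%C + INR (S n) * t ^ n * (c / INR (S n))).
      * apply @is_derive_plus; [exact IH|].
        auto_derive; [easy|]. rewrite Rmult_1_l.
        replace (match n with O => 1 | S _ => INR n + 1 end) with (INR (S n)) by reflexivity.
        simpl Nat.pred. ring.
      * rewrite Hpow. replace (INR (S n) * t ^ n * (c / INR (S n))) with (t ^ n * c).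
        2:{ field. apply not_0_INR. lia. }
        unfold c.
        replace (x * (gsum (RtoC t * x) n + RtoC (t ^ n) * (- x) ^ n))%C
          with (x * gsum (RtoC t * x) n + RtoC (t ^ n) * ((- x) ^ n * x))%C by ring.
        destruct ((- x) ^ n * x)%C as [u v].
        destruct (x * gsum (RtoC t * x) n)%C as [u' v'].
        unfold Re, Cplus, Cmult, RtoC. cbn [fst snd]. ring.
Qed.

Lemma lnmod_derive (x : C) (t : R) :
  Cmod x <= 1 / 4 -> 0 <= t <= 1 ->
  is_derive (lnmod x) t (Re (x * / (RtoC 1 + RtoC t * x))%C).
Proof.
  intros Hx Ht.
  assert (H1 : Cmod (RtoC t * x)%C <= 1 / 4).
  { rewrite Cmod_mult, Cmod_R, Rabs_pos_eq by lra. assert (H := Cmod_ge_0 x). nra. }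
  assert (H2 := Cmod_1_plus _ H1).
  assert (H3 : 0 < (1 + t * Re x) ^ 2 + (t * Im x) ^ 2).
  { assert (H4 : Cmod (RtoC 1 + RtoC t * x)%C ^ 2 = (1 + t * Re x) ^ 2 + (t * Im x) ^ 2).
    { rewrite Cmod2_alt. destruct x as [a b].
      unfold Re, Im, Cplus, Cmult, RtoC. cbn [fst snd]. ring. }
    rewrite <- H4. apply pow_lt. lra. }
  unfold lnmod. auto_derive; [simpl in *; lra|].
  destruct x as [a b]. unfold Re, Im, Cinv, Cplus, Cmult, RtoC in *. cbn [fst snd] in *.
  field. apply Rgt_not_eq. eapply Rlt_le_trans; [exact H3 | apply Req_le; ring].
Qed.

(** Mean value theorem along the segment from 0 to [x]. With [y = c x], the difference has
    derivative [Re (x (-y)^n / (1 + y))], where [|x / (1 + y)| <= 1] and [|y| <= 1/4]. *)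
Lemma lsum_error (x : C) (n : nat) :
  Cmod x <= 1 / 4 -> Rabs (ln (Cmod (RtoC 1 + x)%C) - Re (lsum x n)) <= (1 / 4) ^ n.
Proof.
  intros Hx.
  set (phi := fun t => lnmod x t - Re (lsum (RtoC t * x)%C n)).
  set (dphi := fun t => Re (x * / (RtoC 1 + RtoC t * x))%C - Re (x * gsum (RtoC t * x) n)%C).
  assert (H0 : phi 0 = 0).
  { unfold phi, lnmod.
    replace ((1 + 0 * Re x) ^ 2 + (0 * Im x) ^ 2) with 1 by ring.
    rewrite ln_1.
    assert (Hl : forall m, lsum (RtoC 0 * x)%C m = RtoC 0).
    { induction m as [|m IH]; simpl; [easy|]. rewrite IH. ring. }
    rewrite Hl. simpl. ring. }
  assert (H1 : phi 1 = ln (Cmod (RtoC 1 + x)%C) - Re (lsum x n)).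
  { unfold phi, lnmod. f_equal.
    - assert (H2 := Cmod_1_plus x Hx).
      replace ((1 + 1 * Re x) ^ 2 + (1 * Im x) ^ 2) with (Cmod (RtoC 1 + x)%C ^ 2).
      + simpl pow. rewrite Rmult_1_r, ln_mult by lra. field.
      + rewrite Cmod2_alt. destruct x as [a b].
        unfold Re, Im, Cplus, RtoC. cbn [fst snd]. ring.
    - f_equal. f_equal. f_equal. ring. }
  rewrite <- H1.
  destruct (MVT_gen phi 0 1 dphi) as [c [Hc Hphi]].
  - intros t Ht. rewrite Rmin_left, Rmax_right in Ht by lra.
    unfold phi, dphi. apply @is_derive_minus; [apply lnmod_derive; lra | apply lsum_scaled_derive].
  - intros t Ht. rewrite Rmin_left, Rmax_right in Ht by lra.
    apply continuity_pt_filterlim. apply @ex_derive_continuous. exists (dphi t).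
    unfold phi, dphi. apply @is_derive_minus; [apply lnmod_derive; lra | apply lsum_scaled_derive].
  - rewrite Rmin_left, Rmax_right in Hc by lra.
    rewrite H0 in Hphi. replace (phi 1) with (dphi c) by lra.
    set (y := (RtoC c * x)%C).
    assert (Hy : Cmod y <= 1 / 4).
    { unfold y. rewrite Cmod_mult, Cmod_R, Rabs_pos_eq by lra. assert (H := Cmod_ge_0 x). nra. }
    assert (Hy1 := Cmod_1_plus y Hy).
    assert (Hn0 : (RtoC 1 + y)%C <> RtoC 0) by (apply Cmod_neq_0; lra).
    replace (dphi c) with (Re (x * (/ (RtoC 1 + y) * (- y) ^ n))%C).
    + eapply Rle_trans; [apply re_le_Cmod|].
      rewrite !Cmod_mult, Cmod_inv, Cmod_pow, Cmod_opp by easy.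
      assert (Hi : / Cmod (RtoC 1 + y)%C <= 2).
      { replace 2 with (/ (1 / 2)) by field. apply Rinv_le_contravar; lra. }
      assert (Hp : Cmod y ^ n <= (1 / 4) ^ n).
      { apply pow_incr. split; [apply Cmod_ge_0 | easy]. }
      assert (Hp0 : 0 <= Cmod y ^ n) by (apply pow_le, Cmod_ge_0).
      assert (Hi0 : 0 <= / Cmod (RtoC 1 + y)%C) by (left; apply Rinv_0_lt_compat; lra).
      assert (Hx0 := Cmod_ge_0 x).
      assert (Cmod x * / Cmod (RtoC 1 + y)%C <= 1) by nra.
      assert (0 <= Cmod x * / Cmod (RtoC 1 + y)%C) by nra.
      rewrite <- Rmult_assoc. nra.
    + unfold dphi. fold y.
      replace ((- y) ^ n)%C with (RtoC 1 - (RtoC 1 + y) * gsum y n)%C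
        by (rewrite gsum_error; ring).
      replace (x * (/ (RtoC 1 + y) * (RtoC 1 - (RtoC 1 + y) * gsum y n)))%C
        with (x * / (RtoC 1 + y) - x * gsum y n)%C by (field; easy).
      reflexivity.
Qed.

Lemma re_approx_ln (V : C2 -> Prop) (f : C2 -> C) :
  (forall z, V z -> Cmod (f z) <= 1 / 4) -> approx V f ->
  re_approx V (fun z => ln (Cmod (RtoC 1 + f z)%C)).
Proof.
  intros HM Hf eps Heps.
  destruct (pow_quarter_small (eps / 2) ltac:(lra)) as [n Hn].
  destruct (approx_lsum V f n HM Hf (eps / 2) ltac:(lra)) as [P [HP HP']].
  exists P. split; [easy|]. intros z Hz.
  assert (H1 := lsum_error (f z) n (HM z Hz)). specialize (HP' z Hz).
  assert (H2 := re_le_Cmod (lsum (f z) n - P z)%C).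
  replace (Re (lsum (f z) n - P z)%C) with (Re (lsum (f z) n) - Re (P z)) in H2 by reflexivity.
  assert (H3 : Rabs (Re (lsum (f z) n) - Re (P z)) <= eps / 2) by lra.
  apply Rabs_le_between in H1, H3. apply Rabs_le. lra.
Qed.

Lemma re_approx_const (V : C2 -> Prop) (a : R) : re_approx V (fun _ => a).
Proof.
  intros eps Heps. exists (fun _ => RtoC a). split; [constructor|]. intros z _.
  simpl. rewrite Rminus_diag, Rabs_R0. lra.
Qed.

Lemma re_approx_plus_scal (V : C2 -> Prop) (f g : C2 -> R) (a : R) :
  re_approx V f -> re_approx V g -> re_approx V (fun z => f z + a * g z).
Proof.
  intros Hf Hg eps Heps. assert (Ha := Rabs_pos a).
  destruct (Hf (eps / 2) ltac:(lra)) as [P [HP HP']].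
  destruct (Hg (eps / (2 * (Rabs a + 1)))) as [Q [HQ HQ']]; [apply Rdiv_lt_0_compat; lra|].
  exists (fun z => P z + RtoC a * Q z)%C. split; [repeat constructor; easy|]. intros z Hz.
  specialize (HP' z Hz). specialize (HQ' z Hz).
  replace (f z + a * g z - Re (P z + RtoC a * Q z)%C)
    with ((f z - Re (P z)) + a * (g z - Re (Q z))).
  2:{ destruct (P z) as [u v], (Q z) as [u' v'].
      unfold Re, Cplus, Cmult, RtoC. cbn [fst snd]. ring. }
  eapply Rle_trans; [apply Rabs_triang|]. rewrite Rabs_mult.
  assert (H : Rabs a * Rabs (g z - Re (Q z)) <= (Rabs a + 1) * (eps / (2 * (Rabs a + 1)))).
  { apply Rmult_le_compat; try apply Rabs_pos; lra. }
  replace ((Rabs a + 1) * (eps / (2 * (Rabs a + 1)))) with (eps / 2) in H by (field; lra).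
  lra.
Qed.

Lemma re_approx_ext (V : C2 -> Prop) (f g : C2 -> R) :
  (forall z, V z -> f z = g z) -> re_approx V f -> re_approx V g.
Proof.
  intros H Hf eps Heps. destruct (Hf eps Heps) as [P [HP HP']].
  exists P. split; [easy|]. intros z Hz. rewrite <- H by easy. auto.
Qed.

Lemma re_approx_limit (V : C2 -> Prop) (f : C2 -> R) :
  (forall eps, 0 < eps -> exists g, re_approx V g /\ forall z, V z -> Rabs (f z - g z) <= eps) ->
  re_approx V f.
Proof.
  intros H eps Heps. destruct (H (eps / 2) ltac:(lra)) as [g [Hg Hfg]].
  destruct (Hg (eps / 2) ltac:(lra)) as [P [HP HP']].
  exists P. split; [easy|]. intros z Hz.
  specialize (Hfg z Hz). specialize (HP' z Hz).
  apply Rabs_le_between in Hfg, HP'. apply Rabs_le. lra.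
Qed.

(** * The automorphisms and their basin *)

Lemma norm_le_cmod2 (v : C2) : @norm C_AbsRing C2h v <= cmod2 v.
Proof.
  change (sqrt (Cmod (fst v) ^ 2 + Cmod (snd v) ^ 2) <= cmod2 v).
  assert (H1 := Cmod_ge_0 (fst v)). assert (H2 := Cmod_ge_0 (snd v)).
  unfold cmod2. rewrite <- (sqrt_pow2 (Cmod (fst v) + Cmod (snd v))) by lra.
  apply sqrt_le_1_alt. nra.
Qed.

Lemma cmod2_le_norm (v : C2) : cmod2 v <= 2 * @norm C_AbsRing C2h v.
Proof.
  change (cmod2 v <= 2 * sqrt (Cmod (fst v) ^ 2 + Cmod (snd v) ^ 2)).
  assert (H1 := Cmod_ge_0 (fst v)). assert (H2 := Cmod_ge_0 (snd v)).
  assert (Cmod (fst v) <= sqrt (Cmod (fst v) ^ 2 + Cmod (snd v) ^ 2)).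
  { rewrite <- (sqrt_pow2 (Cmod (fst v))) at 1 by lra. apply sqrt_le_1_alt. nra. }
  assert (Cmod (snd v) <= sqrt (Cmod (fst v) ^ 2 + Cmod (snd v) ^ 2)).
  { rewrite <- (sqrt_pow2 (Cmod (snd v))) at 1 by lra. apply sqrt_le_1_alt. nra. }
  unfold cmod2. lra.
Qed.

(** * Differentials with quadratic error *)

Definition csub2 (p q : C2) : C2 := (fst p - fst q, snd p - snd q)%C.

Definition cscal2 (c : C) (v : C2) : C2 := (c * fst v, c * snd v)%C.

Definition lin2 (A B A' B' : C) (v : C2) : C2 :=
  (A * fst v + B * snd v, A' * fst v + B' * snd v)%C.

Lemma cplus2_csub2 (p q : C2) : cplus2 p (csub2 q p) = q.
Proof. unfold cplus2, csub2. destruct q; simpl. f_equal; ring. Qed.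

Lemma csub2_cplus2 (p v : C2) : csub2 (cplus2 p v) p = v.
Proof. unfold cplus2, csub2. destruct v; simpl. f_equal; ring. Qed.

Lemma cplus2_csub2_r (p q : C2) : cplus2 (csub2 q p) p = q.
Proof. unfold cplus2, csub2. destruct q; simpl. f_equal; ring. Qed.

Lemma cmod2_triangle (u v : C2) : cmod2 (cplus2 u v) <= cmod2 u + cmod2 v.
Proof.
  unfold cmod2, cplus2; simpl.
  assert (H1 := Cmod_triangle (fst u) (fst v)). assert (H2 := Cmod_triangle (snd u) (snd v)).
  lra.
Qed.

Lemma cmod2_scal (c : C) (v : C2) : cmod2 (cscal2 c v) = Cmod c * cmod2 v.
Proof. unfold cmod2, cscal2; simpl. rewrite !Cmod_mult. ring. Qed.

Lemma lin2_bound (A B A' B' : C) :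
  exists M, 0 < M /\ forall v, cmod2 (lin2 A B A' B' v) <= M * cmod2 v.
Proof.
  exists (Cmod A + Cmod B + Cmod A' + Cmod B' + 1).
  assert (H1 := Cmod_ge_0 A). assert (H2 := Cmod_ge_0 B).
  assert (H3 := Cmod_ge_0 A'). assert (H4 := Cmod_ge_0 B').
  split; [lra|]. intros v.
  assert (H5 := Cmod_ge_0 (fst v)). assert (H6 := Cmod_ge_0 (snd v)).
  unfold cmod2, lin2; simpl.
  assert (T := Cmod_triangle (A * fst v) (B * snd v)).
  assert (T' := Cmod_triangle (A' * fst v) (B' * snd v)).
  rewrite !Cmod_mult in T, T'. nra.
Qed.

Lemma lin2_is_linear (A B A' B' : C) : @is_linear C_AbsRing C2h C2h (lin2 A B A' B').
Proof.
  split.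
  - intros x y. change (lin2 A B A' B' (cplus2 x y) = cplus2 (lin2 A B A' B' x) (lin2 A B A' B' y)).
    unfold lin2, cplus2; simpl. f_equal; ring.
  - intros k x. change (lin2 A B A' B' (cscal2 k x) = cscal2 k (lin2 A B A' B' x)).
    unfold lin2, cscal2; simpl. f_equal; ring.
  - destruct (lin2_bound A B A' B') as [M [HM H]].
    exists (M * 2). split; [lra|]. intros x.
    eapply Rle_trans; [apply norm_le_cmod2|]. eapply Rle_trans; [apply H|].
    rewrite Rmult_assoc. apply Rmult_le_compat_l; [lra | apply cmod2_le_norm].
Qed.

(** Differentiability in quantitative form. Scaling arguments and inductions over iterates work
    directly with such bounds; [expands_filterdiff] converts them once [L] is known to be linear. *)
Definition expands (T : C2 -> C2) (p : C2) (L : C2 -> C2) : Prop :=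
  exists K, 0 <= K /\ forall v, cmod2 v <= 1 ->
    cmod2 (csub2 (csub2 (T (cplus2 p v)) (T p)) (L v)) <= K * cmod2 v ^ 2.

Definition polymap (T : C2 -> C2) : Prop :=
  polyfun (fun z => fst (T z)) /\ polyfun (fun z => snd (T z)).

Lemma polymap_expands (T : C2 -> C2) (p : C2) :
  polymap T -> exists A B A' B', expands T p (lin2 A B A' B').
Proof.
  intros [H1 H2].
  destruct (polyfun_expand _ p H1) as [A [B [K [HK H]]]].
  destruct (polyfun_expand _ p H2) as [A' [B' [K' [HK' H']]]].
  exists A, B, A', B', (K + K'). split; [lra|]. intros v Hv.
  specialize (H v Hv). specialize (H' v Hv).
  unfold cmod2 at 1, csub2, lin2. cbn [fst snd]. lra.
Qed.

Lemma polyfun_comp (f : C2 -> C) (T : C2 -> C2) :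
  polyfun f -> polymap T -> polyfun (fun z => f (T z)).
Proof.
  intros Hf [H1 H2]. induction Hf as [c| | |f g _ IHf _ IHg|f g _ IHf _ IHg|f g Hfg _ IH].
  - constructor.
  - exact H1.
  - exact H2.
  - now constructor.
  - now constructor.
  - apply polyfun_ext with (fun z => f (T z)); [intros; apply Hfg | exact IH].
Qed.

Lemma polymap_comp (S T : C2 -> C2) : polymap S -> polymap T -> polymap (fun z => S (T z)).
Proof.
  intros [H1 H2] HT. split.
  - now apply (polyfun_comp (fun z => fst (S z))).
  - now apply (polyfun_comp (fun z => snd (S z))).
Qed.

Lemma expands_filterdiff (T L : C2 -> C2) (p : C2) :
  @is_linear C_AbsRing C2h C2h L -> expands T p L ->
  @filterdiff C_AbsRing C2h C2h T (Hierarchy.locally (p : C2h)) L.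
Proof.
  intros HL [K [HK H]]. split; [exact HL|].
  intros x Hx. apply is_filter_lim_locally_unique in Hx. subst x.
  intros eps. assert (Heps := cond_pos eps).
  apply locally_polydisc.
  assert (Hr : 0 < Rmin (1 / 2) (eps / (4 * (K + 1)))).
  { apply Rmin_pos; [lra|]. apply Rdiv_lt_0_compat; lra. }
  exists (Rmin (1 / 2) (eps / (4 * (K + 1)))). split; [exact Hr|].
  intros w [H1 H2].
  assert (Ha := Rmin_l (1 / 2) (eps / (4 * (K + 1)))).
  assert (Hb := Rmin_r (1 / 2) (eps / (4 * (K + 1)))).
  change (@norm C_AbsRing C2h (csub2 (csub2 (T w) (T p)) (L (csub2 w p)))
          <= eps * @norm C_AbsRing C2h (csub2 w p)).
  set (v := csub2 w p).
  assert (Hv : cmod2 v < eps / (2 * (K + 1)) /\ cmod2 v <= 1).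
  { unfold cmod2, v, csub2; simpl.
    replace (eps / (2 * (K + 1))) with (eps / (4 * (K + 1)) + eps / (4 * (K + 1))) by (field; lra).
    lra. }
  destruct Hv as [Hv1 Hv2].
  replace (T w) with (T (cplus2 p v)) by (f_equal; apply cplus2_csub2).
  eapply Rle_trans; [apply norm_le_cmod2|]. eapply Rle_trans; [now apply H|].
  assert (Hn := cmod2_le_norm v). assert (Hv0 := cmod2_ge_0 v).
  assert (Hv3 : cmod2 v * (2 * (K + 1)) <= eps).
  { replace (pos eps) with (eps / (2 * (K + 1)) * (2 * (K + 1))) by (field; lra).
    apply Rmult_le_compat_r; lra. }
  assert (K * cmod2 v * 2 <= eps) by nra.
  simpl pow. rewrite Rmult_1_r, <- Rmult_assoc.
  apply Rle_trans with (K * cmod2 v * (2 * @norm C_AbsRing C2h v)).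
  - apply Rmult_le_compat_l; [nra | exact Hn].
  - assert (Hnn := norm_ge_0 (v : C2h)). nra.
Qed.

Lemma polymap_holo (U : C2 -> Prop) (T : C2 -> C2) : polymap T -> holo_on U T.
Proof.
  intros HT z _. destruct (polymap_expands T z HT) as [A [B [A' [B' H]]]].
  exists (lin2 A B A' B'). apply expands_filterdiff; [apply lin2_is_linear | exact H].
Qed.

(** Chain rule along an affine disc. It supplies both the holomorphy of the discs used for the
    Kobayashi metric and their derivative at the centre. *)
Lemma expands_disc (T L : C2 -> C2) (q u : C2) (zeta0 : C) :
  @is_linear C_AbsRing C2h C2h L -> expands T (cline q u zeta0) L ->
  hderiv (fun zeta => T (cline q u zeta)) zeta0 (L u).
Proof.
  intros HL [K [HK H]]. split.
  { split.
    - intros x y. apply (@scal_distr_r C_AbsRing C2h).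
    - intros k x. symmetry. apply (@scal_assoc C_AbsRing C2h).
    - assert (H0 := norm_ge_0 (L u : C2h)).
      exists (@norm C_AbsRing C2h (L u) + 1). split; [lra|]. intros x.
      eapply Rle_trans; [apply (@norm_scal C_AbsRing C2h)|].
      change (Cmod x * @norm C_AbsRing C2h (L u) <= (@norm C_AbsRing C2h (L u) + 1) * Cmod x).
      assert (Hx := Cmod_ge_0 x). nra. }
  intros x Hx.
  apply (@is_filter_lim_locally_unique C_AbsRing C_NormedModule) in Hx. subst x.
  intros eps. assert (Heps := cond_pos eps).
  assert (Hu := cmod2_ge_0 u).
  set (k := K * cmod2 u * cmod2 u + 1).
  assert (Hk : 0 < k) by (unfold k; assert (0 <= K * cmod2 u) by nra; nra).
  assert (Hr : 0 < Rmin (/ (1 + cmod2 u)) (eps / k)).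
  { apply Rmin_pos; [apply Rinv_0_lt_compat; lra|]. now apply Rdiv_lt_0_compat. }
  apply (@locally_le_locally_norm C_AbsRing C_NormedModule).
  exists (mkposreal _ Hr). intros w Hw.
  set (h := (w - zeta0)%C).
  assert (Hh : Cmod h < Rmin (/ (1 + cmod2 u)) (eps / k)) by exact Hw.
  assert (Ha := Rmin_l (/ (1 + cmod2 u)) (eps / k)).
  assert (Hb := Rmin_r (/ (1 + cmod2 u)) (eps / k)).
  assert (Hh0 := Cmod_ge_0 h).
  change (@norm C_AbsRing C2h
     (csub2 (csub2 (T (cline q u w)) (T (cline q u zeta0))) (cscal2 h (L u))) <= eps * Cmod h).
  replace (cscal2 h (L u)) with (L (cscal2 h u)) by (apply (linear_scal L HL h u)).
  replace (cline q u w) with (cplus2 (cline q u zeta0) (cscal2 h u)).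
  2:{ unfold cplus2, cline, cscal2, h; simpl. f_equal; ring. }
  assert (Hh1 : Cmod h * (1 + cmod2 u) <= 1).
  { apply Rle_trans with (/ (1 + cmod2 u) * (1 + cmod2 u)); [|right; field; lra].
    apply Rmult_le_compat_r; lra. }
  assert (Hh2 : Cmod h * k <= eps).
  { replace (pos eps) with (eps / k * k) by (field; lra). apply Rmult_le_compat_r; lra. }
  eapply Rle_trans; [apply norm_le_cmod2|].
  eapply Rle_trans; [apply H; rewrite cmod2_scal; nra|].
  rewrite cmod2_scal. unfold k in Hh2.
  replace (K * (Cmod h * cmod2 u) ^ 2) with (Cmod h * (K * cmod2 u * cmod2 u) * Cmod h) by ring.
  apply Rmult_le_compat_r; nra.
Qed.

(** Squaring at every step keeps pace with the squaring of [z_n]. The base 1/32 makes the tolerance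
    [1 / 2 - 16 * acoef k] of [outside_log_derivative] nonnegative already at [k = 0], where it is
    exactly 0. *)
Definition acoef (n : nat) : R := (/ 32) ^ (2 ^ n).

Lemma acoef_pos (n : nat) : 0 < acoef n.
Proof. apply pow_lt. lra. Qed.

Lemma acoef_S (n : nat) : acoef (S n) = acoef n ^ 2.
Proof.
  unfold acoef. replace (2 ^ S n)%nat with (2 ^ n * 2)%nat by (simpl; lia). now rewrite pow_mult.
Qed.

Lemma acoef_le (n : nat) : acoef n <= / 32.
Proof.
  induction n as [|n IH]; [unfold acoef; simpl; lra|].
  rewrite acoef_S. assert (H := acoef_pos n). simpl. nra.
Qed.

Lemma acoef_neq_0 (n : nat) : RtoC (acoef n) <> RtoC 0.
Proof. apply Cmod_neq_0. rewrite Cmod_R. apply Rabs_pos_lt. assert (H := acoef_pos n). lra. Qed.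

Lemma Cmod_acoef (n : nat) : Cmod (RtoC (acoef n)) = acoef n.
Proof. rewrite Cmod_R. apply Rabs_pos_eq. left. apply acoef_pos. Qed.

Definition henon (n : nat) (z : C2) : C2 :=
  (fst z * fst z + RtoC (acoef n) * snd z, RtoC (acoef n) * fst z)%C.

Definition henon_inv (n : nat) (z : C2) : C2 :=
  let x := (/ RtoC (acoef n) * snd z)%C in
  (x, / RtoC (acoef n) * (fst z + (- RtoC 1) * (x * x)))%C.

Lemma henon_invK (n : nat) (z : C2) : henon_inv n (henon n z) = z.
Proof.
  assert (H := acoef_neq_0 n).
  unfold henon, henon_inv. destruct z as [x y]; simpl. f_equal; field; easy.
Qed.

Lemma henonK (n : nat) (z : C2) : henon n (henon_inv n z) = z.
Proof.
  assert (H := acoef_neq_0 n).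
  unfold henon, henon_inv. destruct z as [x y]; simpl. f_equal; field; easy.
Qed.

Lemma polymap_henon (n : nat) : polymap (henon n).
Proof. split; simpl; repeat constructor. Qed.

Lemma polymap_henon_inv (n : nat) : polymap (henon_inv n).
Proof. split; simpl; repeat constructor. Qed.

Lemma henon_automorphism (n : nat) : holo_automorphism (henon n).
Proof.
  exists (henon_inv n).
  repeat split; auto using polymap_holo, polymap_henon, polymap_henon_inv, henonK, henon_invK.
Qed.

Definition dhenon (n : nat) (q : C2) : C2 -> C2 :=
  lin2 (RtoC 2 * fst q) (RtoC (acoef n)) (RtoC (acoef n)) (RtoC 0).

Lemma henon_expand (n : nat) (q v : C2) :
  csub2 (csub2 (henon n (cplus2 q v)) (henon n q)) (dhenon n q v) = (fst v * fst v, RtoC 0)%C.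
Proof.
  unfold csub2, henon, cplus2, dhenon, lin2; simpl. f_equal; ring.
Qed.

Lemma henon_expands (n : nat) (q : C2) : expands (henon n) q (dhenon n q).
Proof.
  exists 1. split; [lra|]. intros v _. rewrite henon_expand.
  unfold cmod2; simpl. rewrite Cmod_0, Cmod_mult.
  assert (H1 := Cmod_ge_0 (fst v)). assert (H2 := Cmod_ge_0 (snd v)). nra.
Qed.

Lemma henon_attracting (n : nat) : attracting_fixed_origin (henon n).
Proof.
  split.
  - unfold henon, zero2; simpl. f_equal; ring.
  - exists (dhenon n zero2). split.
    + apply expands_filterdiff; [apply lin2_is_linear | apply henon_expands].
    + intros lam v Hv E.
      change (dhenon n zero2 v = cscal2 lam v) in E.
      unfold dhenon, lin2, cscal2, zero2 in E; simpl in E.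
      destruct v as [x y]. simpl in E.
      assert (E1 := f_equal fst E). assert (E2 := f_equal snd E). simpl in E1, E2.
      replace (RtoC 2 * RtoC 0 * x + RtoC (acoef n) * y)%C
        with (RtoC (acoef n) * y)%C in E1 by ring.
      replace (RtoC (acoef n) * x + RtoC 0 * y)%C with (RtoC (acoef n) * x)%C in E2 by ring.
      (* The differential at 0 exchanges the coordinates and multiplies them by [a = acoef n]. If
         [|lam| >= 1], then [|x| <= a |y|] and [|y| <= a |x|] with [a < 1], so both vanish. *)
      apply (f_equal Cmod) in E1, E2. rewrite !Cmod_mult, Cmod_acoef in E1, E2.
      assert (Hx := Cmod_ge_0 x). assert (Hy := Cmod_ge_0 y). assert (Hl := Cmod_ge_0 lam).
      assert (Ha := acoef_pos n). assert (Ha' := acoef_le n).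
      apply Rnot_le_lt. intros Hlam. apply Hv.
      assert (Hx0 : Cmod x = 0) by nra. assert (Hy0 : Cmod y = 0) by nra.
      apply Cmod_eq_0 in Hx0, Hy0. unfold zero2. now rewrite Hx0, Hy0.
Qed.

(** Shifted by one against [ncomp]: stage 0 is the identity and the map with index [n] leads from
    stage [n] to stage [n + 1], so [acoef n] always goes with [orb n]. *)
Fixpoint orb (n : nat) (p : C2) : C2 :=
  match n with O => p | S m => henon m (orb m p) end.

Fixpoint orb_inv (n : nat) (p : C2) : C2 :=
  match n with O => p | S m => orb_inv m (henon_inv m p) end.

Lemma ncomp_orb (n : nat) (p : C2) : ncomp henon n p = orb (S n) p.
Proof. induction n as [|n IH]; [easy|]. simpl in *. now rewrite IH. Qed.

Lemma orb_invK (n : nat) (p : C2) : orb_inv n (orb n p) = p.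
Proof. induction n as [|n IH]; simpl; [easy|]. now rewrite henon_invK. Qed.

Lemma orbK (n : nat) (p : C2) : orb n (orb_inv n p) = p.
Proof. revert p. induction n as [|n IH]; intros p; simpl; [easy|]. now rewrite IH, henonK. Qed.

Lemma polymap_id : polymap (fun z => z).
Proof. split; constructor. Qed.

Lemma polymap_orb (n : nat) : polymap (orb n).
Proof.
  induction n as [|n IH]; [apply polymap_id|].
  apply (polymap_comp (henon n) (orb n)); [apply polymap_henon | exact IH].
Qed.

Lemma polymap_orb_inv (n : nat) : polymap (orb_inv n).
Proof.
  induction n as [|n IH]; [apply polymap_id|].
  apply (polymap_comp (orb_inv n) (henon_inv n)); [exact IH | apply polymap_henon_inv].
Qed.

(** * The basin and its exhaustion by balls *)

Lemma basin_iff (p : C2) :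
  basin henon p <-> forall eps, 0 < eps -> exists N, forall n, (N <= n)%nat ->
    Cmod (fst (orb n p)) < eps /\ Cmod (snd (orb n p)) < eps.
Proof.
  assert (Hpd : forall r n, polydisc zero2 r (orb n p) <->
    Cmod (fst (orb n p)) < r /\ Cmod (snd (orb n p)) < r).
  { intros r n. unfold polydisc, zero2; simpl.
    replace (fst (orb n p) - RtoC 0)%C with (fst (orb n p)) by ring.
    replace (snd (orb n p) - RtoC 0)%C with (snd (orb n p)) by ring. easy. }
  split.
  - intros H eps Heps.
    destruct (H (polydisc zero2 eps)) as [N HN].
    { apply locally_polydisc. exists eps. split; [easy|]. auto. }
    exists (S N). intros n Hn. destruct n as [|n]; [lia|].
    apply Hpd. rewrite <- ncomp_orb. apply HN. lia.
  - intros H Q HQ. apply locally_polydisc in HQ. destruct HQ as [r [Hr HQ]].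
    destruct (H r Hr) as [N HN]. exists N. intros n Hn. apply HQ.
    rewrite ncomp_orb. apply Hpd. apply HN. lia.
Qed.

Lemma henon_step (n : nat) (z : C2) :
  Cmod (fst (henon n z)) <= Cmod (fst z) ^ 2 + acoef n * Cmod (snd z) /\
  Cmod (snd (henon n z)) = acoef n * Cmod (fst z).
Proof.
  unfold henon; simpl. split.
  - eapply Rle_trans; [apply Cmod_triangle|]. rewrite !Cmod_mult, Cmod_acoef. lra.
  - now rewrite Cmod_mult, Cmod_acoef.
Qed.

Lemma pow_mult_small (q b eps : R) :
  0 <= q < 1 -> 0 < eps -> exists N, forall n, (N <= n)%nat -> b * q ^ n < eps.
Proof.
  intros Hq Heps. assert (Hb := Rabs_pos b).
  destruct (pow_lt_1_zero q) with (y := eps / (Rabs b + 1)) as [N HN].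
  - rewrite Rabs_pos_eq; lra.
  - apply Rdiv_lt_0_compat; lra.
  - exists N. intros n Hn. specialize (HN n ltac:(lia)).
    assert (H0 : 0 <= q ^ n) by (apply pow_le; lra).
    rewrite Rabs_pos_eq in HN by easy.
    assert (q ^ n * (Rabs b + 1) < eps).
    { replace eps with (eps / (Rabs b + 1) * (Rabs b + 1)) by (field; lra).
      apply Rmult_lt_compat_r; lra. }
    assert (Hb' := Rle_abs b). nra.
Qed.

(** On the bidisc of radius 3/4 squaring contracts by 3/4 and the perturbation adds at most 1/32,
    whence the rate 25/32. This bidisc is larger than the exhausting ball because points outside the
    basin have to satisfy a lower bound on [|z_n|] that leaves room for perturbation. *)
Lemma basin_absorb (p : C2) (n : nat) :
  Cmod (fst (orb n p)) <= 3 / 4 -> Cmod (snd (orb n p)) <= 3 / 4 -> basin henon p.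
Proof.
  intros H1 H2. apply basin_iff.
  assert (H : forall k, Cmod (fst (orb (n + k) p)) <= 3 / 4 * (25 / 32) ^ k /\
                        Cmod (snd (orb (n + k) p)) <= 3 / 4 * (25 / 32) ^ k).
  { induction k as [|k [IH1 IH2]].
    - rewrite Nat.add_0_r. simpl. lra.
    - rewrite Nat.add_succ_r.
      change (orb (S (n + k)) p) with (henon (n + k) (orb (n + k) p)).
      destruct (henon_step (n + k) (orb (n + k) p)) as [S1 S2].
      assert (Ha := acoef_pos (n + k)). assert (Ha' := acoef_le (n + k)).
      assert (Hz := Cmod_ge_0 (fst (orb (n + k) p))).
      assert (Hw := Cmod_ge_0 (snd (orb (n + k) p))).
      assert (Hq : 0 < (25 / 32) ^ k <= 1).
      { split; [apply pow_lt; lra|]. rewrite <- (pow1 k). apply pow_incr. lra. }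
      simpl pow. simpl pow in S1.
      set (x := Cmod (fst (orb (n + k) p))) in *. set (y := Cmod (snd (orb (n + k) p))) in *.
      set (q := (25 / 32) ^ k) in *.
      assert (Hxx : x * x <= 3 / 4 * (3 / 4 * q)) by (apply Rmult_le_compat; lra).
      assert (Hay : acoef (n + k) * y <= / 32 * (3 / 4 * q)) by (apply Rmult_le_compat; lra).
      assert (Hax : acoef (n + k) * x <= / 32 * (3 / 4 * q)) by (apply Rmult_le_compat; lra).
      split; lra. }
  intros eps Heps. destruct (pow_mult_small (25 / 32) (3 / 4) eps ltac:(lra) Heps) as [N HN].
  exists (n + N)%nat. intros m Hm. replace m with (n + (m - n))%nat by lia.
  specialize (H (m - n)%nat). specialize (HN (m - n)%nat ltac:(lia)). lra.
Qed.

Definition exhaust (j : nat) (z : C2) : Prop := ball2 (cscal2 (RtoC 2) (orb j z)).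

Lemma exhaust_iff (j : nat) (z : C2) :
  exhaust j z <-> 4 * Cmod (fst (orb j z)) ^ 2 + 4 * Cmod (snd (orb j z)) ^ 2 < 1.
Proof.
  unfold exhaust, ball2, cscal2; simpl. rewrite !Cmod_mult, Cmod_R, Rabs_pos_eq by lra.
  split; intros; lra.
Qed.

Lemma exhaust_incr (j : nat) (z : C2) : exhaust j z -> exhaust (S j) z.
Proof.
  rewrite !exhaust_iff. simpl orb. intros H.
  destruct (henon_step j (orb j z)) as [S1 S2].
  assert (Ha := acoef_pos j). assert (Ha' := acoef_le j).
  assert (Hz := Cmod_ge_0 (fst (orb j z))). assert (Hw := Cmod_ge_0 (snd (orb j z))).
  assert (Hz' := Cmod_ge_0 (fst (henon j (orb j z)))).
  rewrite S2.
  set (x := Cmod (fst (orb j z))) in *. set (y := Cmod (snd (orb j z))) in *.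
  set (x' := Cmod (fst (henon j (orb j z)))) in *. set (a := acoef j) in *.
  assert (Hx : x <= 1 / 2) by nra.
  assert (H1 : x' <= x / 2 + y / 32) by nra.
  assert (H2 : a * x <= x / 32) by nra.
  assert (H3 : 0 <= a * x) by nra.
  assert (H4 : x' ^ 2 <= (x / 2 + y / 32) ^ 2) by (apply pow_incr; lra).
  assert (H5 : (a * x) ^ 2 <= (x / 32) ^ 2) by (apply pow_incr; lra).
  (* This bounds the cross term: [(x / 2 + y / 32) ^ 2] is at most [x ^ 2 / 2 + y ^ 2 / 512], which
     leaves room for the second coordinate below [x ^ 2 + y ^ 2]. *)
  assert (H6 : 0 <= (x / 2 - y / 32) ^ 2) by apply pow2_ge_0.
  assert (H7 := pow2_ge_0 x). assert (H8 := pow2_ge_0 y).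
  nra.
Qed.

Lemma exhaust_basin (z : C2) : basin henon z <-> exists j, exhaust j z.
Proof.
  split.
  - intros H. destruct (proj1 (basin_iff z) H (1 / 4) ltac:(lra)) as [N HN].
    exists N. apply exhaust_iff. destruct (HN N ltac:(lia)) as [H1 H2].
    assert (Hz := Cmod_ge_0 (fst (orb N z))). assert (Hw := Cmod_ge_0 (snd (orb N z))).
    simpl. nra.
  - intros [j H]. apply exhaust_iff in H.
    assert (Hz := Cmod_ge_0 (fst (orb j z))). assert (Hw := Cmod_ge_0 (snd (orb j z))).
    simpl in H. apply basin_absorb with j; nra.
Qed.

Lemma polymap_scal (c : C) (T : C2 -> C2) : polymap T -> polymap (fun z => cscal2 c (T z)).
Proof.
  intros [H1 H2]. split; simpl; apply polyfun_mult; (constructor || assumption).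
Qed.

Lemma exhaust_open (j : nat) : openC2 (exhaust j).
Proof.
  change (forall z : C2, exhaust j z -> Hierarchy.locally (z : C2h) (exhaust j)).
  intros z Hz. apply locally_polydisc.
  apply exhaust_iff in Hz.
  set (x := Cmod (fst (orb j z))) in *. set (y := Cmod (snd (orb j z))) in *.
  assert (Hx : 0 <= x) by apply Cmod_ge_0. assert (Hy : 0 <= y) by apply Cmod_ge_0.
  (* Enlarging [x] and [y] by [d] adds [8 d (x + y) + 8 d ^ 2], which stays below the slack [24 d]
     because [x, y <= 1/2] and [d <= 1/24]. *)
  set (d := (1 - (4 * x ^ 2 + 4 * y ^ 2)) / 24).
  assert (Hd : 0 < d) by (unfold d; lra).
  assert (Hx1 : x <= 1 / 2) by (simpl in *; nra). assert (Hy1 : y <= 1 / 2) by (simpl in *; nra).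
  assert (Hd1 : d <= 1 / 24) by (unfold d; simpl in *; nra).
  destruct (polyfun_continuous _ z d (proj1 (polymap_orb j)) Hd) as [r1 [Hr1 C1]].
  destruct (polyfun_continuous _ z d (proj2 (polymap_orb j)) Hd) as [r2 [Hr2 C2']].
  exists (Rmin r1 r2). split; [now apply Rmin_pos|]. intros w Hw.
  assert (Hw1 : polydisc z r1 w) by (eapply polydisc_le; [apply Rmin_l | exact Hw]).
  assert (Hw2 : polydisc z r2 w) by (eapply polydisc_le; [apply Rmin_r | exact Hw]).
  specialize (C1 w Hw1). specialize (C2' w Hw2). simpl in C1, C2'.
  apply exhaust_iff.
  assert (T1 := Cmod_triangle (fst (orb j w) - fst (orb j z))%C (fst (orb j z))).
  replace (fst (orb j w) - fst (orb j z) + fst (orb j z))%C with (fst (orb j w)) in T1 by ring.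
  assert (T2 := Cmod_triangle (snd (orb j w) - snd (orb j z))%C (snd (orb j z))).
  replace (snd (orb j w) - snd (orb j z) + snd (orb j z))%C with (snd (orb j w)) in T2 by ring.
  fold x in T1. fold y in T2.
  assert (Hz' := Cmod_ge_0 (fst (orb j w))). assert (Hw' := Cmod_ge_0 (snd (orb j w))).
  assert (B1 : Cmod (fst (orb j w)) ^ 2 < (x + d) ^ 2) by (simpl; nra).
  assert (B2 : Cmod (snd (orb j w)) ^ 2 < (y + d) ^ 2) by (simpl; nra).
  assert (E : 4 * x ^ 2 + 4 * y ^ 2 = 1 - 24 * d) by (unfold d; field).
  simpl in *. nra.
Qed.

Lemma exhaust_biholo (j : nat) : biholo_to_ball (exhaust j).
Proof.
  split; [apply exhaust_open|].
  exists (fun z => cscal2 (RtoC 2) (orb j z)), (fun w => orb_inv j (cscal2 (RtoC (/ 2)) w)).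
  assert (E : forall v, cscal2 (RtoC (/ 2)) (cscal2 (RtoC 2) v) = v).
  { intros [x y]. unfold cscal2; simpl. rewrite !Cmult_assoc, <- !RtoC_mult, Rinv_l by lra.
    f_equal; ring. }
  assert (E' : forall v, cscal2 (RtoC 2) (cscal2 (RtoC (/ 2)) v) = v).
  { intros [x y]. unfold cscal2; simpl. rewrite !Cmult_assoc, <- !RtoC_mult, Rinv_r by lra.
    f_equal; ring. }
  repeat split.
  - apply polymap_holo, polymap_scal, polymap_orb.
  - apply polymap_holo. apply (polymap_comp (orb_inv j)); [apply polymap_orb_inv|].
    apply polymap_scal, polymap_id.
  - exact H.
  - now rewrite E, orb_invK.
  - unfold exhaust. now rewrite orbK, E'.
  - now rewrite orbK, E'.
Qed.

Lemma basin_open (p : C2) : basin henon p -> Hierarchy.locally (p : C2h) (basin henon).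
Proof.
  intros Hp. apply exhaust_basin in Hp. destruct Hp as [j Hj].
  destruct (proj1 (locally_polydisc p _) (exhaust_open j p Hj)) as [r [Hr H]].
  apply locally_polydisc. exists r. split; [easy|].
  intros z Hz. apply exhaust_basin. exists j. auto.
Qed.

(** * Differentials of the iterates and the Kobayashi metric *)

Fixpoint dorb (n : nat) (p v : C2) : C2 :=
  match n with O => v | S m => dhenon m (orb m p) (dorb m p v) end.

Lemma cmod2_sqr_fst (y : C2) : cmod2 (fst y * fst y, RtoC 0)%C <= cmod2 y * cmod2 y.
Proof.
  unfold cmod2; simpl. rewrite Cmod_0, Cmod_mult.
  assert (H1 := Cmod_ge_0 (fst y)). assert (H2 := Cmod_ge_0 (snd y)). nra.
Qed.

Lemma orb_expands (n : nat) (p : C2) : expands (orb n) p (dorb n p).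
Proof.
  (* The error of one more map is the square of the displacement [y] produced by the previous ones,
     so a Lipschitz bound [c] must be carried through the induction next to the quadratic bound
     [K]. *)
  assert (H : exists c K, 0 <= c /\ 0 <= K /\ forall v, cmod2 v <= 1 ->
    cmod2 (csub2 (orb n (cplus2 p v)) (orb n p)) <= c * cmod2 v /\
    cmod2 (csub2 (csub2 (orb n (cplus2 p v)) (orb n p)) (dorb n p v)) <= K * cmod2 v ^ 2).
  { induction n as [|n [c [K [Hc [HK IH]]]]].
    - exists 1, 0. split; [lra|]. split; [lra|]. intros v _. simpl.
      rewrite csub2_cplus2.
      replace (csub2 v v) with zero2 by (unfold csub2, zero2; destruct v; simpl; f_equal; ring).
      unfold cmod2 at 3. simpl. rewrite Cmod_0. lra.
    - set (q := orb n p) in *.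
      destruct (lin2_bound (RtoC 2 * fst q) (RtoC (acoef n)) (RtoC (acoef n)) (RtoC 0))
        as [M [HM HL]].
      change (lin2 (RtoC 2 * fst q) (RtoC (acoef n)) (RtoC (acoef n)) (RtoC 0))
        with (dhenon n q) in HL.
      exists (M * c + c * c), (M * K + c * c).
      split; [nra|]. split; [nra|]. intros v Hv. destruct (IH v Hv) as [I1 I2].
      simpl orb. simpl dorb. fold q.
      set (y := csub2 (orb n (cplus2 p v)) q) in *.
      replace (orb n (cplus2 p v)) with (cplus2 q y)
        by apply cplus2_csub2.
      set (r := csub2 y (dorb n p v)) in *.
      assert (E := henon_expand n q y).
      set (X := csub2 (henon n (cplus2 q y)) (henon n q)) in *.
      assert (E1 : X = cplus2 (dhenon n q y) (fst y * fst y, RtoC 0)%C).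
      { rewrite <- E. symmetry. apply cplus2_csub2. }
      assert (E2 : csub2 X (dhenon n q (dorb n p v)) =
                   cplus2 (dhenon n q r) (fst y * fst y, RtoC 0)%C).
      { rewrite E1. unfold r, csub2, cplus2, dhenon, lin2; simpl. f_equal; ring. }
      rewrite E2. rewrite E1.
      assert (Hv0 := cmod2_ge_0 v). assert (Hy0 := cmod2_ge_0 y). assert (Hr0 := cmod2_ge_0 r).
      assert (Hsq := cmod2_sqr_fst y).
      assert (Hyy : cmod2 y * cmod2 y <= (c * cmod2 v) * (c * cmod2 v))
        by (apply Rmult_le_compat; lra).
      assert (Hvv : cmod2 v * cmod2 v <= cmod2 v) by nra.
      assert (Hcc : c * c * (cmod2 v * cmod2 v) <= c * c * cmod2 v)
        by (apply Rmult_le_compat_l; nra).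
      assert (T1 := cmod2_triangle (dhenon n q y) (fst y * fst y, RtoC 0)%C).
      assert (T2 := cmod2_triangle (dhenon n q r) (fst y * fst y, RtoC 0)%C).
      assert (L1 := HL y). assert (L2 := HL r).
      assert (L1' : M * cmod2 y <= M * (c * cmod2 v)) by (apply Rmult_le_compat_l; lra).
      assert (L2' : M * cmod2 r <= M * (K * cmod2 v ^ 2)) by (apply Rmult_le_compat_l; lra).
      simpl pow in *. split; nra. }
  destruct H as [c [K [_ [HK H]]]]. exists K. split; [easy|]. intros v Hv. now apply H.
Qed.

Lemma dorb_scal (n : nat) (p : C2) (c : C) (v : C2) :
  dorb n p (cscal2 c v) = cscal2 c (dorb n p v).
Proof.
  induction n as [|n IH]; simpl; [easy|]. rewrite IH.
  unfold dhenon, lin2, cscal2; simpl. f_equal; ring.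
Qed.

(** Each [dhenon] has determinant [- acoef n ^ 2], which is not 0. This allows a direction at [p] to
    be prescribed by its image at stage [n]. *)
Lemma dorb_surj (n : nat) (p y : C2) : exists e, dorb n p e = y.
Proof.
  revert y. induction n as [|n IH]; intros y; [now exists y|].
  assert (Ha := acoef_neq_0 n).
  destruct (IH (/ RtoC (acoef n) * snd y, / RtoC (acoef n) *
     (fst y - RtoC 2 * fst (orb n p) * (/ RtoC (acoef n) * snd y)))%C) as [e He].
  exists e. simpl. rewrite He. unfold dhenon, lin2; simpl. destruct y; simpl. f_equal; field; easy.
Qed.

(** Differentiating [T (S z) = z] at [p]. Expanding both maps along [t v] shows that [t] times
    [v - L (A v)] has size at most [Q t ^ 2] for small [t], which forces that vector to vanish. The
    quantity [W + K * V ^ 2] bounds the displacement under [S] divided by [t]. *)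
Lemma expands_inverse (S T L : C2 -> C2) (A : C2 -> C2) (p v : C2) :
  (forall z, T (S z) = z) ->
  expands S p A -> expands T (S p) L -> @is_linear C_AbsRing C2h C2h L ->
  (forall c u, A (cscal2 c u) = cscal2 c (A u)) ->
  L (A v) = v.
Proof.
  intros HTS [K [HK HS]] [K' [HK' HT]] HL HA.
  destruct (linear_norm L HL) as [M [HM HLM]].
  assert (HLM' : forall u, cmod2 (L u) <= 2 * M * cmod2 u).
  { intros u. eapply Rle_trans; [apply cmod2_le_norm|].
    assert (H1 : @norm C_AbsRing C2h (L u) <= M * @norm C_AbsRing C2h u) by apply HLM.
    assert (H2 := norm_le_cmod2 u).
    assert (M * @norm C_AbsRing C2h u <= M * cmod2 u) by (apply Rmult_le_compat_l; lra). lra. }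
  assert (Hv0 := cmod2_ge_0 v). set (V := cmod2 v) in *.
  assert (HAv0 := cmod2_ge_0 (A v)). set (W := cmod2 (A v)) in *.
  set (X := csub2 v (L (A v))).
  set (Q := K' * (W + K * V ^ 2) ^ 2 + 2 * M * (K * V ^ 2)).
  assert (HV2 : 0 <= V ^ 2) by (simpl; nra).
  assert (HKV : 0 <= K * V ^ 2) by nra.
  assert (HQ : 0 <= Q).
  { unfold Q. assert (0 <= (W + K * V ^ 2) ^ 2) by (simpl; nra).
    assert (0 <= 2 * M * (K * V ^ 2)) by nra. nra. }
  assert (Hkey : forall t, 0 < t <= / (1 + V + (W + K * V ^ 2)) -> cmod2 X <= Q * t).
  { intros t [Ht0 Ht].
    assert (Hs : 0 < 1 + V + (W + K * V ^ 2)) by lra.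
    assert (Ht1 : t * (1 + V + (W + K * V ^ 2)) <= 1).
    { apply Rle_trans with (/ (1 + V + (W + K * V ^ 2)) * (1 + V + (W + K * V ^ 2)));
        [|right; rewrite Rinv_l; lra].
      apply Rmult_le_compat_r; lra. }
    assert (HtC : Cmod (RtoC t) = t) by (rewrite Cmod_R, Rabs_pos_eq; lra).
    assert (HtV0 : 0 <= t * V) by (apply Rmult_le_pos; lra).
    assert (HtW0 : 0 <= t * (W + K * V ^ 2)) by (apply Rmult_le_pos; lra).
    replace (t * (1 + V + (W + K * V ^ 2))) with (t + t * V + t * (W + K * V ^ 2)) in Ht1 by ring.
    assert (Htle1 : t <= 1) by lra.
    assert (Htv : cmod2 (cscal2 (RtoC t) v) = t * V) by now rewrite cmod2_scal, HtC.
    assert (H1 := HS (cscal2 (RtoC t) v) ltac:(rewrite Htv; lra)).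
    rewrite Htv, HA in H1.
    set (y := csub2 (S (cplus2 p (cscal2 (RtoC t) v))) (S p)) in *.
    set (r := csub2 y (cscal2 (RtoC t) (A v))) in *.
    assert (Hy : cmod2 y <= t * (W + K * V ^ 2)).
    { replace y with (cplus2 (cscal2 (RtoC t) (A v)) r)
        by apply cplus2_csub2.
      eapply Rle_trans; [apply cmod2_triangle|]. rewrite cmod2_scal, HtC.
      fold W. simpl pow in *.
      assert (t * t * (K * (V * V)) <= t * (K * (V * V))).
      { rewrite Rmult_assoc. apply Rmult_le_compat_l; [lra|]. nra. }
      nra. }
    assert (Hy0 := cmod2_ge_0 y).
    assert (H2 := HT y ltac:(lra)).
    replace (cplus2 (S p) y) with (S (cplus2 p (cscal2 (RtoC t) v))) in H2
      by (symmetry; apply cplus2_csub2).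
    rewrite !HTS in H2.
    rewrite csub2_cplus2 in H2.
    assert (EL : L y = cplus2 (cscal2 (RtoC t) (L (A v))) (L r)).
    { replace y with (cplus2 (cscal2 (RtoC t) (A v)) r) at 1
        by apply cplus2_csub2.
      transitivity (cplus2 (L (cscal2 (RtoC t) (A v))) (L r)); [apply (linear_plus L HL)|].
      f_equal. apply (linear_scal L HL). }
    rewrite EL in H2.
    replace (csub2 (cscal2 (RtoC t) v) (cplus2 (cscal2 (RtoC t) (L (A v))) (L r)))
      with (csub2 (cscal2 (RtoC t) X) (L r)) in H2
      by (unfold X, cplus2, csub2, cscal2; simpl; f_equal; ring).
    assert (H3 : cmod2 (cscal2 (RtoC t) X) <= K' * cmod2 y ^ 2 + 2 * M * cmod2 r).
    { replace (cscal2 (RtoC t) X) with (cplus2 (csub2 (cscal2 (RtoC t) X) (L r)) (L r))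
        by apply cplus2_csub2_r.
      eapply Rle_trans; [apply cmod2_triangle|]. specialize (HLM' r). lra. }
    rewrite cmod2_scal, HtC in H3.
    assert (H4 : K' * cmod2 y ^ 2 <= K' * (t * (W + K * V ^ 2)) ^ 2).
    { apply Rmult_le_compat_l; [lra|]. apply pow_incr. lra. }
    assert (H5 : 2 * M * cmod2 r <= 2 * M * (K * (t * V) ^ 2)).
    { apply Rmult_le_compat_l; lra. }
    apply (Rmult_le_reg_l t); [lra|].
    replace (t * (Q * t)) with (K' * (t * (W + K * V ^ 2)) ^ 2 + 2 * M * (K * (t * V) ^ 2))
      by (unfold Q; ring).
    lra. }
  assert (HX : cmod2 X = 0).
  { apply Rle_antisym; [|apply cmod2_ge_0]. apply le_epsilon. intros eps Heps.
    set (b := / (1 + V + (W + K * V ^ 2))) in *.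
    assert (Hb : 0 < b) by (apply Rinv_0_lt_compat; lra).
    set (t := Rmin b (eps / (Q + 1))).
    assert (Ht : 0 < t) by (apply Rmin_pos; [easy | apply Rdiv_lt_0_compat; lra]).
    assert (Ht1 : t <= b) by apply Rmin_l.
    assert (Ht2 : t <= eps / (Q + 1)) by apply Rmin_r.
    specialize (Hkey t (conj Ht Ht1)).
    assert (t * (Q + 1) <= eps).
    { replace eps with (eps / (Q + 1) * (Q + 1)) by (field; lra).
      apply Rmult_le_compat_r; lra. }
    nra. }
  unfold cmod2 in HX.
  assert (H1 := Cmod_ge_0 (fst X)). assert (H2 := Cmod_ge_0 (snd X)).
  assert (X1 : fst X = RtoC 0) by (apply Cmod_eq_0; lra).
  assert (X2 : snd X = RtoC 0) by (apply Cmod_eq_0; lra).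
  unfold X, csub2 in X1, X2. simpl in X1, X2.
  apply injective_projections.
  - replace (fst v) with ((fst v - fst (L (A v))) + fst (L (A v)))%C by ring. rewrite X1. ring.
  - replace (snd v) with ((snd v - snd (L (A v))) + snd (L (A v)))%C by ring. rewrite X2. ring.
Qed.

(** Once [|z_n| < 1/8], the moduli in each column of the matrix of [dhenon] add up to at most
    [1/4 + 1/32], so every further step at least halves [cmod2]. *)
Lemma dorb_small (p v : C2) (eps : R) :
  basin henon p -> 0 < eps -> exists N, forall n, (N <= n)%nat -> cmod2 (dorb n p v) < eps.
Proof.
  intros Hp Heps.
  destruct (proj1 (basin_iff p) Hp (1 / 8) ltac:(lra)) as [N HN].
  assert (H : forall k, cmod2 (dorb (N + k) p v) <= cmod2 (dorb N p v) * (1 / 2) ^ k).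
  { induction k as [|k IH].
    - rewrite Nat.add_0_r. simpl. lra.
    - rewrite Nat.add_succ_r.
      change (dorb (S (N + k)) p v) with (dhenon (N + k) (orb (N + k) p) (dorb (N + k) p v)).
      destruct (HN (N + k)%nat ltac:(lia)) as [Hz _].
      set (q := orb (N + k) p) in *. set (u := dorb (N + k) p v) in *.
      assert (Ha := acoef_pos (N + k)). assert (Ha' := acoef_le (N + k)).
      assert (Hstep : cmod2 (dhenon (N + k) q u) <= 1 / 2 * cmod2 u).
      { unfold cmod2, dhenon, lin2; simpl.
        assert (T1 := Cmod_triangle (RtoC 2 * fst q * fst u) (RtoC (acoef (N + k)) * snd u)).
        assert (T2 := Cmod_triangle (RtoC (acoef (N + k)) * fst u) (RtoC 0 * snd u)).
        rewrite !Cmod_mult, Cmod_acoef in T1.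
        rewrite !Cmod_mult, Cmod_acoef, Cmod_0 in T2.
        rewrite Cmod_R, Rabs_pos_eq in T1 by lra.
        assert (H1 := Cmod_ge_0 (fst u)). assert (H2 := Cmod_ge_0 (snd u)).
        assert (H3 := Cmod_ge_0 (fst q)).
        assert (2 * Cmod (fst q) * Cmod (fst u) <= 1 / 4 * Cmod (fst u))
          by (apply Rmult_le_compat_r; lra).
        assert (acoef (N + k) * Cmod (fst u) <= / 32 * Cmod (fst u))
          by (apply Rmult_le_compat_r; lra).
        assert (acoef (N + k) * Cmod (snd u) <= / 32 * Cmod (snd u))
          by (apply Rmult_le_compat_r; lra).
        lra. }
      simpl pow. lra. }
  destruct (pow_mult_small (1 / 2) (cmod2 (dorb N p v)) eps ltac:(lra) Heps) as [N' HN'].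
  exists (N + N')%nat. intros n Hn. replace n with (N + (n - N))%nat by lia.
  specialize (H (n - N)%nat). specialize (HN' (n - N)%nat ltac:(lia)). lra.
Qed.

Lemma kobayashi_basin (p v : C2) : basin henon p -> kobayashi (basin henon) p v = Finite 0.
Proof.
  intros Hp. apply is_glb_Rbar_unique. split.
  - intros r [a [f [w [-> _]]]]. simpl. apply Cmod_ge_0.
  - intros b Hb.
    assert (Hsmall : forall eps, 0 < eps -> Rbar_le b (Finite eps)).
    { intros eps Heps. apply Hb.
      destruct (proj1 (basin_iff p) Hp (1 / 8) ltac:(lra)) as [N1 HN1].
      destruct (dorb_small p v (eps / 8) Hp ltac:(lra)) as [N2 HN2].
      set (n := max N1 N2).
      destruct (HN1 n ltac:(unfold n; lia)) as [Hz Hw].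
      specialize (HN2 n ltac:(unfold n; lia)).
      destruct (polymap_expands (orb_inv n) (orb n p) (polymap_orb_inv n))
        as [A [B [A' [B' HL]]]].
      assert (HLv := expands_inverse (orb n) (orb_inv n) (lin2 A B A' B') (dorb n p) p v
        (orb_invK n) (orb_expands n p) HL (lin2_is_linear A B A' B') (dorb_scal n p)).
      assert (HepsC : RtoC eps <> RtoC 0).
      { apply Cmod_neq_0. rewrite Cmod_R. apply Rabs_pos_lt. lra. }
      (* The affine disc at stage [n] has centre and radius vector of coordinates below 1/8, so it
         stays in the absorbing bidisc. Pulled back by [orb_inv n] it has derivative [v / eps] at 0,
         which makes [eps] a competitor in the infimum. *)
      set (u := cscal2 (/ RtoC eps)%C (dorb n p v)).
      assert (Hu : cmod2 u < 1 / 8).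
      { unfold u. rewrite cmod2_scal, Cmod_inv, Cmod_R, Rabs_pos_eq by (lra || easy).
        apply (Rmult_lt_reg_l eps); [easy|].
        rewrite <- Rmult_assoc, Rinv_r, Rmult_1_l by lra. lra. }
      exists (RtoC eps), (fun zeta => orb_inv n (cline (orb n p) u zeta)),
        (cscal2 (/ RtoC eps)%C v).
      split; [now rewrite Cmod_R, Rabs_pos_eq by lra|].
      split; [|split; [|split]].
      - intros zeta Hzeta. split.
        + apply basin_absorb with n; rewrite orbK; unfold cline; cbn [fst snd].
          * eapply Rle_trans; [apply Cmod_triangle|]. rewrite Cmod_mult.
            unfold cmod2 in Hu. assert (H1 := Cmod_ge_0 (fst u)). assert (H2 := Cmod_ge_0 (snd u)).
            assert (Cmod zeta * Cmod (fst u) <= 1 * Cmod (fst u)) by (apply Rmult_le_compat_r; lra).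
            lra.
          * eapply Rle_trans; [apply Cmod_triangle|]. rewrite Cmod_mult.
            unfold cmod2 in Hu. assert (H1 := Cmod_ge_0 (fst u)). assert (H2 := Cmod_ge_0 (snd u)).
            assert (Cmod zeta * Cmod (snd u) <= 1 * Cmod (snd u)) by (apply Rmult_le_compat_r; lra).
            lra.
        + destruct (polymap_expands (orb_inv n) (cline (orb n p) u zeta) (polymap_orb_inv n))
            as [A1 [B1 [A1' [B1' HL1]]]].
          eexists. apply expands_disc; [apply lin2_is_linear | exact HL1].
      - now rewrite cline_0, orb_invK.
      - replace (cscal2 (/ RtoC eps) v) with (lin2 A B A' B' u).
        + apply expands_disc; [apply lin2_is_linear|]. now rewrite cline_0.
        + transitivity (cscal2 (/ RtoC eps) (lin2 A B A' B' (dorb n p v)));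
            [unfold u, lin2, cscal2; simpl; f_equal; ring | now rewrite HLv].
      - change (cscal2 (RtoC eps) (cscal2 (/ RtoC eps) v) = v).
        unfold cscal2; destruct v; simpl. f_equal; field; easy. }
    destruct b as [b| |]; simpl in *.
    + apply le_epsilon. intros eps Heps. rewrite Rplus_0_l. now apply Hsmall.
    + exact (Hsmall 1 ltac:(lra)).
    + exact I.
Qed.

(** * Smoothness of the boundary *)

Lemma ln_le_minus_1 (y : R) : 0 < y -> ln y <= y - 1.
Proof.
  intros Hy. assert (H := exp_ineq1_le (ln y)). rewrite exp_ln in H by easy. lra.
Qed.

Lemma ln_abs_le_1 (y : R) : 3 / 4 <= y <= 5 / 4 -> Rabs (ln y) <= 1.
Proof.
  intros Hy. assert (H1 := ln_le_minus_1 y ltac:(lra)).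
  assert (H2 := ln_le_minus_1 (/ y) ltac:(apply Rinv_0_lt_compat; lra)).
  rewrite ln_Rinv in H2 by lra.
  assert (/ y <= / (3 / 4)) by (apply Rinv_le_contravar; lra).
  apply Rabs_le. lra.
Qed.

Lemma geometric_limit (u : nat -> R) (N : nat) :
  (forall k, (N <= k)%nat -> Rabs (u (S k) - u k) <= / 2 ^ (S k)) ->
  forall k, (N <= k)%nat -> Rabs (real (Lim_seq u) - u k) <= / 2 ^ k.
Proof.
  intros H.
  assert (Hpos : forall n, 0 < / 2 ^ n) by (intros n; apply Rinv_0_lt_compat, pow_lt; lra).
  assert (H2 : forall n, / 2 ^ n = 2 * / 2 ^ (S n)).
  { intros n. simpl. field. apply pow_nonzero. lra. }
  assert (Hj : forall k j, (N <= k)%nat -> Rabs (u (k + j)%nat - u k) <= / 2 ^ k - / 2 ^ (k + j)).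
  { intros k j Hk. induction j as [|j IH].
    - rewrite Nat.add_0_r, Rminus_diag, Rminus_diag, Rabs_R0. lra.
    - rewrite Nat.add_succ_r. specialize (H (k + j)%nat ltac:(lia)).
      specialize (H2 (k + j)%nat).
      apply Rabs_le_between in H, IH. apply Rabs_le. lra. }
  assert (Hex : ex_finite_lim_seq u).
  { apply ex_lim_seq_cauchy_corr. intros eps.
    destruct (pow_mult_small (1 / 2) 2 eps ltac:(lra) (cond_pos eps)) as [M HM].
    exists (max N M). intros n m Hn Hm.
    specialize (HM (max N M) ltac:(lia)).
    replace ((1 / 2) ^ max N M) with (/ 2 ^ (max N M)) in HM
      by (unfold Rdiv; rewrite Rmult_1_l, pow_inv; reflexivity).
    assert (A := Hj (max N M) (n - max N M)%nat ltac:(lia)).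
    assert (B := Hj (max N M) (m - max N M)%nat ltac:(lia)).
    replace (max N M + (n - max N M))%nat with n in A by lia.
    replace (max N M + (m - max N M))%nat with m in B by lia.
    assert (P1 := Hpos n). assert (P2 := Hpos m).
    apply Rabs_le_between in A, B. apply Rabs_def1; lra. }
  destruct Hex as [l Hl]. rewrite (is_lim_seq_unique _ _ Hl). simpl.
  intros k Hk.
  assert (Hl' := proj1 (is_lim_seq_incr_n u k (Finite l)) Hl).
  assert (U : Rbar_le (Finite l) (Finite (u k + / 2 ^ k))).
  { apply is_lim_seq_le with (u := fun n => u (n + k)%nat) (v := fun _ => u k + / 2 ^ k);
      [|exact Hl'|apply is_lim_seq_const].
    intros n. specialize (Hj k n Hk). rewrite Nat.add_comm.
    assert (P := Hpos (k + n)%nat). apply Rabs_le_between in Hj. lra. }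
  assert (L : Rbar_le (Finite (u k - / 2 ^ k)) (Finite l)).
  { apply is_lim_seq_le with (u := fun _ => u k - / 2 ^ k) (v := fun n => u (n + k)%nat);
      [|apply is_lim_seq_const|exact Hl'].
    intros n. specialize (Hj k n Hk). rewrite Nat.add_comm.
    assert (P := Hpos (k + n)%nat). apply Rabs_le_between in Hj. lra. }
  simpl in U, L. apply Rabs_le. lra.
Qed.

(** If [|w_n| < |z_n|] never occurs together with [|z_n| > 3/4], then it never occurs at all, since
    otherwise the orbit enters the absorbing bidisc. But [|z_n| <= |w_n|] at all stages gives
    [|w_(n+1)| = a_n |z_n| <= |w_n| / 32], and the orbit tends to 0. *)
Lemma outside_stage (p : C2) : ~ basin henon p ->
  exists N, Cmod (snd (orb N p)) < Cmod (fst (orb N p)) /\ 3 / 4 < Cmod (fst (orb N p)).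
Proof.
  intros Hp. apply NNPP. intros Hno.
  assert (H : forall n, Cmod (fst (orb n p)) <= Cmod (snd (orb n p))).
  { intros n. apply Rnot_lt_le. intros H. apply Hno. exists n. split; [easy|].
    apply Rnot_le_lt. intros H'. apply Hp. apply basin_absorb with n; lra. }
  assert (Hg : forall n, Cmod (snd (orb n p)) <= Cmod (snd (orb 0 p)) * (/ 32) ^ n).
  { induction n as [|n IH]; [simpl; lra|].
    destruct (henon_step n (orb n p)) as [_ S2]. simpl orb at 1. rewrite S2.
    specialize (H n). assert (Ha := acoef_pos n). assert (Ha' := acoef_le n).
    assert (Hz := Cmod_ge_0 (fst (orb n p))).
    assert (acoef n * Cmod (fst (orb n p)) <= / 32 * Cmod (snd (orb n p)))
      by (apply Rmult_le_compat; lra).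
    simpl pow. lra. }
  apply Hp. apply basin_iff. intros eps Heps.
  destruct (pow_mult_small (/ 32) (Cmod (snd (orb 0 p))) eps ltac:(lra) Heps) as [N HN].
  exists N. intros n Hn. specialize (HN n Hn). specialize (Hg n). specialize (H n). lra.
Qed.

(** The cone [|w| < |z|] is invariant where [|z| > 3/4]: there [|z_(k+1)| >= (3/4 - 1/32) |z_k|],
    well above [|w_(k+1)| <= |z_k| / 32]. Inside the cone the bound 3/4 cannot be lost without
    entering the absorbing bidisc. *)
Lemma outside_stage_persist (p : C2) (N : nat) : ~ basin henon p ->
  Cmod (snd (orb N p)) < Cmod (fst (orb N p)) -> 3 / 4 < Cmod (fst (orb N p)) ->
  forall k, (N <= k)%nat ->
    Cmod (snd (orb k p)) < Cmod (fst (orb k p)) /\ 3 / 4 < Cmod (fst (orb k p)).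
Proof.
  intros Hp H1 H2 k Hk. induction Hk as [|k Hk [IH1 IH2]]; [easy|].
  simpl orb. destruct (henon_step k (orb k p)) as [_ S2].
  assert (Ha := acoef_pos k). assert (Ha' := acoef_le k).
  assert (Hw := Cmod_ge_0 (snd (orb k p))).
  assert (T : Cmod (fst (orb k p)) ^ 2 - acoef k * Cmod (snd (orb k p))
              <= Cmod (fst (henon k (orb k p)))).
  { assert (T := Cmod_triangle (fst (henon k (orb k p)))
                   (- (RtoC (acoef k) * snd (orb k p)))%C).
    rewrite Cmod_opp, Cmod_mult, Cmod_acoef in T. unfold henon in T at 1. simpl fst in T.
    replace (fst (orb k p) * fst (orb k p) + RtoC (acoef k) * snd (orb k p)
             + - (RtoC (acoef k) * snd (orb k p)))%C
      with (fst (orb k p) * fst (orb k p))%C in T by ring.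
    rewrite Cmod_mult in T. unfold henon. cbn [fst]. simpl pow. lra. }
  assert (H3 : Cmod (snd (henon k (orb k p))) < Cmod (fst (henon k (orb k p)))).
  { rewrite S2.
    set (x := Cmod (fst (orb k p))) in *. set (y := Cmod (snd (orb k p))) in *.
    assert (acoef k * y <= / 32 * x) by (apply Rmult_le_compat; lra).
    assert (acoef k * x <= / 32 * x) by (apply Rmult_le_compat_r; lra).
    simpl pow in T. nra. }
  split; [exact H3|].
  apply Rnot_le_lt. intros H4. apply Hp. apply basin_absorb with (S k); simpl orb; lra.
Qed.

(** The condition must also hold at basin points close to the boundary, whose [z_k] tends to 0;
    hence thresholds that shrink with [acoef k] instead of the fixed 3/4 valid outside. The second
    bound is what makes [relerr] at most 1/4. *)
Definition good (k : nat) (z : C2) : Prop :=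
  2 * acoef k <= Cmod (fst (orb k z)) /\
  4 * (acoef k * Cmod (snd (orb k z))) <= Cmod (fst (orb k z)) ^ 2.

(** The [eps_k] of [z_(k+1) = z_k^2 (1 + eps_k)], written as a product with inverses so that an
    approximation of [1 / z_k] yields one of [eps_k]. *)
Definition relerr (k : nat) (z : C2) : C :=
  (RtoC (acoef k) * snd (orb k z) * (/ fst (orb k z) * / fst (orb k z)))%C.

Lemma good_neq_0 (k : nat) (z : C2) : good k z -> fst (orb k z) <> RtoC 0.
Proof. intros [H _]. apply Cmod_neq_0. assert (Ha := acoef_pos k). lra. Qed.

Lemma relerr_eq (k : nat) (z : C2) : good k z ->
  fst (orb (S k) z) = (fst (orb k z) * fst (orb k z) * (RtoC 1 + relerr k z))%C.
Proof.
  intros H. apply good_neq_0 in H. simpl orb. unfold henon, relerr. cbn [fst snd]. field. easy.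
Qed.

Lemma relerr_le (k : nat) (z : C2) : good k z -> Cmod (relerr k z) <= 1 / 4.
Proof.
  intros H. assert (Hn := good_neq_0 k z H). destruct H as [H1 H2].
  assert (Ha := acoef_pos k).
  unfold relerr. rewrite !Cmod_mult, Cmod_acoef, !Cmod_inv by easy.
  set (x := Cmod (fst (orb k z))) in *. set (y := Cmod (snd (orb k z))) in *.
  assert (Hx : 0 < x) by lra. simpl pow in H2.
  apply (Rmult_le_reg_r (x * x)); [nra|].
  replace (acoef k * y * (/ x * / x) * (x * x)) with (acoef k * y) by (field; lra). lra.
Qed.

(** With [x = |z_k|] and [a = acoef k], the bound [2 a <= x] gives [|z_(k+1)| >= (3/4) x^2 >= 3 a^2]
    and [4 a^3 x <= x^4 / 2 <= (9/16) x^4]; these are the two requirements at the next stage, where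
    [a] becomes [a^2]. *)
Lemma good_S (k : nat) (z : C2) : good k z -> good (S k) z.
Proof.
  intros H. assert (Hr := Cmod_1_plus _ (relerr_le k z H)).
  assert (E := relerr_eq k z H). apply (f_equal Cmod) in E. rewrite !Cmod_mult in E.
  destruct H as [H1 H2]. assert (Ha := acoef_pos k). assert (Ha' := acoef_le k).
  destruct (henon_step k (orb k z)) as [_ S2].
  unfold good. rewrite E. simpl orb. rewrite S2, acoef_S.
  set (x := Cmod (fst (orb k z))) in *. set (m := Cmod (RtoC 1 + relerr k z)%C) in *.
  set (a := acoef k) in *. clearbody x m a.
  assert (Hxx : 4 * (a * a) <= x * x) by nra.
  split.
  - simpl. nra.
  - assert (H3 : 3 / 4 * (x * x) <= x * x * m) by nra.
    assert (H4 : (3 / 4 * (x * x)) ^ 2 <= (x * x * m) ^ 2) by (apply pow_incr; nra).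
    assert (H5 : a * a * a <= x * x * x / 8).
    { assert (H6 : a ^ 3 <= (x / 2) ^ 3) by (apply pow_incr; lra). simpl in H6. lra. }
    assert (H6 : a * a * a * x <= x * x * x / 8 * x) by (apply Rmult_le_compat_r; lra).
    assert (0 <= x * x * (x * x)) by nra.
    simpl in *. lra.
Qed.

Lemma good_le (N k : nat) (z : C2) : (N <= k)%nat -> good N z -> good k z.
Proof. intros H. induction H; auto using good_S. Qed.

(** * The Green function near the boundary *)

Definition approx_green (k : nat) (z : C2) : R := / 2 ^ k * ln (Cmod (fst (orb k z))).

(** Non-autonomous analogue of the Green function of [z^2]. [Lim_seq] is total, and the value is
    controlled at points that are [good] at some stage. *)
Definition green (z : C2) : R := real (Lim_seq (fun k => approx_green k z)).

Lemma approx_green_S (k : nat) (z : C2) : good k z ->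
  approx_green (S k) z =
  approx_green k z + / 2 ^ (S k) * ln (Cmod (RtoC 1 + relerr k z)%C).
Proof.
  intros H. assert (Hr := Cmod_1_plus _ (relerr_le k z H)).
  unfold approx_green. rewrite (relerr_eq k z H), !Cmod_mult.
  destruct H as [H1 _]. assert (Ha := acoef_pos k).
  rewrite !ln_mult by nra. simpl pow. field. apply pow_nonzero. lra.
Qed.

Lemma green_close (N k : nat) (z : C2) : (N <= k)%nat -> good N z ->
  Rabs (green z - approx_green k z) <= / 2 ^ k.
Proof.
  intros Hk HN. apply (geometric_limit (fun k => approx_green k z) N); [|easy].
  intros j Hj. assert (Hg := good_le N j z Hj HN).
  rewrite (approx_green_S j z Hg).
  replace (approx_green j z + / 2 ^ S j * ln (Cmod (RtoC 1 + relerr j z)%C) - approx_green j z)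
    with (/ 2 ^ S j * ln (Cmod (RtoC 1 + relerr j z)%C)) by ring.
  assert (Hl := ln_abs_le_1 _ (Cmod_1_plus _ (relerr_le j z Hg))).
  assert (Hp : 0 < / 2 ^ S j) by (apply Rinv_0_lt_compat, pow_lt; lra).
  rewrite Rabs_mult, (Rabs_pos_eq (/ 2 ^ S j)) by lra.
  nra.
Qed.

(** The recursion [1 / z_(k+1) = (1 / z_k)^2 / (1 + eps_k)] carries approximability from stage [N]
    to all later ones on one and the same polydisc; [good] bounds [1 / z_k] by [/ (2 * acoef k)], as
    products of approximations require. *)
Lemma approx_relerr_inv (p : C2) (R0 : R) (N k : nat) :
  (forall z, polydisc p R0 z -> good N z) -> (N <= k)%nat ->
  approx (polydisc p R0) (fun z => / fst (orb N z))%C ->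
  approx (polydisc p R0) (fun z => / fst (orb k z))%C /\
  approx (polydisc p R0) (relerr k).
Proof.
  intros HV Hk H0.
  assert (Hg : forall j, (N <= j)%nat -> forall z, polydisc p R0 z -> good j z)
    by (intros j Hj z Hz; apply good_le with N; auto).
  assert (Hinv : forall j, (N <= j)%nat -> forall z, polydisc p R0 z ->
                 Cmod (/ fst (orb j z))%C <= / (2 * acoef j)).
  { intros j Hj z Hz. specialize (Hg j Hj z Hz). assert (Hn := good_neq_0 j z Hg).
    rewrite Cmod_inv by easy. destruct Hg as [H1 _]. assert (Ha := acoef_pos j).
    apply Rinv_le_contravar; lra. }
  assert (Hinv2 : forall j, (N <= j)%nat -> forall z, polydisc p R0 z ->
     Cmod (/ fst (orb j z) * / fst (orb j z))%C <= / (2 * acoef j) * / (2 * acoef j)).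
  { intros j Hj z Hz. rewrite Cmod_mult. specialize (Hinv j Hj z Hz).
    apply Rmult_le_compat; auto using Cmod_ge_0. }
  assert (Hrel : forall j, (N <= j)%nat -> approx (polydisc p R0) (fun z => / fst (orb j z))%C ->
            approx (polydisc p R0) (relerr j)).
  { intros j Hj Hi. unfold relerr.
    destruct (polyfun_bound (fun z => RtoC (acoef j) * snd (orb j z))%C p R0) as [M [_ HM]].
    { apply polyfun_mult; [constructor | apply (polymap_orb j)]. }
    apply approx_mult with M (/ (2 * acoef j) * / (2 * acoef j)); [exact HM | auto | |].
    - apply approx_polyfun. apply polyfun_mult; [constructor | apply (polymap_orb j)].
    - apply approx_mult with (/ (2 * acoef j)) (/ (2 * acoef j)); auto. }
  assert (Hall : approx (polydisc p R0) (fun z => / fst (orb k z))%C).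
  { induction Hk as [|k Hk IH]; [exact H0|].
    apply approx_ext with
      (fun z => / fst (orb k z) * / fst (orb k z) * / (RtoC 1 + relerr k z))%C.
    - intros z Hz. assert (G := Hg k Hk z Hz). rewrite (relerr_eq k z G).
      assert (Hn := good_neq_0 k z G).
      assert (Hn1 : (RtoC 1 + relerr k z)%C <> RtoC 0).
      { apply Cmod_neq_0. assert (H := Cmod_1_plus _ (relerr_le k z G)). lra. }
      field. easy.
    - apply approx_mult with (/ (2 * acoef k) * / (2 * acoef k)) 2.
      + auto.
      + intros z Hz. assert (G := Hg k Hk z Hz).
        assert (H := Cmod_1_plus _ (relerr_le k z G)).
        rewrite Cmod_inv by (apply Cmod_neq_0; lra).
        replace 2 with (/ (1 / 2)) by field. apply Rinv_le_contravar; lra.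
      + apply approx_mult with (/ (2 * acoef k)) (/ (2 * acoef k)); auto.
      + apply approx_inv_1_plus; [|now apply Hrel].
        intros z Hz. apply relerr_le. auto. }
  split; auto.
Qed.

(* On such a polydisc every iterate [fst (orb k z)], [k >= N], has a holomorphic logarithm. *)
Definition good_disc (p : C2) (R0 : R) (N : nat) : Prop :=
  fst (orb N p) <> RtoC 0 /\
  forall z, polydisc p R0 z ->
    good N z /\ Cmod (fst (orb N z) * / fst (orb N p) - RtoC 1)%C <= 1 / 4.

Lemma good_disc_exists (p : C2) (N : nat) :
  Cmod (snd (orb N p)) < Cmod (fst (orb N p)) -> 3 / 4 < Cmod (fst (orb N p)) ->
  exists R0, 0 < R0 /\ good_disc p R0 N.
Proof.
  intros H1 H2.
  (* A displacement of 1/8 leaves [|z_N| > 5/8] and [|w_N| < |z_N| + 1/4], enough for [good], and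
     changes [z_N] by a relative amount below 1/6. *)
  destruct (polyfun_continuous _ p (1 / 8) (proj1 (polymap_orb N)) ltac:(lra)) as [r1 [Hr1 K1]].
  destruct (polyfun_continuous _ p (1 / 8) (proj2 (polymap_orb N)) ltac:(lra)) as [r2 [Hr2 K2]].
  exists (Rmin r1 r2). split; [now apply Rmin_pos|].
  assert (Hn : fst (orb N p) <> RtoC 0) by (apply Cmod_neq_0; lra).
  split; [exact Hn|]. intros z Hz.
  assert (Hz1 : polydisc p r1 z) by (eapply polydisc_le; [apply Rmin_l | exact Hz]).
  assert (Hz2 : polydisc p r2 z) by (eapply polydisc_le; [apply Rmin_r | exact Hz]).
  specialize (K1 z Hz1). specialize (K2 z Hz2). cbv beta in K1, K2.
  assert (Ha := acoef_pos N). assert (Ha' := acoef_le N).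
  split.
  - assert (T1 := Cmod_triangle (fst (orb N z))%C (- (fst (orb N z) - fst (orb N p)))%C).
    replace (fst (orb N z) + - (fst (orb N z) - fst (orb N p)))%C with (fst (orb N p)) in T1 by ring.
    rewrite Cmod_opp in T1.
    assert (T2 := Cmod_triangle (snd (orb N z) - snd (orb N p))%C (snd (orb N p))).
    replace (snd (orb N z) - snd (orb N p) + snd (orb N p))%C with (snd (orb N z)) in T2 by ring.
    unfold good.
    set (x := Cmod (fst (orb N z))) in *. set (y := Cmod (snd (orb N z))) in *.
    assert (Hy : 0 <= y) by apply Cmod_ge_0.
    split; [lra|].
    assert (acoef N * y <= / 32 * (x + 1 / 4)) by (apply Rmult_le_compat; lra).
    simpl pow. nra.
  - replace (fst (orb N z) * / fst (orb N p) - RtoC 1)%C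
      with ((fst (orb N z) - fst (orb N p)) * / fst (orb N p))%C by (field; easy).
    rewrite Cmod_mult, Cmod_inv by easy.
    apply (Rmult_le_reg_r (Cmod (fst (orb N p)))); [lra|].
    rewrite Rmult_assoc, Rinv_l, Rmult_1_r by lra. lra.
Qed.

(** [log |z_N|] differs from its value at [p] by [log |1 + x|] with [|x| <= 1/4], and each later
    stage adds a multiple of [log |1 + eps_k|]; all of these are covered by [re_approx_ln]. *)
Lemma good_disc_approx_green (p : C2) (R0 : R) (N k : nat) :
  good_disc p R0 N -> (N <= k)%nat -> re_approx (polydisc p R0) (approx_green k).
Proof.
  intros [Hn HV] Hk.
  set (x := fun z => (fst (orb N z) * / fst (orb N p) - RtoC 1)%C).
  assert (Hx : approx (polydisc p R0) x).
  { apply approx_polyfun.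
    apply polyfun_ext with (fun z => fst (orb N z) * / fst (orb N p) + (- RtoC 1))%C;
      [reflexivity|].
    apply polyfun_plus; [|constructor]. apply polyfun_mult; [apply (polymap_orb N) | constructor]. }
  assert (Hx4 : forall z, polydisc p R0 z -> Cmod (x z) <= 1 / 4) by (intros z Hz; now apply HV).
  assert (Ex : forall z, polydisc p R0 z -> fst (orb N z) = (fst (orb N p) * (RtoC 1 + x z))%C).
  { intros z Hz. unfold x. field. easy. }
  assert (H0 : approx (polydisc p R0) (fun z => / fst (orb N z))%C).
  { apply approx_ext with (fun z => / fst (orb N p) * / (RtoC 1 + x z))%C.
    - intros z Hz. rewrite (Ex z Hz).
      assert (Hn1 : (RtoC 1 + x z)%C <> RtoC 0).
      { apply Cmod_neq_0. assert (H := Cmod_1_plus _ (Hx4 z Hz)). lra. }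
      field. easy.
    - apply approx_mult with (Cmod (/ fst (orb N p))%C) 2.
      + intros; lra.
      + intros z Hz. assert (H := Cmod_1_plus _ (Hx4 z Hz)).
        rewrite Cmod_inv by (apply Cmod_neq_0; lra).
        replace 2 with (/ (1 / 2)) by field. apply Rinv_le_contravar; lra.
      + apply approx_polyfun. constructor.
      + now apply approx_inv_1_plus. }
  induction Hk as [|k Hk IH].
  - apply re_approx_ext with
      (fun z => / 2 ^ N * ln (Cmod (fst (orb N p))) + / 2 ^ N * ln (Cmod (RtoC 1 + x z)%C)).
    + intros z Hz. unfold approx_green. rewrite (Ex z Hz), Cmod_mult, ln_mult; [ring| |].
      * now apply Cmod_gt_0.
      * assert (H := Cmod_1_plus _ (Hx4 z Hz)). lra.
    + apply (re_approx_plus_scal _ (fun _ => / 2 ^ N * ln (Cmod (fst (orb N p))))).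
      * apply re_approx_const.
      * now apply re_approx_ln.
  - apply re_approx_ext with
      (fun z => approx_green k z + / 2 ^ (S k) * ln (Cmod (RtoC 1 + relerr k z)%C)).
    + intros z Hz. symmetry. apply approx_green_S. apply good_le with N; [easy|]. now apply HV.
    + apply re_approx_plus_scal; [exact IH|]. apply re_approx_ln.
      * intros z Hz. apply relerr_le. apply good_le with N; [easy|]. now apply HV.
      * apply (approx_relerr_inv p R0 N k); [|easy|easy]. intros z Hz. now apply HV.
Qed.

Lemma inv_pow2_small (eps : R) : 0 < eps -> exists M, forall n, (M <= n)%nat -> / 2 ^ n < eps.
Proof.
  intros Heps. destruct (pow_mult_small (1 / 2) 1 eps ltac:(lra) Heps) as [M HM].
  exists M. intros n Hn. specialize (HM n Hn).
  replace ((1 / 2) ^ n) with (/ 2 ^ n) in HM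
    by (unfold Rdiv; rewrite Rmult_1_l, pow_inv; reflexivity).
  lra.
Qed.

Lemma good_disc_green (p : C2) (R0 : R) (N : nat) :
  good_disc p R0 N -> re_approx (polydisc p R0) green.
Proof.
  intros HV. apply re_approx_limit. intros eps Heps.
  destruct (inv_pow2_small eps Heps) as [M HM].
  exists (approx_green (max N M)). split.
  - apply good_disc_approx_green with N; [easy | lia].
  - intros z Hz. eapply Rle_trans; [apply green_close with N; [lia | now apply HV]|].
    left. apply HM. lia.
Qed.

(** The error [/ 2 ^ k] of [green_close] moves [log |z_k|] by at most 1. So [log |z_k| < -2] at one
    late stage forces a negative value, while a negative value below [-3 / 2^k] forces
    [log |z_k| < -1], that is [|z_k| < 1/2]. *)
Lemma green_basin (N : nat) (z : C2) : good N z -> (basin henon z <-> green z < 0).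
Proof.
  intros HN.
  assert (Hpos : forall k, 0 < / 2 ^ k) by (intros k; apply Rinv_0_lt_compat, pow_lt; lra).
  split.
  - intros Hb. destruct (proj1 (basin_iff z) Hb (exp (-2)) (exp_pos _)) as [M HM].
    destruct (HM (max N M) ltac:(lia)) as [H1 _].
    set (k := max N M) in *.
    assert (Hg := good_le N k z ltac:(unfold k; lia) HN).
    assert (Hc := green_close N k z ltac:(unfold k; lia) HN).
    assert (Hl : ln (Cmod (fst (orb k z))) < -2).
    { rewrite <- (ln_exp (-2)). apply ln_increasing; [|easy].
      apply Cmod_gt_0. now apply good_neq_0. }
    apply Rabs_le_between in Hc. unfold approx_green in Hc. specialize (Hpos k). nra.
  - intros Hgr.
    assert (Hsm : exists M, forall k, (M <= k)%nat -> Cmod (fst (orb k z)) <= 3 / 4).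
    { destruct (inv_pow2_small (- green z / 3) ltac:(lra)) as [M HM].
      exists (max N M). intros k Hk. specialize (HM k ltac:(lia)).
      assert (Hg := good_le N k z ltac:(lia) HN).
      assert (Hc := green_close N k z ltac:(lia) HN).
      apply Rabs_le_between in Hc. unfold approx_green in Hc. specialize (Hpos k).
      assert (Hl : ln (Cmod (fst (orb k z))) < -1).
      { apply (Rmult_lt_reg_l (/ 2 ^ k)); [easy|]. lra. }
      assert (H0 : 0 < Cmod (fst (orb k z))) by (apply Cmod_gt_0; now apply good_neq_0).
      assert (H1 : Cmod (fst (orb k z)) < exp (-1)).
      { rewrite <- (exp_ln _ H0). now apply exp_increasing. }
      assert (H2 : exp (-1) <= 1 / 2).
      { replace (exp (-1)) with (/ exp 1) by (rewrite <- exp_Ropp; f_equal; ring). assert (E := exp_ineq1_le 1).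
        replace (1 / 2) with (/ 2) by field. apply Rinv_le_contravar; lra. }
      lra. }
    destruct Hsm as [M HM].
    (* Only the first coordinate is known to be small; one further step bounds the second, since
       [|w_(M+1)| = a_M |z_M|]. *)
    apply basin_absorb with (S M); [apply HM; lia|].
    simpl orb. destruct (henon_step M (orb M z)) as [_ S2]. rewrite S2.
    specialize (HM M ltac:(lia)). assert (Ha := acoef_pos M). assert (Ha' := acoef_le M).
    assert (Hz := Cmod_ge_0 (fst (orb M z))). assert (acoef M * Cmod (fst (orb M z)) <= / 32 * (3 / 4)) by (apply Rmult_le_compat; lra). lra.
Qed.

Lemma is_derive_half_ln_sqr (x y : R -> R) (c dx dy : R) :
  is_derive x 0 dx -> is_derive y 0 dy -> 0 < x 0 ^ 2 + y 0 ^ 2 ->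
  Hierarchy.locally (0 : R_UniformSpace) (fun t : R => 0 < x t ^ 2 + y t ^ 2) /\
  is_derive (fun t => c * (/ 2 * ln (x t ^ 2 + y t ^ 2))) 0
    (c * ((x 0 * dx + y 0 * dy) / (x 0 ^ 2 + y 0 ^ 2))).
Proof.
  intros Hx Hy Hpos.
  assert (Ex := is_derive_unique _ _ _ Hx). assert (Ey := is_derive_unique _ _ _ Hy).
  split.
  - assert (Hc : continuous (fun t : R_UniformSpace => (x t ^ 2 + y t ^ 2) : R_UniformSpace) 0).
    { apply @ex_derive_continuous. auto_derive.
      repeat split; try (now exists dx); now exists dy. }
    apply Hc. apply (open_gt 0). exact Hpos.
  - auto_derive.
    + repeat split; try (now exists dx); try (now exists dy). simpl in Hpos. lra.
    + replace (Derive (fun u => x u) 0) with dx by (symmetry; exact Ex).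
      replace (Derive (fun u => y u) 0) with dy by (symmetry; exact Ey).
      field. simpl in Hpos. lra.
Qed.

(** The real derivative of [log |f|] is [Re (f' / f)], with [f'] read off from the quadratic
    expansion of the iterate. *)
Lemma approx_green_dirderiv (k : nat) (p e : C2) : fst (orb k p) <> RtoC 0 ->
  dirderiv (approx_green k) e p = / 2 ^ k * Re (fst (dorb k p e) * / fst (orb k p))%C.
Proof.
  intros Hn. destruct (orb_expands k p) as [K [HK H]].
  destruct (step_size e 1 ltac:(lra)) as [s [Hs He]].
  set (f := fun t : R => fst (orb k (cline p e (RtoC t)))).
  set (d := fst (dorb k p e)).
  assert (Hf0 : f 0 = fst (orb k p)) by (unfold f; now rewrite cline_0).
  assert (Hexp : forall t, Rabs t <= s ->
            Cmod (f t - f 0 - RtoC t * d)%C <= K * cmod2 e ^ 2 * t ^ 2).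
  { intros t Ht. rewrite Hf0. unfold f.
    assert (Htc : Cmod (RtoC t) = Rabs t) by apply Cmod_R.
    assert (Hv : cmod2 (cscal2 (RtoC t) e) <= 1).
    { rewrite cmod2_scal, Htc. assert (He0 := cmod2_ge_0 e). assert (Ht0 := Rabs_pos t). nra. }
    specialize (H _ Hv). rewrite cmod2_scal, Htc, dorb_scal in H.
    replace (cline p e (RtoC t)) with (cplus2 p (cscal2 (RtoC t) e)) by reflexivity.
    rewrite Rpow_mult_distr, pow2_abs in H.
    replace (K * cmod2 e ^ 2 * t ^ 2) with (K * (t ^ 2 * cmod2 e ^ 2)) by ring.
    eapply Rle_trans; [|exact H]. unfold cmod2 at 1, csub2, cscal2. cbn [fst snd].
    fold d. match goal with |- _ <= _ + Cmod ?u => assert (Hu := Cmod_ge_0 u) end.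
    lra. }
  assert (Hre : is_derive (fun t => Re (f t)) 0 (Re d)).
  { apply is_derive_quadratic with (s := s) (K := K * cmod2 e ^ 2); [easy|]. intros t Ht.
    eapply Rle_trans; [|apply (Hexp t Ht)].
    eapply Rle_trans; [|apply re_le_Cmod]. right. f_equal.
    unfold Re, Cminus, Cplus, Copp, Cmult, RtoC. cbn [fst snd]. ring. }
  assert (Him : is_derive (fun t => Im (f t)) 0 (Im d)).
  { apply is_derive_quadratic with (s := s) (K := K * cmod2 e ^ 2); [easy|]. intros t Ht.
    eapply Rle_trans; [|apply (Hexp t Ht)].
    assert (HM := Rmax_Cmod (f t - f 0 - RtoC t * d)%C).
    assert (HM' := Rmax_r (Rabs (fst (f t - f 0 - RtoC t * d)%C))
                          (Rabs (snd (f t - f 0 - RtoC t * d)%C))).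
    eapply Rle_trans; [|exact HM]. eapply Rle_trans; [|exact HM']. right. f_equal.
    unfold Im, Cminus, Cplus, Copp, Cmult, RtoC. cbn [fst snd]. ring. }
  assert (Hpos : 0 < Re (f 0) ^ 2 + Im (f 0) ^ 2).
  { rewrite <- Cmod2_alt. apply pow_lt. apply Cmod_gt_0. now rewrite Hf0. }
  destruct (is_derive_half_ln_sqr _ _ (/ 2 ^ k) _ _ Hre Him Hpos) as [Hl Hd].
  unfold dirderiv. apply is_derive_unique.
  replace (Re (d * / fst (orb k p))%C)
    with ((Re (f 0) * Re d + Im (f 0) * Im d) / (Re (f 0) ^ 2 + Im (f 0) ^ 2)).
  - revert Hd. apply is_derive_ext_loc. revert Hl. apply filter_imp. intros t Ht.
    rewrite dirderiv_arg. unfold approx_green.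
    change (fst (orb k (cline p e (RtoC t)))) with (f t). f_equal.
    rewrite <- Cmod2_alt in *. simpl pow in *. rewrite Rmult_1_r in *.
    assert (Hf := Cmod_ge_0 (f t)). assert (0 < Cmod (f t)) by nra.
    rewrite ln_mult by easy. field.
  - rewrite <- Hf0. clearbody f d. destruct (f 0) as [x y]. destruct d as [u v].
    unfold Re, Im, Cmult, Cinv in *. cbn [fst snd] in *. field. simpl in *. lra.
Qed.

(** The normalised logarithmic derivative [2^(N-k) dz_k / z_k] starts at 1 and moves by at most
    [8 a_k] per step. The tolerance [1/2 - 16 a_k] grows by more than this because
    [a_(k+1) <= a_k / 32]. Keeping [|dw_k| <= |dz_k|] in the induction controls the contribution of
    [w]. *)
Lemma outside_log_derivative (p e : C2) (N : nat) :
  (forall k, (N <= k)%nat ->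
     Cmod (snd (orb k p)) < Cmod (fst (orb k p)) /\ 3 / 4 < Cmod (fst (orb k p))) ->
  good N p -> dorb N p e = (fst (orb N p), RtoC 0) ->
  forall k, (N <= k)%nat ->
    Cmod (snd (dorb k p e)) <= Cmod (fst (dorb k p e)) /\
    Cmod (RtoC (2 ^ N / 2 ^ k) * (fst (dorb k p e) * / fst (orb k p)) - RtoC 1)%C
      <= 1 / 2 - 16 * acoef k.
Proof.
  intros Hout Hgood He k Hk. induction Hk as [|k Hk [IH1 IH2]].
  - rewrite He. cbn [fst snd].
    assert (Hn := good_neq_0 N p Hgood). assert (Ha := acoef_le N).
    split; [rewrite Cmod_0; apply Cmod_ge_0|].
    replace (2 ^ N / 2 ^ N) with 1 by (field; apply pow_nonzero; lra).
    replace (RtoC 1 * (fst (orb N p) * / fst (orb N p)) - RtoC 1)%C with (RtoC 0)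
      by (field; easy).
    rewrite Cmod_0. lra.
  - assert (Hg := good_le N k p Hk Hgood). assert (Hn := good_neq_0 k p Hg).
    destruct (Hout k Hk) as [O1 O2].
    assert (Hm := Cmod_1_plus _ (relerr_le k p Hg)).
    assert (Hn1 : (RtoC 1 + relerr k p)%C <> RtoC 0) by (apply Cmod_neq_0; lra).
    assert (E := relerr_eq k p Hg).
    assert (E' : fst (orb (S k) p) =
      (fst (orb k p) * fst (orb k p) + RtoC (acoef k) * snd (orb k p))%C) by reflexivity.
    assert (Ez : fst (dorb (S k) p e) =
      (RtoC 2 * fst (orb k p) * fst (dorb k p e) + RtoC (acoef k) * snd (dorb k p e))%C)
      by reflexivity.
    assert (Ew : snd (dorb (S k) p e) = (RtoC (acoef k) * fst (dorb k p e))%C).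
    { simpl. unfold dhenon, lin2. cbn [fst snd]. ring. }
    assert (HnS : fst (orb (S k) p) <> RtoC 0) by (apply good_neq_0, good_S; exact Hg).
    assert (HmS : 3 / 4 * (Cmod (fst (orb k p)) * Cmod (fst (orb k p)))
                  <= Cmod (fst (orb (S k) p))).
    { rewrite E, !Cmod_mult. assert (H0 := Cmod_ge_0 (fst (orb k p))). nra. }
    assert (Ha := acoef_pos k). assert (Ha' := acoef_le k).
    assert (HaS : acoef (S k) <= / 32 * acoef k) by (rewrite acoef_S; simpl; nra).
    set (z := fst (orb k p)) in *. set (w := snd (orb k p)) in *.
    set (dz := fst (dorb k p e)) in *. set (dw := snd (dorb k p e)) in *.
    set (zS := fst (orb (S k) p)) in *.
    assert (Hdz := Cmod_ge_0 dz). assert (Hdw := Cmod_ge_0 dw). assert (Hw := Cmod_ge_0 w).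
    split.
    + rewrite Ew, Ez, Cmod_mult, Cmod_acoef.
      assert (T := Cmod_triangle (RtoC 2 * z * dz + RtoC (acoef k) * dw)%C
                     (- (RtoC (acoef k) * dw))%C).
      replace (RtoC 2 * z * dz + RtoC (acoef k) * dw + - (RtoC (acoef k) * dw))%C
        with (RtoC 2 * z * dz)%C in T by ring.
      rewrite Cmod_opp, (Cmod_mult (RtoC (acoef k)) dw), Cmod_acoef in T.
      rewrite (Cmod_mult (RtoC 2 * z)), (Cmod_mult (RtoC 2)), Cmod_R, Rabs_pos_eq in T by lra.
      assert (acoef k * Cmod dw <= / 32 * Cmod dz) by (apply Rmult_le_compat; lra).
      assert (acoef k * Cmod dz <= / 32 * Cmod dz) by (apply Rmult_le_compat_r; lra).
      assert (2 * (3 / 4) * Cmod dz <= 2 * Cmod z * Cmod dz) by (apply Rmult_le_compat_r; lra).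
      lra.
    + rewrite Ez.
      assert (H2k : 2 ^ k <> 0) by (apply pow_nonzero; lra).
      set (c := 2 ^ N / 2 ^ k) in *.
      assert (Hc : 2 ^ N / 2 ^ S k = c * / 2) by (unfold c; simpl; field; easy).
      assert (Hc0 : 0 < c) by (unfold c; apply Rdiv_lt_0_compat; apply pow_lt; lra).
      rewrite Hc.
      set (lam := (RtoC c * (dz * / z))%C) in *.
      (* d log z_(k+1) - 2 d log z_k = a_k (z dw - 2 w dz) / (z (z^2 + a_k w)) *)
      assert (Ediff : (RtoC (c * / 2) * ((RtoC 2 * z * dz + RtoC (acoef k) * dw) * / zS) - RtoC 1
          = (lam - RtoC 1) +
            RtoC c * (RtoC (acoef k) * (RtoC (/ 2) * (z * dw) + - (w * dz))) * / (z * zS))%C).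
      { unfold lam. rewrite RtoC_mult, E'.
        assert (Eh : RtoC (/ 2) = (/ RtoC 2)%C) by (now rewrite RtoC_inv).
        rewrite Eh. rewrite E' in HnS. field.
        now split. }
      rewrite Ediff.
      eapply Rle_trans; [apply Cmod_triangle|].
      assert (Hlam : Cmod lam <= 3 / 2).
      { assert (T := Cmod_triangle (lam - RtoC 1) (RtoC 1)).
        replace (lam - RtoC 1 + RtoC 1)%C with lam in T by ring. rewrite Cmod_1 in T. lra. }
      assert (Hlamz : c * Cmod dz = Cmod lam * Cmod z).
      { unfold lam. rewrite !Cmod_mult, Cmod_inv, Cmod_R, Rabs_pos_eq by (lra || easy).
        field. lra. }
      (* The numerator is at most [(9/4) a_k |z|^2], using [|w|, |dw| <= |z|, |dz|] respectively and
         [|lam| <= 3/2]; the denominator is at least [(9/16) |z|^2], using [|z| > 3/4]. *)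
      assert (HB : Cmod (RtoC c * (RtoC (acoef k) * (RtoC (/ 2) * (z * dw) + - (w * dz)))
                          * / (z * zS))%C <= 8 * acoef k).
      { assert (Hprod : (z * zS)%C <> RtoC 0) by now apply Cmult_neq_0.
        rewrite Cmod_mult, Cmod_inv by easy.
        assert (HP : 0 < Cmod (z * zS)%C) by now apply Cmod_gt_0.
        apply (Rmult_le_reg_r (Cmod (z * zS)%C)); [easy|].
        rewrite Rmult_assoc, Rinv_l, Rmult_1_r by lra.
        rewrite !(Cmod_mult (RtoC _)), Cmod_acoef, Cmod_R, Rabs_pos_eq by lra.
        assert (T := Cmod_triangle (RtoC (/ 2) * (z * dw)) (- (w * dz))).
        rewrite Cmod_opp, !Cmod_mult, Cmod_R, Rabs_pos_eq in T by lra.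
        assert (T1 : Cmod z * Cmod dw <= Cmod z * Cmod dz) by (apply Rmult_le_compat_l; lra).
        assert (T2 : Cmod w * Cmod dz <= Cmod z * Cmod dz) by (apply Rmult_le_compat_r; lra).
        rewrite Cmod_mult.
        set (X := Cmod (RtoC (/ 2) * (z * dw) + - (w * dz))%C) in *.
        assert (HX : X <= 3 / 2 * (Cmod z * Cmod dz)) by lra.
        assert (H1 : c * (acoef k * X) <= acoef k * (3 / 2 * (Cmod z * (Cmod lam * Cmod z)))).
        { rewrite <- Hlamz.
          replace (acoef k * (3 / 2 * (Cmod z * (c * Cmod dz))))
            with (c * (acoef k * (3 / 2 * (Cmod z * Cmod dz)))) by ring.
          apply Rmult_le_compat_l; [lra|]. apply Rmult_le_compat_l; lra. }
        assert (Hz2 : 0 < Cmod z * Cmod z) by nra.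
        assert (H2 : Cmod lam * (Cmod z * Cmod z) <= 3 / 2 * (Cmod z * Cmod z))
          by (apply Rmult_le_compat_r; lra).
        assert (H3 : acoef k * (Cmod lam * (Cmod z * Cmod z))
                     <= acoef k * (3 / 2 * (Cmod z * Cmod z)))
          by (apply Rmult_le_compat_l; lra).
        assert (H4 : 3 / 4 * (3 / 4 * (Cmod z * Cmod z)) <= Cmod z * Cmod zS)
          by (apply Rmult_le_compat; lra).
        assert (H5 : acoef k * (3 / 4 * (3 / 4 * (Cmod z * Cmod z)))
                     <= acoef k * (Cmod z * Cmod zS))
          by (apply Rmult_le_compat_l; lra).
        assert (H6 : 0 <= acoef k * (Cmod z * Cmod z)) by (apply Rmult_le_pos; lra).
        lra. }
      lra.
Qed.

(** The derivative of [approx_green k] stays above [/ 2 ^ N / 2] for all [k >= N], whereas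
    [green - approx_green k] is at most [/ 2 ^ k] on the polydisc. Comparing this difference with
    the zero polynomial, the Cauchy estimate makes its derivative at most [2 / (2^k s)], negligible
    for large [k]. *)
Lemma green_dirderiv_neq_0 (p e : C2) (R0 : R) (N : nat) :
  0 < R0 -> good_disc p R0 N ->
  (forall k, (N <= k)%nat ->
     Cmod (snd (orb k p)) < Cmod (fst (orb k p)) /\ 3 / 4 < Cmod (fst (orb k p))) ->
  dorb N p e = (fst (orb N p), RtoC 0) ->
  dirderiv green e p <> 0.
Proof.
  intros HR0 HV Hout He.
  assert (Hp := polydisc_center p (R0 / 2) ltac:(lra)).
  assert (Hp0 := polydisc_center p R0 HR0).
  assert (Hgood : good N p) by now apply HV.
  assert (HN : 0 < / 2 ^ N) by (apply Rinv_0_lt_compat, pow_lt; lra).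
  destruct (step_size e (R0 - R0 / 2) ltac:(lra)) as [s [Hs Hse]].
  destruct (inv_pow2_small (/ 2 ^ N * s / 8)) as [M HM].
  { assert (0 < / 2 ^ N * s) by nra. lra. }
  set (k := max N M). specialize (HM k ltac:(unfold k; lia)).
  assert (HNk : (N <= k)%nat) by (unfold k; lia).
  assert (Hn : fst (orb k p) <> RtoC 0).
  { apply good_neq_0. now apply good_le with N. }
  assert (G1 := good_disc_green p R0 N HV).
  assert (G2 := good_disc_approx_green p R0 N k HV HNk).
  assert (D1 := re_approx_is_derive p (R0 / 2) R0 green e p ltac:(lra) G1 Hp).
  assert (D2 := re_approx_is_derive p (R0 / 2) R0 (approx_green k) e p ltac:(lra) G2 Hp).
  set (diff := fun z => green z + (-1) * approx_green k z).
  assert (G3 : re_approx (polydisc p R0) diff) by now apply re_approx_plus_scal.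
  assert (E : dirderiv diff e p = dirderiv green e p - dirderiv (approx_green k) e p).
  { unfold dirderiv at 1. apply is_derive_unique.
    apply is_derive_ext with (fun t => green (@plus C2r p (@scal R_AbsRing C2r t e)) -
        approx_green k (@plus C2r p (@scal R_AbsRing C2r t e))).
    - intros t. unfold diff. match goal with |- ?a = ?b => change (@eq R a b) end. ring.
    - apply @is_derive_minus; assumption. }
  assert (Hclose : Rabs (dirderiv diff e p - Re (RtoC 0)) <= 2 * / 2 ^ k / s).
  { apply (re_approx_dirderiv_close p (R0 / 2) R0 s (/ 2 ^ k) diff e p
             (fun _ => RtoC 0) (fun _ => RtoC 0)); try assumption; try lra.
    - split; [constructor|]. intros z. exists (fun _ => RtoC 0).
      split; [apply ispoly_const|]. intros zeta. ring.
    - intros y Hy. unfold diff. simpl.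
      replace (green y + -1 * approx_green k y - 0) with (green y - approx_green k y) by ring.
      apply green_close with N; [easy|]. now apply HV. }
  simpl Re in Hclose. rewrite Rminus_0_r in Hclose.
  assert (Hk2 : 2 * / 2 ^ k / s <= / 2 ^ N / 4).
  { apply (Rmult_le_reg_r s); [easy|].
    replace (2 * / 2 ^ k / s * s) with (2 * / 2 ^ k) by (unfold Rdiv; rewrite Rmult_assoc, Rinv_l by lra; ring).
    lra. }
  destruct (outside_log_derivative p e N Hout Hgood He k HNk) as [_ Hlog].
  set (q := (fst (dorb k p e) * / fst (orb k p))%C) in *.
  assert (Hre := re_le_Cmod (RtoC (2 ^ N / 2 ^ k) * q - RtoC 1)%C).
  replace (Re (RtoC (2 ^ N / 2 ^ k) * q - RtoC 1)%C) with (2 ^ N / 2 ^ k * Re q - 1) in Hre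
    by (unfold Re, Cminus, Cplus, Copp, Cmult, RtoC; cbn [fst snd]; ring).
  assert (Ha := acoef_pos k).
  assert (Hre2 : Rabs (2 ^ N / 2 ^ k * Re q - 1) <= 1 / 2) by lra.
  assert (Hd := approx_green_dirderiv k p e Hn). fold q in Hd.
  assert (Hlow : / 2 ^ N / 2 <= dirderiv (approx_green k) e p).
  { rewrite Hd. apply Rabs_le_between in Hre2.
    apply (Rmult_le_reg_l (2 ^ N)); [apply pow_lt; lra|].
    replace (2 ^ N * (/ 2 ^ N / 2)) with (1 / 2) by (field; apply pow_nonzero; lra).
    unfold Rdiv in Hre2. lra. }
  rewrite E in Hclose. apply Rabs_le_between in Hclose. lra.
Qed.

Lemma smooth_boundary_basin : smooth_boundary (basin henon).
Proof.
  intros p [_ Hp].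
  assert (Hb : ~ basin henon p) by (intros H; apply Hp; now apply basin_open).
  destruct (outside_stage p Hb) as [N [H1 H2]].
  assert (Hout := outside_stage_persist p N Hb H1 H2).
  destruct (good_disc_exists p N H1 H2) as [R0 [HR0 HV]].
  exists (polydisc p (R0 / 2)), green.
  split; [apply polydisc_open|].
  split; [apply polydisc_center; lra|].
  split; [|split].
  - intros k. apply re_approx_Ck with R0; [lra|]. now apply good_disc_green with N.
  (* In this direction [dz_N = z_N] and [dw_N = 0], so the logarithmic derivative at stage [N] is
     exactly 1. *)
  - destruct (dorb_surj N p (fst (orb N p), RtoC 0)) as [e He].
    exists e. now apply green_dirderiv_neq_0 with R0 N.
  - intros z Hz. apply green_basin with N. apply HV. apply polydisc_le with (R0 / 2); [lra | easy].
Qed.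

(** * The plurisubharmonic function *)

Definition lipschitz_with (K : R) (f : R -> R) : Prop :=
  forall s t, Rabs (f s - f t) <= K * Rabs (s - t).

Lemma lipschitz_continuous (K : R) (f : R -> R) (x : R) : lipschitz_with K f -> continuous f x.
Proof.
  intros H. apply filterlim_locally. intros eps.
  assert (HK := Rabs_pos K). assert (HK' := Rle_abs K).
  assert (Hd : 0 < eps / (Rabs K + 1)) by (apply Rdiv_lt_0_compat; [apply cond_pos | lra]).
  exists (mkposreal _ Hd). intros y Hy.
  change (Rabs (y - x) < eps / (Rabs K + 1)) in Hy. change (Rabs (f y - f x) < eps).
  eapply Rle_lt_trans; [apply H|].
  assert (Rabs (y - x) * (Rabs K + 1) < eps).
  { replace (pos eps) with (eps / (Rabs K + 1) * (Rabs K + 1)) by (field; lra).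
    apply Rmult_lt_compat_r; lra. }
  assert (Hxy := Rabs_pos (y - x)). nra.
Qed.

Lemma lipschitz_ex_RInt (K : R) (f : R -> R) (a b : R) : lipschitz_with K f -> ex_RInt f a b.
Proof.
  intros H. apply (@ex_RInt_continuous R_CompleteNormedModule).
  intros z _. now apply lipschitz_continuous with K.
Qed.

Lemma RInt_period (K : R) (U : R -> R) (T theta : R) :
  lipschitz_with K U -> (forall t, U (t + T) = U t) ->
  RInt U theta (theta + T) = RInt U 0 T.
Proof.
  intros H Hper.
  assert (Hex : forall a b, ex_RInt U a b) by (intros; now apply lipschitz_ex_RInt with K).
  rewrite <- (RInt_Chasles U theta 0 (theta + T)) by apply Hex.
  rewrite <- (RInt_Chasles U 0 T (theta + T)) by apply Hex.
  assert (E : RInt U T (theta + T) = RInt U 0 theta).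
  { assert (E0 := RInt_comp_lin U 1 T 0 theta (Hex _ _)).
    replace (1 * 0 + T) with T in E0 by ring.
    replace (1 * theta + T) with (theta + T) in E0 by ring.
    rewrite <- E0. apply RInt_ext. intros t _.
    unfold scal; simpl; unfold mult; simpl. rewrite !Rmult_1_l. apply Hper. }
  rewrite E, <- (opp_RInt_swap U theta 0) by apply Hex.
  unfold plus, opp; simpl. lra.
Qed.

Fixpoint Rsum (f : nat -> R) (n : nat) : R :=
  match n with O => 0 | S m => Rsum f m + f m end.

Lemma Riemann_lower (K : R) (U : R -> R) (theta h : R) (n : nat) :
  0 <= K -> 0 <= h -> lipschitz_with K U ->
  h * Rsum (fun k => U (theta + INR k * h)) n - INR n * (h * (K * h))
    <= RInt U theta (theta + INR n * h).
Proof.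
  intros HK Hh H.
  assert (Hex : forall a b, ex_RInt U a b) by (intros; now apply lipschitz_ex_RInt with K).
  induction n as [|n IH].
  - replace (theta + INR 0 * h) with theta by (simpl; ring).
    rewrite RInt_point. unfold zero; simpl. lra.
  - rewrite S_INR. simpl Rsum.
    rewrite <- (RInt_Chasles U theta (theta + INR n * h)) by apply Hex.
    set (x := theta + INR n * h) in *.
    replace (theta + (INR n + 1) * h) with (x + h) by (unfold x; ring).
    assert (Hcell : h * (U x - K * h) <= RInt U x (x + h)).
    { replace (h * (U x - K * h)) with (RInt (fun _ => U x - K * h) x (x + h)).
      - apply RInt_le; [lra | apply ex_RInt_const | apply Hex |].
        intros y Hy. specialize (H x y). rewrite (Rabs_left1 (x - y)) in H by lra.
        apply Rabs_le_between in H.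
        assert (K * (y - x) <= K * h) by (apply Rmult_le_compat_l; lra). lra.
      - rewrite RInt_const. unfold scal; simpl; unfold mult; simpl. ring. }
    unfold plus; simpl. lra.
Qed.

Lemma cis_lipschitz (s t : R) : Cmod (cis s - cis t)%C <= 2 * Rabs (s - t).
Proof.
  assert (Hgen : forall f df : R -> R, (forall x, is_derive f x (df x)) ->
            (forall x, Rabs (df x) <= 1) -> Rabs (f s - f t) <= Rabs (s - t)).
  { intros f df Hd Hb. destruct (MVT_gen f t s df) as [c [_ E]].
    - intros; apply Hd.
    - intros x _. apply continuity_pt_filterlim. apply @ex_derive_continuous. now exists (df x).
    - rewrite E, Rabs_mult. assert (H1 := Hb c). assert (H2 := Rabs_pos (s - t)). nra. }
  assert (Hc : Rabs (cos s - cos t) <= Rabs (s - t)).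
  { apply (Hgen cos (fun x => - sin x)).
    - intros x. auto_derive; [easy|]. ring.
    - intros x. apply Rabs_le. assert (H := SIN_bound x). lra. }
  assert (Hs : Rabs (sin s - sin t) <= Rabs (s - t)).
  { apply (Hgen sin cos).
    - intros x. auto_derive; [easy|]. ring.
    - intros x. apply Rabs_le. assert (H := COS_bound x). lra. }
  replace (cis s - cis t)%C with (RtoC (cos s - cos t) + Ci * RtoC (sin s - sin t))%C.
  - eapply Rle_trans; [apply Cmod_triangle|]. rewrite Cmod_mult, !Cmod_R, Cmod_Ci. lra.
  - unfold cis, Ci, RtoC, Cminus, Cplus, Copp, Cmult; simpl. f_equal; ring.
Qed.

Lemma peval_cis_lipschitz (l : list C) : exists K M, 0 <= K /\ 0 <= M /\
  (forall t, Cmod (peval l (cis t)) <= M) /\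
  forall s t, Cmod (peval l (cis s) - peval l (cis t))%C <= K * Rabs (s - t).
Proof.
  induction l as [|c l [K [M [HK [HM [IH1 IH2]]]]]].
  - exists 0, 0. repeat split; try lra; intros; simpl.
    + rewrite Cmod_0. lra.
    + replace (RtoC 0 - RtoC 0)%C with (RtoC 0) by ring. rewrite Cmod_0. lra.
  - exists (2 * M + K), (Cmod c + M). assert (Hc := Cmod_ge_0 c).
    repeat split; try lra.
    + intros t. simpl. eapply Rle_trans; [apply Cmod_triangle|].
      rewrite Cmod_mult, Cmod_cis. specialize (IH1 t). lra.
    + intros s t. simpl.
      replace (c + cis s * peval l (cis s) - (c + cis t * peval l (cis t)))%C
        with ((cis s - cis t) * peval l (cis s) + cis t * (peval l (cis s) - peval l (cis t)))%C
        by ring.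
      eapply Rle_trans; [apply Cmod_triangle|]. rewrite !Cmod_mult, Cmod_cis.
      specialize (IH1 s). specialize (IH2 s t). assert (H := cis_lipschitz s t).
      assert (Cmod (cis s - cis t)%C * Cmod (peval l (cis s)) <= (2 * Rabs (s - t)) * M)
        by (apply Rmult_le_compat; auto using Cmod_ge_0).
      lra.
Qed.

(* Truncating at [delta] keeps the logarithm finite and Lipschitz. *)
Definition lnmax (delta : R) (x : C) : R := ln (Rmax (Cmod x) delta).

Lemma lnmax_lipschitz (delta : R) (x y : C) : 0 < delta ->
  Rabs (lnmax delta x - lnmax delta y) <= / delta * Cmod (x - y)%C.
Proof.
  intros Hd.
  assert (Hgen : forall x y : C, lnmax delta x - lnmax delta y <= / delta * Cmod (x - y)%C).
  { clear x y. intros x y. unfold lnmax.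
    assert (Hx := Rmax_r (Cmod x) delta). assert (Hy := Rmax_r (Cmod y) delta).
    rewrite <- ln_div by lra.
    eapply Rle_trans; [apply ln_le_minus_1, Rdiv_lt_0_compat; lra|].
    assert (Hxy : Rmax (Cmod x) delta - Rmax (Cmod y) delta <= Cmod (x - y)%C).
    { assert (T := Cmod_triangle (x - y)%C y). replace (x - y + y)%C with x in T by ring.
      assert (H1 := Rmax_l (Cmod y) delta). assert (H2 := Cmod_ge_0 (x - y)%C).
      destruct (Rle_dec (Cmod x) delta) as [H|H].
      - rewrite (Rmax_right (Cmod x)) by lra. lra.
      - rewrite (Rmax_left (Cmod x)) by lra. lra. }
    apply (Rmult_le_reg_r (Rmax (Cmod y) delta)); [lra|].
    replace ((Rmax (Cmod x) delta / Rmax (Cmod y) delta - 1) * Rmax (Cmod y) delta)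
      with (Rmax (Cmod x) delta - Rmax (Cmod y) delta) by (field; lra).
    assert (H2 := Cmod_ge_0 (x - y)%C).
    apply Rle_trans with (/ delta * Cmod (x - y)%C * delta).
    - replace (/ delta * Cmod (x - y)%C * delta) with (Cmod (x - y)%C) by (field; lra). lra.
    - apply Rmult_le_compat_l; [|lra].
      apply Rmult_le_pos; [|easy]. left. now apply Rinv_0_lt_compat. }
  apply Rabs_le. assert (H1 := Hgen x y). assert (H2 := Hgen y x).
  replace (y - x)%C with (- (x - y))%C in H2 by ring. rewrite Cmod_opp in H2. lra.
Qed.

(** As a function of [z] the product over the vertices of a rotated polygon is again a polynomial,
    so the maximum principle compares its value at 0 with those on the circle. *)
Fixpoint rotprod (l : list C) (h : R) (n : nat) (z : C) : C :=
  match n with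
  | O => RtoC 1
  | S m => (rotprod l h m z * peval l (z * cis (INR m * h)))%C
  end.

Lemma ispoly_rotprod (l : list C) (h : R) (n : nat) : ispoly (rotprod l h n).
Proof.
  induction n as [|n IH]; simpl; [apply ispoly_const|].
  apply ispoly_mult; [exact IH|].
  generalize (cis (INR n * h)). intros c. clear IH.
  induction l as [|a l IHl]; simpl; [apply ispoly_const|].
  apply ispoly_ext with (fun z => a + z * (c * peval l (z * c)))%C; [intros; ring|].
  now apply ispoly_cons, ispoly_scal.
Qed.

Lemma rotprod_0 (l : list C) (h : R) (n : nat) :
  rotprod l h n (RtoC 0) = (peval l (RtoC 0) ^ n)%C.
Proof.
  induction n as [|n IH]; simpl; [easy|]. rewrite IH.
  replace (RtoC 0 * cis (INR n * h))%C with (RtoC 0) by ring. ring.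
Qed.

Lemma rotprod_le (l : list C) (h delta theta : R) (n : nat) : 0 < delta ->
  Cmod (rotprod l h n (cis theta))
    <= exp (Rsum (fun k => lnmax delta (peval l (cis (theta + INR k * h)))) n).
Proof.
  intros Hd. induction n as [|n IH]; simpl Rsum; simpl rotprod.
  - rewrite Cmod_1, exp_0. lra.
  - rewrite Cmod_mult, exp_plus, <- cis_plus.
    apply Rmult_le_compat; auto using Cmod_ge_0.
    unfold lnmax.
    assert (H1 := Rmax_l (Cmod (peval l (cis (theta + INR n * h)))) delta).
    assert (H2 := Rmax_r (Cmod (peval l (cis (theta + INR n * h)))) delta).
    rewrite exp_ln by lra. exact H1.
Qed.

Lemma cis_period (t : R) : cis (t + 2 * PI) = cis t.
Proof.
  rewrite cis_plus. replace (2 * PI) with (2 * PI * INR 1) by (simpl; ring).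
  rewrite cis_2PI. ring.
Qed.

(* Jensen's inequality without factorization: by the maximum principle the product of [f] over
   some rotated regular [n]-gon is at least [|f(0)|^n], and the logarithm of that product is a
   Riemann sum. *)
Lemma lnmax_submean (q : C -> C) (delta : R) : ispoly q -> 0 < delta ->
  2 * PI * lnmax delta (q (RtoC 0)) <= RInt (fun t => lnmax delta (q (cis t))) 0 (2 * PI).
Proof.
  intros [l Hl] Hd.
  rewrite (RInt_ext _ (fun t => lnmax delta (peval l (cis t)))) by (intros; now rewrite Hl).
  rewrite Hl. clear q Hl.
  destruct (peval_cis_lipschitz l) as [K0 [_ [HK0 [_ [_ Hlip0]]]]].
  set (U := fun t => lnmax delta (peval l (cis t))).
  set (K := / delta * K0).
  assert (Hid : 0 < / delta) by now apply Rinv_0_lt_compat.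
  assert (HK : 0 <= K) by (apply Rmult_le_pos; lra).
  assert (Hlip : lipschitz_with K U).
  { intros s t. unfold U, K. eapply Rle_trans; [now apply lnmax_lipschitz|].
    rewrite Rmult_assoc. apply Rmult_le_compat_l; [lra | apply Hlip0]. }
  assert (HPI := PI_RGT_0).
  set (I := RInt U 0 (2 * PI)).
  assert (Hex : forall a b, ex_RInt U a b) by (intros; now apply lipschitz_ex_RInt with K).
  assert (Hlow : 2 * PI * ln delta <= I).
  { replace (2 * PI * ln delta) with (RInt (fun _ => ln delta) 0 (2 * PI)).
    - apply RInt_le; [lra | apply ex_RInt_const | apply Hex |].
      intros t _. unfold U, lnmax.
      assert (H := Rmax_r (Cmod (peval l (cis t))) delta).
      destruct H as [H|H]; [left; now apply ln_increasing | right; now rewrite <- H].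
    - rewrite RInt_const. unfold scal; simpl; unfold mult; simpl. ring. }
  (* When [|q(0)| <= delta] the left side is [2 PI ln delta], and [Hlow] suffices. Otherwise the
     truncation is inactive at the centre. *)
  unfold lnmax. destruct (Rle_dec (Cmod (peval l (RtoC 0))) delta) as [Hc|Hc].
  { now rewrite Rmax_right. }
  rewrite Rmax_left by lra. apply Rnot_le_lt in Hc.
  set (c := Cmod (peval l (RtoC 0))) in *.
  assert (Hstep : forall n, (0 < n)%nat -> 2 * PI * ln c <= I + 2 * PI * (K * (2 * PI)) * / INR n).
  { intros n Hn. assert (Hn' : 0 < INR n) by now apply lt_0_INR.
    set (h := 2 * PI / INR n).
    assert (Hh : 0 < h) by (apply Rdiv_lt_0_compat; lra).
    assert (Hnh : INR n * h = 2 * PI) by (unfold h; field; lra).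
    destruct (ispoly_rotprod l h n) as [g Hg].
    (* [B] bounds the sum of the logarithms over any rotated polygon: the Riemann sum exceeds the
       integral by at most [2 PI K h], an error of order [1 / n] that disappears at the end. *)
    set (B := (I + 2 * PI * (K * h)) / h).
    assert (Hmax : c ^ n <= exp B).
    { unfold c. rewrite <- Cmod_pow, <- (rotprod_0 l h n), Hg.
      apply peval_max_principle. intros theta. rewrite <- Hg.
      eapply Rle_trans; [now apply rotprod_le with (delta := delta)|].
      assert (HR := Riemann_lower K U theta h n HK ltac:(lra) Hlip).
      rewrite Hnh, (RInt_period K) in HR.
      - fold I in HR. fold U.
        change (fun k => lnmax delta (peval l (cis (theta + INR k * h))))
          with (fun k => U (theta + INR k * h)).
        set (s := Rsum (fun k => U (theta + INR k * h)) n) in *.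
        assert (Hs : s <= B).
        { unfold B. apply (Rmult_le_reg_r h); [easy|].
          replace ((I + 2 * PI * (K * h)) / h * h) with (I + 2 * PI * (K * h)) by (field; lra).
          rewrite <- Hnh at 1. lra. }
        destruct Hs as [Hs|Hs]; [left; now apply exp_increasing | right; now rewrite Hs].
      - exact Hlip.
      - intros t. unfold U. now rewrite cis_period. }
    assert (Hln : INR n * ln c <= B).
    { rewrite <- ln_pow by lra. rewrite <- (ln_exp B).
      destruct Hmax as [H|H]; [left; apply ln_increasing; [apply pow_lt; lra | easy]
                              | right; now rewrite H]. }
    rewrite <- Hnh at 1.
    replace (INR n * h * ln c) with (INR n * ln c * h) by ring.
    eapply Rle_trans; [apply Rmult_le_compat_r; [lra | exact Hln]|].
    unfold B. replace ((I + 2 * PI * (K * h)) / h * h) with (I + 2 * PI * (K * h)) by (field; lra).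
    right. unfold h, Rdiv. ring. }
  apply le_epsilon. intros eps Heps.
  set (A := 2 * PI * (K * (2 * PI))) in *.
  assert (HA : 0 <= A) by (unfold A; apply Rmult_le_pos; [lra|]; apply Rmult_le_pos; lra).
  destruct (archimed_cor1 (eps / (A + 1))) as [n [Hn1 Hn2]]; [apply Rdiv_lt_0_compat; lra|].
  specialize (Hstep n Hn2).
  assert (Hn' : 0 < / INR n) by (apply Rinv_0_lt_compat, lt_0_INR; lia).
  assert ((A + 1) * / INR n < eps).
  { replace eps with ((A + 1) * (eps / (A + 1))) by (field; lra).
    apply Rmult_lt_compat_l; lra. }
  lra.
Qed.

(** * The potential as a decreasing limit *)

Lemma polyfun_cline (P : C2 -> C) (a b : C2) :
  polyfun P -> ispoly (fun zeta => P (cline a b zeta)).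
Proof.
  intros HP. destruct (polyfun_dirD P b HP) as [D [_ HD]]. destruct (HD a) as [A [HA E]].
  apply ispoly_ext with (fun z => P a + z * (D a + z * A z))%C; [intros; now rewrite E|].
  now apply ispoly_cons, ispoly_cons.
Qed.

(** Truncating at [acoef n] makes the logarithm finite and Lipschitz on circles, and is compatible
    with the dynamics because [acoef (S n)] is [acoef n ^ 2]. The summand [ln 2] turns the estimate
    [m_(n+1) <= 2 m_n^2] for the maximum into [2 m_(n+1) <= (2 m_n)^2], hence monotonicity. *)
Definition psi (n : nat) (z : C2) : R :=
  / 2 ^ n * (ln 2 + Rmax (lnmax (acoef n) (fst (orb n z))) (lnmax (acoef n) (snd (orb n z)))).

Lemma inv_pow2_pos (n : nat) : 0 < / 2 ^ n.
Proof. apply Rinv_0_lt_compat, pow_lt. lra. Qed.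

Lemma Rmax_lipschitz (a b c d K : R) :
  Rabs (a - c) <= K -> Rabs (b - d) <= K -> Rabs (Rmax a b - Rmax c d) <= K.
Proof.
  intros H1 H2. apply Rabs_le_between in H1, H2. apply Rabs_le.
  unfold Rmax. destruct (Rle_dec a b), (Rle_dec c d); lra.
Qed.

Lemma psi_circle_lipschitz (n : nat) (a b : C2) :
  exists K, lipschitz_with K (fun t => psi n (cline a b (cis t))).
Proof.
  destruct (polyfun_cline _ a b (proj1 (polymap_orb n))) as [l1 E1].
  destruct (polyfun_cline _ a b (proj2 (polymap_orb n))) as [l2 E2].
  destruct (peval_cis_lipschitz l1) as [K1 [_ [HK1 [_ [_ L1]]]]].
  destruct (peval_cis_lipschitz l2) as [K2 [_ [HK2 [_ [_ L2]]]]].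
  assert (Ha := acoef_pos n). assert (Hp := inv_pow2_pos n).
  assert (Hia : 0 < / acoef n) by now apply Rinv_0_lt_compat.
  exists (/ 2 ^ n * (/ acoef n * (K1 + K2))). intros s t. unfold psi.
  rewrite !E1, !E2.
  rewrite <- Rmult_minus_distr_l, Rabs_mult, (Rabs_pos_eq (/ 2 ^ n)), Rmult_assoc by lra.
  apply Rmult_le_compat_l; [lra|].
  match goal with |- Rabs (_ + ?u - (_ + ?v)) <= _ =>
    replace (ln 2 + u - (ln 2 + v)) with (u - v) by ring end.
  specialize (L1 s t). specialize (L2 s t). assert (H0 := Rabs_pos (s - t)).
  assert (Hmul : forall K X, X <= K * Rabs (s - t) -> 0 <= K -> K <= K1 + K2 ->
            / acoef n * X <= / acoef n * (K1 + K2) * Rabs (s - t)).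
  { intros K X HX HK HKK. rewrite Rmult_assoc. apply Rmult_le_compat_l; [lra|].
    eapply Rle_trans; [exact HX|]. apply Rmult_le_compat_r; lra. }
  apply Rmax_lipschitz; (eapply Rle_trans; [now apply lnmax_lipschitz|]).
  - apply Hmul with K1; lra.
  - apply Hmul with K2; lra.
Qed.

(** A maximum of functions with the sub-mean value property: the coordinate attaining the maximum at
    the centre is dominated by [psi n] on the whole circle. *)
Lemma psi_submean (n : nat) (a b : C2) :
  2 * PI * psi n a <= RInt (fun t => psi n (cline a b (cis t))) 0 (2 * PI).
Proof.
  assert (Ha := acoef_pos n). assert (Hp := inv_pow2_pos n). assert (HPI := PI_RGT_0).
  destruct (psi_circle_lipschitz n a b) as [K HK].
  assert (Hex := lipschitz_ex_RInt K _ 0 (2 * PI) HK).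
  assert (Hone : forall P, polyfun P ->
     (forall z, / 2 ^ n * (ln 2 + lnmax (acoef n) (P z)) <= psi n z) ->
     2 * PI * (/ 2 ^ n * (ln 2 + lnmax (acoef n) (P a)))
       <= RInt (fun t => psi n (cline a b (cis t))) 0 (2 * PI)).
  { intros P HP Hle.
    assert (Hpoly := polyfun_cline P a b HP).
    assert (Hs := lnmax_submean _ (acoef n) Hpoly Ha). cbv beta in Hs. rewrite cline_0 in Hs.
    set (U := fun t => lnmax (acoef n) (P (cline a b (cis t)))) in *.
    assert (HU : ex_RInt U 0 (2 * PI)).
    { destruct Hpoly as [l Hl]. destruct (peval_cis_lipschitz l) as [K1 [_ [_ [_ [_ L]]]]].
      apply lipschitz_ex_RInt with (/ acoef n * K1). intros s t. unfold U. rewrite !Hl.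
      eapply Rle_trans; [now apply lnmax_lipschitz|]. rewrite Rmult_assoc.
      apply Rmult_le_compat_l; [|apply L]. left. now apply Rinv_0_lt_compat. }
    assert (HI : is_RInt (fun t => / 2 ^ n * (ln 2 + U t)) 0 (2 * PI)
                   (/ 2 ^ n * (2 * PI * ln 2 + RInt U 0 (2 * PI)))).
    { apply (is_RInt_scal (V := R_NormedModule)). apply (is_RInt_plus (V := R_NormedModule)).
      - replace (2 * PI * ln 2) with (scal (2 * PI - 0) (ln 2))
          by (unfold scal; simpl; unfold mult; simpl; ring).
        apply (is_RInt_const (V := R_NormedModule)).
      - now apply (RInt_correct (V := R_CompleteNormedModule)). }
    apply Rle_trans with (/ 2 ^ n * (2 * PI * ln 2 + RInt U 0 (2 * PI))).
    - replace (2 * PI * (/ 2 ^ n * (ln 2 + lnmax (acoef n) (P a))))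
        with (/ 2 ^ n * (2 * PI * ln 2 + 2 * PI * lnmax (acoef n) (P a))) by ring.
      apply Rmult_le_compat_l; lra.
    - rewrite <- (is_RInt_unique _ _ _ _ HI).
      apply RInt_le; [lra | eexists; exact HI | exact Hex | intros t _; apply Hle]. }
  assert (H1 := Hone _ (proj1 (polymap_orb n))). assert (H2 := Hone _ (proj2 (polymap_orb n))).
  unfold psi at 1.
  unfold Rmax at 1. destruct (Rle_dec _ _).
  - apply H2. intros z. unfold psi. apply Rmult_le_compat_l; [lra|].
    assert (H := Rmax_r (lnmax (acoef n) (fst (orb n z))) (lnmax (acoef n) (snd (orb n z)))). lra.
  - apply H1. intros z. unfold psi. apply Rmult_le_compat_l; [lra|].
    assert (H := Rmax_l (lnmax (acoef n) (fst (orb n z))) (lnmax (acoef n) (snd (orb n z)))). lra.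
Qed.

Definition mmax (n : nat) (z : C2) : R :=
  Rmax (Rmax (Cmod (fst (orb n z))) (acoef n)) (Rmax (Cmod (snd (orb n z))) (acoef n)).

Lemma mmax_pos (n : nat) (z : C2) : 0 < mmax n z.
Proof.
  assert (H1 := Rmax_l (Rmax (Cmod (fst (orb n z))) (acoef n)) (Rmax (Cmod (snd (orb n z))) (acoef n))).
  assert (H2 := Rmax_r (Cmod (fst (orb n z))) (acoef n)). assert (Ha := acoef_pos n).
  unfold mmax. lra.
Qed.

Lemma psi_mmax (n : nat) (z : C2) : psi n z = / 2 ^ n * ln (2 * mmax n z).
Proof.
  unfold psi. f_equal. rewrite ln_mult by (lra || apply mmax_pos). f_equal.
  unfold mmax, lnmax.
  assert (H1 := Rmax_r (Cmod (fst (orb n z))) (acoef n)).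
  assert (H2 := Rmax_r (Cmod (snd (orb n z))) (acoef n)). assert (Ha := acoef_pos n).
  set (x := Rmax (Cmod (fst (orb n z))) (acoef n)) in *.
  set (y := Rmax (Cmod (snd (orb n z))) (acoef n)) in *.
  destruct (Rle_lt_dec x y) as [[H|H]|H].
  - rewrite !Rmax_right; [easy | lra | left; apply ln_increasing; lra].
  - rewrite H, !Rmax_left by lra. easy.
  - rewrite !Rmax_left; [easy | lra | left; apply ln_increasing; lra].
Qed.

(** Since the maximum [m] includes [acoef n], each of [|z_n|^2], [a_n |w_n|], [a_n |z_n|] and
    [a_n^2] is at most [m^2]; the factor 2 comes from the two terms of the first coordinate. *)
Lemma mmax_S (n : nat) (z : C2) : 2 * mmax (S n) z <= (2 * mmax n z) ^ 2.
Proof.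
  assert (Hx : Cmod (fst (orb n z)) <= mmax n z).
  { unfold mmax. eapply Rle_trans; [|apply Rmax_l]. apply Rmax_l. }
  assert (Hy : Cmod (snd (orb n z)) <= mmax n z).
  { unfold mmax. eapply Rle_trans; [|apply Rmax_r]. apply Rmax_l. }
  assert (Ha : acoef n <= mmax n z).
  { unfold mmax. eapply Rle_trans; [|apply Rmax_r]. apply Rmax_r. }
  assert (Ha0 := acoef_pos n). assert (Hx0 := Cmod_ge_0 (fst (orb n z))).
  assert (Hy0 := Cmod_ge_0 (snd (orb n z))).
  assert (H : mmax (S n) z <= 2 * mmax n z ^ 2); [|simpl in *; lra].
  destruct (henon_step n (orb n z)) as [S1 S2].
  set (m := mmax n z) in *.
  assert (Hay : acoef n * Cmod (snd (orb n z)) <= m * m) by (apply Rmult_le_compat; lra).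
  assert (Hax : acoef n * Cmod (fst (orb n z)) <= m * m) by (apply Rmult_le_compat; lra).
  assert (Hxx : Cmod (fst (orb n z)) * Cmod (fst (orb n z)) <= m * m) by (apply Rmult_le_compat; lra).
  assert (Haa : acoef n * acoef n <= m * m) by (apply Rmult_le_compat; lra).
  assert (Hm : 0 <= m * m) by nra.
  unfold mmax. simpl orb. rewrite S2, acoef_S. simpl pow in *.
  repeat apply Rmax_lub; lra.
Qed.

Lemma psi_decr (n : nat) (z : C2) : psi (S n) z <= psi n z.
Proof.
  rewrite !psi_mmax. assert (Hm := mmax_pos n z). assert (Hm' := mmax_pos (S n) z).
  assert (Hp := inv_pow2_pos (S n)).
  replace (/ 2 ^ n * ln (2 * mmax n z)) with (/ 2 ^ (S n) * ln ((2 * mmax n z) ^ 2)).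
  - apply Rmult_le_compat_l; [lra|]. destruct (mmax_S n z) as [H|H].
    + left. apply ln_increasing; lra.
    + right. now rewrite H.
  - rewrite ln_pow by lra. simpl. field. apply pow_nonzero. lra.
Qed.

Lemma psi_le (n k : nat) (z : C2) : (n <= k)%nat -> psi k z <= psi n z.
Proof.
  intros H. induction H as [|k _ IH]; [lra|]. eapply Rle_trans; [apply psi_decr | exact IH].
Qed.

Lemma psi_lower (n : nat) (z : C2) : ln (/ 32) <= psi n z.
Proof.
  rewrite psi_mmax. assert (Hp := inv_pow2_pos n). assert (Hm := mmax_pos n z).
  assert (Ha := acoef_pos n).
  assert (H : acoef n <= 2 * mmax n z).
  { assert (acoef n <= mmax n z); [|lra].
    unfold mmax. eapply Rle_trans; [|apply Rmax_r]. apply Rmax_r. }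
  assert (Hl : ln (acoef n) <= ln (2 * mmax n z)).
  { destruct H as [H|H]; [left; now apply ln_increasing | right; now rewrite H]. }
  apply Rle_trans with (/ 2 ^ n * ln (acoef n)); [|apply Rmult_le_compat_l; lra].
  unfold acoef. rewrite ln_pow by lra. rewrite pow_INR. simpl (INR 2).
  right. replace (1 + 1) with 2 by ring. field. apply pow_nonzero. lra.
Qed.

Definition potential (z : C2) : R := real (Lim_seq (fun n => psi n z)).

Lemma potential_lim (z : C2) : is_lim_seq (fun n => psi n z) (Finite (potential z)).
Proof.
  apply Lim_seq_correct'. apply ex_finite_lim_seq_decr with (ln (/ 32)).
  - intros n. apply psi_decr.
  - intros n. apply psi_lower.
Qed.

Lemma potential_le_psi (n : nat) (z : C2) : potential z <= psi n z.
Proof.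
  apply (is_lim_seq_decr_compare (fun n => psi n z)); [apply potential_lim|].
  intros k. apply psi_decr.
Qed.

Lemma potential_upper (z : C2) : basin henon z -> potential z <= 0.
Proof.
  intros H. destruct (proj1 (basin_iff z) H (1 / 2) ltac:(lra)) as [N HN].
  destruct (HN N ltac:(lia)) as [H1 H2].
  eapply Rle_trans; [apply (potential_le_psi N)|].
  rewrite psi_mmax. assert (Hp := inv_pow2_pos N). assert (Hm := mmax_pos N z).
  assert (Ha := acoef_le N).
  assert (Hmm : mmax N z <= 1 / 2) by (unfold mmax; repeat apply Rmax_lub; lra).
  assert (Hl := ln_le_minus_1 (2 * mmax N z) ltac:(lra)). nra.
Qed.

(** An infimum of continuous functions: some [psi n z] is already below [c], remains so nearby, and
    dominates the potential. The tolerance [eta] undoes the Lipschitz constant [/ acoef n] and the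
    factor [/ 2 ^ n]. *)
Lemma potential_usc (z : C2) (c : R) : potential z < c ->
  Hierarchy.locally (z : C2h) (fun w => potential w < c).
Proof.
  intros Hc.
  assert (Hn : exists n, psi n z < c).
  { assert (Hlim := potential_lim z). apply is_lim_seq_spec in Hlim.
    assert (Heps : 0 < c - potential z) by lra.
    destruct (Hlim (mkposreal _ Heps)) as [n Hn]. exists n.
    specialize (Hn n (le_n n)). simpl in Hn. apply Rabs_def2 in Hn. lra. }
  destruct Hn as [n Hn].
  assert (Ha := acoef_pos n). assert (Hp := inv_pow2_pos n).
  assert (Hia : 0 < / acoef n) by now apply Rinv_0_lt_compat.
  set (eta := acoef n * ((c - psi n z) * 2 ^ n)).
  assert (H2n : 0 < 2 ^ n) by (apply pow_lt; lra).
  assert (Heta : 0 < eta) by (unfold eta; repeat apply Rmult_lt_0_compat; lra).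
  destruct (polyfun_continuous _ z eta (proj1 (polymap_orb n)) Heta) as [r1 [Hr1 C1]].
  destruct (polyfun_continuous _ z eta (proj2 (polymap_orb n)) Heta) as [r2 [Hr2 C2']].
  apply locally_polydisc. exists (Rmin r1 r2). split; [now apply Rmin_pos|]. intros w Hw.
  specialize (C1 w ltac:(eapply polydisc_le; [apply Rmin_l | exact Hw])).
  specialize (C2' w ltac:(eapply polydisc_le; [apply Rmin_r | exact Hw])).
  cbv beta in C1, C2'.
  eapply Rle_lt_trans; [apply (potential_le_psi n)|].
  assert (L1 := lnmax_lipschitz (acoef n) (fst (orb n w)) (fst (orb n z)) Ha).
  assert (L2 := lnmax_lipschitz (acoef n) (snd (orb n w)) (snd (orb n z)) Ha).
  assert (Hsc : forall X, X < eta -> / acoef n * X < (c - psi n z) * 2 ^ n).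
  { intros X HX. replace ((c - psi n z) * 2 ^ n) with (/ acoef n * eta)
      by (unfold eta; field; lra).
    apply Rmult_lt_compat_l; lra. }
  assert (S1 := Hsc _ C1). assert (S2 := Hsc _ C2').
  apply Rabs_le_between in L1, L2.
  set (X := Rmax (lnmax (acoef n) (fst (orb n w))) (lnmax (acoef n) (snd (orb n w)))).
  set (Y := Rmax (lnmax (acoef n) (fst (orb n z))) (lnmax (acoef n) (snd (orb n z)))).
  assert (HXY : X < Y + (c - psi n z) * 2 ^ n).
  { assert (Y1 := Rmax_l (lnmax (acoef n) (fst (orb n z))) (lnmax (acoef n) (snd (orb n z)))).
    assert (Y2 := Rmax_r (lnmax (acoef n) (fst (orb n z))) (lnmax (acoef n) (snd (orb n z)))).
    fold Y in Y1, Y2. unfold X. apply Rmax_lub_lt; lra. }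
  assert (Ez : psi n z = / 2 ^ n * (ln 2 + Y)) by reflexivity.
  change (psi n w) with (/ 2 ^ n * (ln 2 + X)).
  apply (Rmult_lt_reg_l (2 ^ n)); [easy|].
  rewrite <- Rmult_assoc, Rinv_r, Rmult_1_l by lra.
  assert (Ey : 2 ^ n * psi n z = ln 2 + Y) by (rewrite Ez; field; lra).
  lra.
Qed.

(** Monotonicity in [n] reduces the bound to stage 0, where the orbit is the point itself. This is
    the upper half of the domination used to pass to the limit under the integral. *)
Lemma psi_circle_upper (n : nat) (a b : C2) :
  exists B, forall t, psi n (cline a b (cis t)) <= B.
Proof.
  exists (/ 2 ^ 0 * (ln 2 + (Cmod (fst a) + Cmod (fst b) + (Cmod (snd a) + Cmod (snd b)) + acoef 0))).
  intros t. eapply Rle_trans; [apply (psi_le 0); lia|].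
  unfold psi. assert (Hp := inv_pow2_pos 0). apply Rmult_le_compat_l; [lra|].
  apply Rplus_le_compat_l. simpl orb. assert (Ha := acoef_pos 0).
  assert (A1 := Cmod_ge_0 (fst a)). assert (A2 := Cmod_ge_0 (fst b)).
  assert (A3 := Cmod_ge_0 (snd a)). assert (A4 := Cmod_ge_0 (snd b)).
  assert (Hgen : forall x y : C, lnmax (acoef 0) (x + cis t * y)%C <= Cmod x + Cmod y + acoef 0).
  { intros x y. unfold lnmax.
    assert (T := Cmod_triangle x (cis t * y)%C). rewrite Cmod_mult, Cmod_cis in T.
    assert (H1 := Rmax_r (Cmod (x + cis t * y)%C) (acoef 0)).
    eapply Rle_trans; [apply ln_le_minus_1; lra|].
    assert (Cmod x + Cmod y >= 0) by (assert (X1 := Cmod_ge_0 x); assert (X2 := Cmod_ge_0 y); lra).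
    assert (Rmax (Cmod (x + cis t * y)%C) (acoef 0) <= Cmod x + Cmod y + acoef 0); [|lra].
    apply Rmax_lub; lra. }
  apply Rmax_lub; unfold cline; cbn [fst snd].
  - eapply Rle_trans; [apply Hgen|]. lra.
  - eapply Rle_trans; [apply Hgen|]. lra.
Qed.

Lemma basin_small (z : C2) : Cmod (fst z) <= 3 / 4 -> Cmod (snd z) <= 3 / 4 -> basin henon z.
Proof. intros H1 H2. now apply basin_absorb with 0%nat. Qed.

(** At 0 the value is at most [psi 0 zero2 = log (2/32)]. The orbit of [(1/4, 0)] stays real and
    nonnegative, so the perturbation can only increase it: [z_n >= (1/4)^(2^n)], and the potential
    there is at least [log (1/4)]. *)
Lemma potential_nonconstant : exists z1 z2,
  basin henon z1 /\ basin henon z2 /\ potential z1 < potential z2.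
Proof.
  exists zero2, (RtoC (1 / 4), RtoC 0).
  split; [|split].
  - apply basin_small; unfold zero2; simpl; rewrite Cmod_0; lra.
  - apply basin_small; simpl; rewrite Cmod_R, Rabs_pos_eq; lra.
  - assert (H0 : psi 0 zero2 = ln (/ 16)).
    { rewrite psi_mmax. unfold mmax, zero2. simpl orb. simpl fst. simpl snd.
      assert (Ha : acoef 0 = / 32) by (unfold acoef; simpl; ring).
      rewrite Cmod_0, Ha, (Rmax_right 0) by lra. rewrite Rmax_left by lra.
      simpl. rewrite Rinv_1, Rmult_1_l. f_equal. field. }
    assert (Hpos : forall n, exists x y, orb n (RtoC (1 / 4), RtoC 0) = (RtoC x, RtoC y)
                     /\ (1 / 4) ^ (2 ^ n) <= x /\ 0 <= y).
    { induction n as [|n [x [y [E [Hx Hy]]]]].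
      - exists (1 / 4), 0. simpl. split; [easy|]. lra.
      - exists (x * x + acoef n * y), (acoef n * x).
        assert (Ha := acoef_pos n).
        assert (Hq : 0 < (1 / 4) ^ (2 ^ n)) by (apply pow_lt; lra).
        split; [|split].
        + simpl orb. rewrite E. unfold henon. cbn [fst snd].
          now rewrite RtoC_plus, !RtoC_mult.
        + replace (2 ^ S n)%nat with (2 ^ n + 2 ^ n)%nat by (simpl; lia).
          rewrite pow_add.
          assert ((1 / 4) ^ 2 ^ n * (1 / 4) ^ 2 ^ n <= x * x) by (apply Rmult_le_compat; lra).
          assert (0 <= acoef n * y) by (apply Rmult_le_pos; lra). lra.
        + apply Rmult_le_pos; lra. }
    assert (Hlow : forall n, ln (1 / 4) <= psi n (RtoC (1 / 4), RtoC 0)).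
    { intros n. destruct (Hpos n) as [x [y [E [Hx Hy]]]].
      rewrite psi_mmax. assert (Hp := inv_pow2_pos n).
      assert (Hq : 0 < (1 / 4) ^ (2 ^ n)) by (apply pow_lt; lra).
      assert (Hm : (1 / 4) ^ (2 ^ n) < 2 * mmax n (RtoC (1 / 4), RtoC 0)).
      { assert (x <= mmax n (RtoC (1 / 4), RtoC 0)); [|lra].
        unfold mmax. rewrite E. cbn [fst snd]. rewrite Cmod_R, Rabs_pos_eq by lra.
        eapply Rle_trans; [|apply Rmax_l]. apply Rmax_l. }
      apply Rle_trans with (/ 2 ^ n * ln ((1 / 4) ^ (2 ^ n))).
      - rewrite ln_pow by lra. rewrite pow_INR. simpl (INR 2).
        right. replace (1 + 1) with 2 by ring. field. apply pow_nonzero. lra.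
      - apply Rmult_le_compat_l; [lra|]. left. now apply ln_increasing. }
    apply Rlt_le_trans with (ln (1 / 4)).
    + eapply Rle_lt_trans; [apply (potential_le_psi 0)|]. rewrite H0. apply ln_increasing; lra.
    + assert (H : Rbar_le (Finite (ln (1 / 4))) (Finite (potential (RtoC (1 / 4), RtoC 0)))).
      { apply is_lim_seq_le with (u := fun _ => ln (1 / 4))
          (v := fun n => psi n (RtoC (1 / 4), RtoC 0)).
        - exact Hlow.
        - apply is_lim_seq_const.
        - apply potential_lim. }
      exact H.
Qed.

(** * Lebesgue integrals and plurisubharmonicity of the limit *)

Module LebesgueBridge.

From mathcomp Require Import all_boot all_order all_algebra.
From mathcomp Require Import all_classical all_reals all_analysis.
From mathcomp Require Import measurable_realfun Rstruct Rstruct_topology.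
Import Order.TTheory GRing.Theory Num.Theory.
Import numFieldNormedType.Exports.

Set Implicit Arguments.
Unset Strict Implicit.

Local Open Scope classical_set_scope.
Local Open Scope ring_scope.

Lemma lipschitz_mc_continuous (K : R) (f : R -> R) : lipschitz_with K f -> continuous f.
Proof.
move=> fK x; apply/continuity_ptE/continuity_pt_filterlim.
exact: (lipschitz_continuous K f _ fK).
Qed.

(* Stdlib's [R] has no normed-module instance of its own; it is found through [RT]. *)
Definition RT : realType := R.

Lemma mc_derivable (F : RT -> RT) (x l : RT) : Coquelicot.Derive.is_derive F x l ->
  derivable F x 1 /\ derive1 F x = l.
Proof.
move=> /is_derive_Reals dF.
have H : h^-1 *: (F (h *: (1 : RT) + x) - F x) @[h --> (0 : RT)^'] --> l.
  apply/cvgrPdist_lt => e e0.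
  have [d Hd] := dF e (elimT RltP e0).
  have d0 : 0 < pos d by apply/RltP; case: d {Hd}.
  near=> h.
  have h0 : h != 0 by near: h; exact: nbhs_dnbhs_neq.
  have hd : `|h| < pos d by near: h; exact: dnbhs0_lt.
  have := Hd h (elimN eqP h0).
  rewrite RabsE => /(_ (elimT RltP hd)) /RltP.
  rewrite RabsE distrC /GRing.scale /= mulr1 [h + x]addrC.
  by rewrite RdivE mulrC.
by split; [apply: cvgP H|rewrite derive1E; apply: cvg_lim H].
Unshelve. all: by end_near.
Qed.

(** The Riemann integral with variable upper end is a primitive of [f], so the fundamental theorem
    for the Lebesgue integral returns the same number. *)
Lemma lebesgue_RInt (K : R) (f : R -> R) (T : R) : Rlt 0 T -> lipschitz_with K f ->
  (\int[@lebesgue_measure R]_(t in `[0%R, T]) (f t)%:E = (RInt f 0%R T)%:E)%E.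
Proof.
move=> T0 fK.
have fc := lipschitz_mc_continuous fK.
have dF x : Coquelicot.Derive.is_derive (fun y => RInt f 0%R y) x (f x).
  apply: (is_derive_RInt f _ 0%R x); last exact: (lipschitz_continuous K f _ fK).
  exists (mkposreal 1%R Rlt_0_1) => y _.
  by apply: RInt_correct; exact: (lipschitz_ex_RInt K f _ _ fK).
have Fc : continuous (fun y : R => RInt f 0%R y : R).
  move=> x; apply/continuity_ptE/continuity_pt_filterlim.
  by apply: ex_derive_continuous; exists (f x).
rewrite (@continuous_FTC2 R f (fun y => RInt f 0%R y) 0%R T).
- by rewrite RInt_point sube0.
- exact/RltP.
- exact: continuous_subspaceT.
- split.
  + by move=> x _; have [] := mc_derivable (dF x).
  + exact/cvg_at_right_filter/Fc.
  + exact/cvg_at_left_filter/Fc.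
- by move=> x _; have [] := mc_derivable (dF x).
Qed.

(** Dominated convergence with the constant [|m| + |B|]. The integrands [U n] are Lipschitz, so
    their integrals may be read as Riemann integrals, while [V] is given only as a pointwise limit
    and is integrated in the sense of Lebesgue. *)
Lemma lebesgue_limit_le (U : nat -> R -> R) (V : R -> R) (m B c T : R) :
  Rlt 0 T ->
  (forall n, exists K, lipschitz_with K (U n)) ->
  (forall n t, Rle m (U n t) /\ Rle (U n t) B) ->
  (forall t, is_lim_seq (fun n => U n t) (Rbar.Finite (V t))) ->
  (forall n, Rle (Rmult T c) (RInt (U n) 0%R T)) ->
  (c%:E <= (Rinv T)%:E * \int[@lebesgue_measure R]_(t in `[0%R, T]) (V t)%:E)%E.
Proof.
move=> T0 UK UB UV Uc.
have T0' : (0 < T)%R by exact/RltP.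
have cvgI : (\int[@lebesgue_measure R]_(t in `[0%R, T]) (U n t)%:E)%E @[n --> \oo] -->
  (\int[@lebesgue_measure R]_(t in `[0%R, T]) (V t)%:E)%E.
  apply: (@dominated_cvg _ _ _ _ _ _ _ _ (fun=> (Rabs m + Rabs B)%:E)).
  - exact: measurable_itv.
  - move=> n; apply/measurable_EFinP; apply: measurable_funTS.
    have [K UnK] := UK n.
    exact: continuous_measurable_fun (lipschitz_mc_continuous UnK).
  - move=> t _; apply: cvg_EFin; first exact: nearW.
    apply/cvgrPdist_lt => e e0.
    have /is_lim_seq_spec Ut := UV t.
    have [N HN] := Ut (mkposreal e (elimT RltP e0)).
    near=> n.
    have Nn : (N <= n)%N by near: n; exact: nbhs_infty_ge.
    have := HN n (elimT ssrnat.leP Nn).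
    by rewrite /= RabsE distrC => /RltP.
  - by [].
  - apply: (@continuous_compact_integrable R (cst (Rabs m + Rabs B))).
      exact: segment_compact.
    by apply: continuous_subspaceT; exact: cst_continuous.
  - move=> n t _; rewrite lee_fin -RabsE; apply/RleP.
    have [H1 H2] := UB n t.
    have Hm := Rle_abs (- m); have Hm' := Rabs_Ropp m; have HB := Rle_abs B.
    have Hm0 := Rabs_pos m; have HB0 := Rabs_pos B.
    by rewrite -RplusE; apply: Rabs_le; lra.
rewrite RinvE lee_pdivlMl // -EFinM.
rewrite -(cvg_lim _ cvgI) //; apply: lime_ge; first exact: cvgP cvgI.
apply: nearW => n; have [K UnK] := UK n.
by rewrite (lebesgue_RInt T0 UnK) lee_fin; apply/RleP; exact: Uc.
Unshelve. all: by end_near.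
Qed.

Lemma EFin_lt (x c : R) : (x%:E < c%:E)%E <-> Rlt x c.
Proof. by rewrite lte_fin; split=> [/RltP|?]; last exact/RltP. Qed.

Lemma EFin_le (x c : R) : Rle x c -> (x%:E <= c%:E)%E.
Proof. by move=> ?; rewrite lee_fin; exact/RleP. Qed.

(** The number [potential a] lies below every [psi n a], hence below every circle mean of [psi n];
    the uniform bounds [ln (/ 32)] and [B] let these means converge to the mean of the potential. *)
Lemma potential_psh (Om : C2 -> Prop) : psh_on Om (fun z => (potential z)%:E).
Proof.
split=> [//|]; split.
  move=> z _ c /EFin_lt zc.
  have [r [r0 H]] := proj1 (locally_polydisc z _) (potential_usc z c zc).
  by apply/locally_polydisc; exists r; split=> // w Hw; apply/EFin_lt; exact: H.
move=> a b _.
have [B HB] := psi_circle_upper 0 a b.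
apply: (@lebesgue_limit_le (fun n t => psi n (cline a b (cis t)))
  (fun t => potential (cline a b (cis t))) (Rpower.ln (Rinv (IZR 32))) B).
- by have := PI_RGT_0; lra.
- by move=> n; exact: psi_circle_lipschitz.
- move=> n t; split; first exact: psi_lower.
  by apply: Rle_trans (HB t); apply: psi_le; apply/ssrnat.leP.
- by move=> t; exact: potential_lim.
- move=> n; apply: Rle_trans (psi_submean n a b).
  apply: Rmult_le_compat_l; first by have := PI_RGT_0; lra.
  exact: potential_le_psi.
Qed.

Lemma basin_bounded_psh : exists u : C2 -> \bar R,
  psh_on (basin henon) u /\
  (exists M : R, forall z, basin henon z -> (u z <= M%:E)%E) /\
  (exists z1 z2 : C2, basin henon z1 /\ basin henon z2 /\ u z1 <> u z2).
Proof.
exists (fun z => (potential z)%:E); split; first exact: potential_psh.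
split; first by exists (IZR 0) => z /potential_upper; exact: EFin_le.
have [z1 [z2 [b1 [b2 lt12]]]] := potential_nonconstant.
exists z1, z2; split=> //; split=> // -[E].
by move: lt12; rewrite E; exact: Rlt_irrefl.
Qed.

End LebesgueBridge.

Theorem theorem1p5 :
  exists F : nat -> C2 -> C2,
    (forall n, holo_automorphism (F n) /\ attracting_fixed_origin (F n)) /\
    short_C2 (basin F) /\ smooth_boundary (basin F).
Proof.
  exists henon. split; [|split; [split; [|split]|]].
  - intros n. split; [apply henon_automorphism | apply henon_attracting].
  - exists exhaust. split; [exact exhaust_incr|].
    split; [exact exhaust_basin | exact exhaust_biholo].
  - intros p v. apply kobayashi_basin.
  - exact LebesgueBridge.basin_bounded_psh.
  - exact smooth_boundary_basin.
Qed.
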